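(* For $x=(x_1,x_2)$ sufficiently close to $(0,0)$ (so close that the hypersurface $Q=\{t\in\mathbb C^4\mid t_1t_2t_3t_4-t_3t_4x_1-t_1t_2x_2=0\}$ does not meet any component of the chain $\Delta_{00}$), the hypergeometric series admits the Euler type integral representation $$F\left(\begin{matrix}a\\ B\end{matrix};x\right)=C_{00}\int_{\Delta_{00}}u(t,x)\,dt,$$ where $dt=dt_1\wedge dt_3\wedge dt_2\wedge dt_4$, $$u(t,x)=\Bigl(\prod_{j=1}^4t_j^{-b_j}\Bigr)(1-t_1-t_3)^{b_1+b_3-a_1-2}(1-t_2-t_4)^{b_2+b_4-a_2-2}\Bigl(1-\frac{x_1}{t_1t_2}-\frac{x_2}{t_3t_4}\Bigr)^{-a_3},$$ $$C_{00}=\frac{\Gamma(1-a_1)\Gamma(1-a_2)}{\Gamma(1-b_1)\Gamma(1-b_3)\Gamma(b_1+b_3-a_1-1)\Gamma(1-b_2)\Gamma(1-b_4)\Gamma(b_2+b_4-a_2-1)},$$ and $\Delta_{00}$ is the $4$-chain given by the regularization of $\triangle_1\times\triangle_2$ associated with $$u(t,0,0)=t_1^{-b_1}t_3^{-b_3}(1-t_1-t_3)^{b_1+b_3-a_1-2}\,t_2^{-b_2}t_4^{-b_4}(1-t_2-t_4)^{b_2+b_4-a_2-2},$$ with $\triangle_1=\{(t_1,t_3)\in\mathbb R^2\mid t_1>0,t_3>0,1-t_1-t_3>0\}$ and $\triangle_2=\{(t_2,t_4)\in\mathbb R^2\mid t_2>0,t_4>0,1-t_2-t_4>0\}$.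
   Context: With $(\alpha,n)=\alpha(\alpha+1)\cdots(\alpha+n-1)$, $a=(a_1,a_2,a_3)$, $B=\begin{pmatrix}b_1&b_2&1\\ b_3&b_4&1\end{pmatrix}$, $$F\left(\begin{matrix}a\\ B\end{matrix};x\right)=\sum_{n_1,n_2\ge0}\frac{(a_1,n_1+n_2)(a_2,n_1+n_2)(a_3,n_1+n_2)}{(b_1,n_1)(b_2,n_1)(1,n_1)(b_3,n_2)(b_4,n_2)(1,n_2)}x_1^{n_1}x_2^{n_2}.$$ The parameters are such that the regularization is defined and the Gamma factor is finite: $b_1,b_2,b_3,b_4,b_1+b_3-a_1,b_2+b_4-a_2\notin\mathbb Z$ and $a_1,a_2\notin\{1,2,\dots\}$. Regularization: let $P\subset\mathbb R^2$ be an open triangle whose three edge lines carry non-integral exponents $p_1,p_2,p_3$ of a weight $w$ (a product of powers of linear forms positive on $P$). The regularization of $P$ associated with $w$ is the compact twisted $2$-cycle $$\sigma+\sum_i\frac{S_i\times\sigma_i}{e^{2\pi\sqrt{-1}p_i}-1}+\sum_{i<j}\frac{S_i\times S_j}{(e^{2\pi\sqrt{-1}p_i}-1)(e^{2\pi\sqrt{-1}p_j}-1)}$$ loaded with the branch of $w$ that is positive-argument-zero on $P$ and its continuation, where $\sigma$ is $P$ with small tubular neighborhoods of its edges removed, $\sigma_i$ is the edge of $\sigma$ along the $i$-th line, $S_i$ is a small positively oriented circle around the complexified $i$-th line starting on $\sigma$, and orientations are such that the boundary vanishes. Equivalently, it is the compact twisted cycle supported in a small neighborhood of $\overline P$ which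 is homologous, as a locally finite twisted chain, to $P$ loaded with $w$. The regularization of $\triangle_1\times\triangle_2$ is the product of those of $\triangle_1$ and $\triangle_2$ with weights the $(t_1,t_3)$- and $(t_2,t_4)$-factors of $u(t,0,0)$, oriented by $dt$. For $x$ close to $0$ one has $|x_1/(t_1t_2)+x_2/(t_3t_4)|<1$ on $\Delta_{00}$, and the branch of the last factor of $u(t,x)$ is the one that equals $1$ at $x=0$ (principal branch). *)

(* Defs.v *)
From Stdlib Require Import Reals List Factorial.
From Coquelicot Require Import Coquelicot.
Import ListNotations.
Open Scope R_scope.
Open Scope C_scope.

(** * Complex exponential, logarithm and Gamma function *)

Definition Cexp (z : C) : C :=
  (exp (Re z) * cos (Im z), exp (Re z) * sin (Im z))%R.

(* Principal argument, with values in (-pi, pi] for z <> 0. *)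
Definition Carg (z : C) : R :=
  if Rle_dec 0 (Im z) then acos (Re z / Cmod z) else (- acos (Re z / Cmod z))%R.

Definition Clog (z : C) : C := (ln (Cmod z), Carg z).

Definition is_int (z : C) : Prop := exists n : Z, z = RtoC (IZR n).

Definition Clim_seq (s : nat -> C) : C :=
  (real (Lim_seq (fun n => Re (s n))), real (Lim_seq (fun n => Im (s n)))).

(* (alpha, n) = alpha (alpha + 1) ... (alpha + n - 1) *)
Fixpoint poch (alpha : C) (n : nat) : C :=
  match n with
  | O => 1
  | S m => poch alpha m * (alpha + RtoC (INR m))
  end.

(* Euler's limit  n! n^z / (z (z+1) ... (z+n)), which gives the meromorphic
   Gamma function at every z outside {0, -1, -2, ...}. *)
Definition Cgamma (z : C) : C :=
  Clim_seq (fun n => RtoC (INR (fact n)) * Cexp (z * RtoC (ln (INR n)))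
                     / poch z (S n)).

(** * The hypergeometric series *)

Definition double_partial_sum (s : nat -> nat -> C) (N : nat) : C :=
  sum_n (fun i => sum_n (fun j => s i j) N) N.

Definition abs_summable (s : nat -> nat -> C) : Prop :=
  exists M : R, forall N : nat,
    (sum_n (fun i => sum_n (fun j => Cmod (s i j)) N) N <= M)%R.

Definition F_term (a1 a2 a3 b1 b2 b3 b4 x1 x2 : C) (n1 n2 : nat) : C :=
  poch a1 (n1 + n2) * poch a2 (n1 + n2) * poch a3 (n1 + n2)
  / (poch b1 n1 * poch b2 n1 * poch 1 n1 * poch b3 n2 * poch b4 n2 * poch 1 n2)
  * (x1 ^ n1) * (x2 ^ n2).

Definition F (a1 a2 a3 b1 b2 b3 b4 x1 x2 : C) : C :=
  Clim_seq (double_partial_sum (F_term a1 a2 a3 b1 b2 b3 b4 x1 x2)).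

(** * Regularization of the standard triangle

    The triangle s > 0, t > 0, 1 - s - t > 0 in the (s, t)-plane is bounded by
    the zero lines of the three linear forms l_L1 = s, l_L2 = t and
    l_L3 = 1 - s - t. *)

Inductive line : Type := L1 | L2 | L3.

Definition line_eqb (i j : line) : bool :=
  match i, j with
  | L1, L1 | L2, L2 | L3, L3 => true
  | _, _ => false
  end.

(* Since l_L1 + l_L2 + l_L3 = 1, one has
   ds /\ dt = dl_i /\ dl_(next i) for every line i. *)
Definition next (i : line) : line :=
  match i with L1 => L2 | L2 => L3 | L3 => L1 end.

(* The point with l_i = z and l_(next i) = w, as the function j |-> l_j. *)
Definition point_at (i : line) (z w : C) (j : line) : C :=
  if line_eqb j i then z else if line_eqb j (next i) then w else 1 - z - w.

(* A point of C^2 off the three lines, given by the values [form] of the linear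
   forms there, together with a value [branch] of the logarithm of each form. *)
Record loaded_point := LoadedPoint {
  form : line -> C;
  branch : line -> C
}.

(* Value at a loaded point of the multivalued function l_i ^ p. *)
Definition bpow (P : loaded_point) (i : line) (p : C) : C :=
  Cexp (p * branch P i).

(* A 2-cell parametrized by the unit square, oriented by du /\ dv, with a
   branch of the weight continued along it. *)
Definition cell : Type := R -> R -> loaded_point.

Definition chain : Type := list (C * cell).

(* exp (2 pi sqrt(-1) p) - 1 *)
Definition monodromy_minus_1 (p : C) : C := Cexp (2 * PI * Ci * p) - 1.

(* Circle of radius eps around 0, starting at eps > 0, and the logarithm
   continued along it. *)
Definition circle (eps u : R) : C := eps * Cexp (2 * PI * u * Ci).
Definition circle_log (eps u : R) : C := ln eps + 2 * PI * u * Ci.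

(* sigma : the closed triangle where all three forms are >= eps; all forms are
   positive there. *)
Definition sigma_cell (eps : R) : cell := fun u v =>
  let l := point_at L1 (eps + (1 - 3 * eps) * u)
                       (eps + (1 - 3 * eps) * (1 - u) * v) in
  LoadedPoint l (fun j => Clog (l j)).

(* S_i x sigma_i : l_i runs over the circle S_i while the point moves from
   l_(next i) = eps to l_(next (next i)) = eps.  For u = 0 this is the edge
   sigma_i of sigma, with the orientation opposite to that of the boundary of
   sigma.  The forms other than l_i keep a positive real part, so that their
   logarithms stay principal. *)
Definition tube_cell (eps : R) (i : line) : cell := fun u v =>
  let z := circle eps u in
  let l := point_at i z ((1 - v) * eps + v * (1 - z - eps)) in
  LoadedPoint l
    (fun j => if line_eqb j i then circle_log eps u else Clog (l j)).

(* S_i x S_(next i) *)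
Definition torus_cell (eps : R) (i : line) : cell := fun u v =>
  let l := point_at i (circle eps u) (circle eps v) in
  LoadedPoint l
    (fun j => if line_eqb j i then circle_log eps u
              else if line_eqb j (next i) then circle_log eps v
              else Clog (l j)).

(* Regularization of the triangle for the weight prod_i l_i ^ (p i).  The tori
   occur as S_1 x S_2, S_2 x S_3, S_3 x S_1: with the edges oriented as above,
   this cyclic order is the one for which the twisted boundary vanishes. *)
Definition regularization (p : line -> C) (eps : R) : chain :=
  let c i := monodromy_minus_1 (p i) in
  (RtoC 1, sigma_cell eps)
  :: map (fun i => (1 / c i, tube_cell eps i)) [L1; L2; L3]
  ++ map (fun i => (1 / (c i * c (next i)), torus_cell eps i)) [L1; L2; L3].

Definition in_support (D : chain) (s t : C) : Prop :=
  exists (k : C) (c : cell) (u v : R),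
    In (k, c) D /\ (0 <= u <= 1)%R /\ (0 <= v <= 1)%R /\
    s = form (c u v) L1 /\ t = form (c u v) L2.

(** * Integration over products of chains *)

Definition CDerive (f : R -> C) (x : R) : C :=
  (Derive (fun y => Re (f y)) x, Derive (fun y => Im (f y)) x).

(* Pull-back of ds /\ dt: the coefficient of du /\ dv. *)
Definition jacobian (c : cell) (u v : R) : C :=
  CDerive (fun y => form (c y v) L1) u * CDerive (fun y => form (c u y) L2) v
  - CDerive (fun y => form (c u y) L1) v * CDerive (fun y => form (c y v) L2) u.

Definition CInt (f : R -> C) : C := @RInt C_R_CompleteNormedModule f 0 1.

Definition cell_integral (f : loaded_point -> loaded_point -> C)
    (c c' : cell) : C :=
  CInt (fun u => CInt (fun v => CInt (fun u' => CInt (fun v' =>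
    f (c u v) (c' u' v') * jacobian c u v * jacobian c' u' v')))).

Definition Csum {T : Type} (g : T -> C) (l : list T) : C :=
  fold_right (fun y s => g y + s) (RtoC 0) l.

(* Integral over D x D' of f (P, P') ds /\ dt /\ ds' /\ dt'. *)
Definition product_integral (D D' : chain)
    (f : loaded_point -> loaded_point -> C) : C :=
  Csum (fun kc => Csum (fun kc' =>
    fst kc * fst kc' * cell_integral f (snd kc) (snd kc')) D') D.

(** * The integrand, the chain Delta_00 and the constant C_00 *)

(* Exponents of s, t and 1 - s - t in s^(-b) t^(-b') (1 - s - t)^(b + b' - a - 2). *)
Definition exponents (a b b' : C) (i : line) : C :=
  match i with L1 => - b | L2 => - b' | L3 => b + b' - a - 2 end.

(* Delta_00 is Delta1 x Delta2, with coordinates (t1, t3) on the first factor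
   and (t2, t4) on the second one. *)
Definition Delta1 (a1 b1 b3 : C) (eps : R) : chain :=
  regularization (exponents a1 b1 b3) eps.
Definition Delta2 (a2 b2 b4 : C) (eps : R) : chain :=
  regularization (exponents a2 b2 b4) eps.

(* P is the loaded point over (t1, t3), P' the one over (t2, t4). *)
Definition u_integrand (a1 a2 a3 b1 b2 b3 b4 x1 x2 : C)
    (P P' : loaded_point) : C :=
  let t1 := form P L1 in let t3 := form P L2 in
  let t2 := form P' L1 in let t4 := form P' L2 in
  bpow P L1 (- b1) * bpow P' L1 (- b2) * bpow P L2 (- b3) * bpow P' L2 (- b4)
  * bpow P L3 (b1 + b3 - a1 - 2) * bpow P' L3 (b2 + b4 - a2 - 2)
  * Cexp (- a3 * Clog (1 - x1 / (t1 * t2) - x2 / (t3 * t4))).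

Definition C00 (a1 a2 b1 b2 b3 b4 : C) : C :=
  Cgamma (1 - a1) * Cgamma (1 - a2)
  / (Cgamma (1 - b1) * Cgamma (1 - b3) * Cgamma (b1 + b3 - a1 - 1)
     * Cgamma (1 - b2) * Cgamma (1 - b4) * Cgamma (b2 + b4 - a2 - 1)).

Definition in_Q (x1 x2 t1 t2 t3 t4 : C) : Prop :=
  t1 * t2 * t3 * t4 - t3 * t4 * x1 - t1 * t2 * x2 = 0.

(* x is so close to 0 that |x1/(t1 t2) + x2/(t3 t4)| < 1 on D x D'; then the
   principal branch of the last factor of u is the one equal to 1 at x = 0. *)
Definition close_to_0 (D D' : chain) (x1 x2 : C) : Prop :=
  forall t1 t2 t3 t4 : C,
    in_support D t1 t3 -> in_support D' t2 t4 ->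
    (Cmod (x1 / (t1 * t2) + x2 / (t3 * t4)) < 1)%R.

(* Main.v *)
Require Import Defs.
From Stdlib Require Import Reals List Factorial Lra Lia.
From Coquelicot Require Import Coquelicot.
Open Scope R_scope.
Open Scope C_scope.

(** Write J(p) for the integral of l_1^(p_1) l_2^(p_2) l_3^(p_3) over the
    regularized triangle. The twisted boundary of the chain vanishes, so Stokes'
    formula gives (p_i + 1) J(p + e_j) = (p_j + 1) J(p + e_i); with l_1 + l_2 + l_3 = 1
    this becomes (p_i + 1) J(p) = (p_1 + p_2 + p_3 + 3) J(p + e_i). As p_3 -> oo
    along p + N e_3, with Re p_1, Re p_2 > 0, the circles can be contracted and J
    concentrates at the corner l_1 = l_2 = 0, where it is asymptotic to a product
    of two Euler Beta integrals; hence
    J(p) = Gamma(p_1 + 1) Gamma(p_2 + 1) Gamma(p_3 + 1) / Gamma(p_1 + p_2 + p_3 + 3)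
    for all non-integral exponents, without analytic continuation. Finally the factor
    (1 - x_1/(t_1 t_2) - x_2/(t_3 t_4))^(-a_3) is expanded in its binomial series,
    which converges uniformly on the compact chain because the tori force
    |x_1| + |x_2| < eps_1 eps_2 and every |t_j| is at least eps; each term is a
    product of two integrals J with shifted exponents. *)

(** The exponents are arbitrary non-integral numbers, so the integral over the open triangle itself
    may diverge. Exact functional equations take the place of convergence: raising p_1 and p_2 makes
    their real parts positive, and raising p_3 leads to the asymptotic regime. An integral shift
    leaves every exp(2 pi i p_j) unchanged, so one weighted chain serves all shifted weights; this
    is why [chain_int] has one argument for the chain and one for the weight.

    As p_3 grows, a cell on which |l_3| <= 1 - eps contributes a geometrically small amount. On the
    tubes around l_1 = 0 and l_2 = 0, however, |l_3| reaches 1, and on the torus over their corner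
    it reaches 1 + 2 eps. No decay is visible there until the circles are contracted, and the
    contraction is what asks for Re p_1, Re p_2 > 0.

    Gamma is given by Euler's limit. Its n-th quotient at x + 1 is n^(x+1) times the Beta integral
    of s^x (1 - s)^n, so the limit of the corner contribution is recognised directly as a product of
    two values of [Cgamma]. *)

Notation I01 x := (0 <= x <= 1)%R (only parsing).

(** * Complex exponential and principal logarithm *)

Lemma C_eq (z w : C) : Re z = Re w -> Im z = Im w -> z = w.
Proof. destruct z, w; simpl; congruence. Qed.

Lemma Re_mult (z w : C) : Re (z * w) = (Re z * Re w - Im z * Im w)%R. Proof. reflexivity. Qed.
Lemma Im_mult (z w : C) : Im (z * w) = (Re z * Im w + Im z * Re w)%R. Proof. reflexivity. Qed.

Lemma Cexp_plus (z w : C) : Cexp (z + w) = Cexp z * Cexp w.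
Proof.
  unfold Cexp; apply C_eq; simpl; unfold Re, Im; simpl; rewrite exp_plus, ?cos_plus, ?sin_plus; ring.
Qed.

Lemma Cexp_0 : Cexp 0 = 1.
Proof. unfold Cexp; apply C_eq; simpl; rewrite exp_0, ?cos_0, ?sin_0; ring. Qed.

Lemma Cexp_neq_0 (z : C) : Cexp z <> 0.
Proof.
  intro H. assert (E : Cexp z * Cexp (- z) = 1).
  { rewrite <- Cexp_plus. replace (z + - z) with (RtoC 0) by ring. apply Cexp_0. }
  rewrite H, Cmult_0_l in E. injection E; lra.
Qed.

Lemma Cexp_opp (z : C) : Cexp (- z) = / Cexp z.
Proof.
  assert (E : Cexp z * Cexp (- z) = 1).
  { rewrite <- Cexp_plus. replace (z + - z) with (RtoC 0) by ring. apply Cexp_0. }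
  rewrite <- (Cmult_1_l (/ _)), <- E. field. apply Cexp_neq_0.
Qed.

Lemma Cexp_minus (z w : C) : Cexp (z - w) = Cexp z / Cexp w.
Proof. unfold Cminus, Cdiv. now rewrite Cexp_plus, Cexp_opp. Qed.

Lemma Cexp_RtoC (r : R) : Cexp (RtoC r) = RtoC (exp r).
Proof. unfold Cexp; apply C_eq; simpl; rewrite ?cos_0, ?sin_0; ring. Qed.

Lemma Cmod_Cexp (z : C) : Cmod (Cexp z) = exp (Re z).
Proof.
  unfold Cmod, Cexp; simpl.
  replace (_ + _)%R with (Rsqr (exp (Re z)) * (Rsqr (sin (Im z)) + Rsqr (cos (Im z))))%R
    by (unfold Rsqr; ring).
  rewrite sin2_cos2, Rmult_1_r. apply sqrt_Rsqr, Rlt_le, exp_pos.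
Qed.

Lemma im_le_Cmod (z : C) : (Rabs (Im z) <= Cmod z)%R.
Proof. eapply Rle_trans; [apply Rmax_r | apply Rmax_Cmod]. Qed.

Lemma Re_le_Cmod (z : C) : (Re z <= Cmod z)%R.
Proof. eapply Rle_trans; [apply Rle_abs | apply re_le_Cmod]. Qed.

Lemma Cmod_le_Re_Im (z : C) : (Cmod z <= Rabs (Re z) + Rabs (Im z))%R.
Proof.
  destruct z as [x y].
  replace (x, y) with (RtoC x + Ci * RtoC y) by (apply C_eq; simpl; ring).
  eapply Rle_trans; [apply Cmod_triangle|].
  rewrite Cmod_mult, Cmod_Ci, !Cmod_R. simpl.
  rewrite !Rmult_0_l, !Rmult_1_l, Rminus_0_r, !Rplus_0_l, !Rplus_0_r. lra.
Qed.

Lemma Cmod_sub_ge (z w : C) : (Cmod z - Cmod w <= Cmod (z + w))%R.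
Proof.
  pose proof (Cmod_triangle (z + w) (- w)) as H. rewrite Cmod_opp in H.
  replace (z + w + - w) with z in H by ring. lra.
Qed.

Lemma Re_pos_neq_0 (z : C) : (0 < Re z)%R -> z <> 0.
Proof. intros H E. rewrite E in H. simpl in H. lra. Qed.

(** [Carg] is built from [acos], which is not differentiable at 1, the value reached on the positive
    axis. The [atan] form is smooth on the right half-plane, where all principal logarithms of the
    proof are differentiated. *)
Lemma Clog_Re_pos (z : C) : (0 < Re z)%R ->
  Clog z = (ln (Rsqr (Re z) + Rsqr (Im z)) / 2, atan (Im z / Re z))%R.
Proof.
  destruct z as [x y]; simpl; intro Hx.
  assert (Hs : (0 < Rsqr x + Rsqr y)%R).
  { pose proof (Rlt_0_sqr x ltac:(lra)); pose proof (Rle_0_sqr y); lra. }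
  assert (HC : Cmod (x, y) = sqrt (Rsqr x + Rsqr y)).
  { unfold Cmod; f_equal; simpl; unfold Rsqr; ring. }
  assert (Hc0 : (0 < sqrt (Rsqr x + Rsqr y))%R) by now apply sqrt_lt_R0.
  unfold Clog. rewrite HC. f_equal.
  - rewrite <- (sqrt_sqrt (Rsqr x + Rsqr y)) at 2 by lra.
    rewrite ln_mult by assumption. field.
  - unfold Carg. rewrite HC. simpl.
    assert (A : acos (x / sqrt (Rsqr x + Rsqr y)) = atan (Rabs y / x)).
    { rewrite acos_atan by (apply Rdiv_lt_0_compat; assumption). f_equal.
      replace (1 - Rsqr (x / sqrt (Rsqr x + Rsqr y)))%R
        with (Rsqr (Rabs y / sqrt (Rsqr x + Rsqr y))).
      - rewrite sqrt_Rsqr.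
        + field. split; lra.
        + apply Rdiv_le_0_compat; [apply Rabs_pos | assumption].
      - rewrite !Rsqr_div', <- Rsqr_abs, !Rsqr_sqrt by lra. field. lra. }
    rewrite A. destruct (Rle_dec 0 y).
    + now rewrite Rabs_right by lra.
    + rewrite Rabs_left by lra.
      replace (- y / x)%R with (- (y / x))%R by (field; lra).
      rewrite atan_opp. ring.
Qed.

Lemma Cexp_Clog (z : C) : (0 < Re z)%R -> Cexp (Clog z) = z.
Proof.
  intro H. rewrite Clog_Re_pos by assumption.
  destruct z as [x y]; simpl in *. unfold Cexp; simpl.
  assert (Hs : (0 < Rsqr x + Rsqr y)%R).
  { pose proof (Rlt_0_sqr x ltac:(lra)); pose proof (Rle_0_sqr y); lra. }
  assert (Hc0 : (0 < sqrt (Rsqr x + Rsqr y))%R) by now apply sqrt_lt_R0.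
  assert (E : exp (ln (Rsqr x + Rsqr y) / 2) = sqrt (Rsqr x + Rsqr y)).
  { rewrite <- (exp_ln (sqrt _)) by assumption. f_equal.
    rewrite <- (sqrt_sqrt (Rsqr x + Rsqr y)) at 1 by lra.
    rewrite ln_mult by assumption. field. }
  rewrite E, cos_atan, sin_atan.
  replace (1 + Rsqr (y / x))%R with ((Rsqr x + Rsqr y) / Rsqr x)%R
    by (unfold Rsqr; field; lra).
  rewrite sqrt_div_alt by (apply Rlt_0_sqr; lra).
  rewrite sqrt_Rsqr by lra. f_equal; field; lra.
Qed.

Lemma Clog_RtoC (r : R) : (0 < r)%R -> Clog (RtoC r) = RtoC (ln r).
Proof.
  intro H. rewrite Clog_Re_pos by assumption. simpl. apply C_eq; simpl.
  - replace (Rsqr r + Rsqr 0)%R with (r * r)%R by (unfold Rsqr; ring).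
    rewrite ln_mult by assumption. field.
  - unfold Rdiv. rewrite Rmult_0_l. apply atan_0.
Qed.

#[global] Arguments Clog : simpl never.

Lemma Clog_1 : Clog 1 = 0.
Proof. rewrite Clog_RtoC by lra. now rewrite ln_1. Qed.

(** * Calculus of functions from R to C, componentwise *)

Definition cder (f : R -> C) (x : R) (l : C) : Prop :=
  is_derive (fun y => Re (f y)) x (Re l) /\ is_derive (fun y => Im (f y)) x (Im l).

(** The domain is a general uniform space because continuity is used on the line, on the parameter
    plane and on [C] itself. *)
Definition ccont {U : UniformSpace} (f : U -> C) (p : U) : Prop :=
  continuous (fun q => Re (f q)) p /\ continuous (fun q => Im (f q)) p.

Lemma is_derive_eq (f : R -> R) (x l l' : R) : is_derive f x l -> l = l' -> is_derive f x l'.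
Proof. now intros H <-. Qed.

Lemma cder_eq (f : R -> C) x l l' : cder f x l -> l = l' -> cder f x l'.
Proof. now intros H <-. Qed.

Lemma cder_ext (f g : R -> C) x l : (forall y, f y = g y) -> cder f x l -> cder g x l.
Proof.
  intros E [H1 H2]; split; (eapply is_derive_ext; [|eassumption]); intro; simpl; now rewrite E.
Qed.

Lemma CDerive_cder f x l : cder f x l -> CDerive f x = l.
Proof.
  intros [H1 H2]. unfold CDerive.
  destruct l; f_equal; now apply is_derive_unique.
Qed.

Lemma cder_const (c : C) x : cder (fun _ => c) x 0.
Proof. split; apply (is_derive_const (K := R_AbsRing) (V := R_NormedModule)). Qed.

Lemma cder_RtoC (f : R -> R) x l : is_derive f x l -> cder (fun y => RtoC (f y)) x (RtoC l).
Proof. intro H. split; simpl; [assumption | apply (is_derive_const (K := R_AbsRing) (V := R_NormedModule))]. Qed.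

Lemma cder_id x : cder RtoC x 1.
Proof. apply (cder_RtoC (fun y => y)). apply (is_derive_id (K := R_AbsRing)). Qed.

Lemma cder_plus f g x l m : cder f x l -> cder g x m -> cder (fun y => f y + g y) x (l + m).
Proof.
  intros [A B] [A' B']; split; simpl;
    apply (is_derive_plus (K := R_AbsRing) (V := R_NormedModule)); assumption.
Qed.

Lemma cder_opp f x l : cder f x l -> cder (fun y => - f y) x (- l).
Proof.
  intros [A B]; split; simpl;
    apply (is_derive_opp (K := R_AbsRing) (V := R_NormedModule)); assumption.
Qed.

Lemma cder_minus f g x l m : cder f x l -> cder g x m -> cder (fun y => f y - g y) x (l - m).
Proof. intros H H'. apply cder_plus; [assumption|]. now apply cder_opp. Qed.

Lemma is_derive_Rmult (f g : R -> R) x l m :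
  is_derive f x l -> is_derive g x m -> is_derive (fun y => f y * g y)%R x (l * g x + f x * m)%R.
Proof. intros H H'. apply (is_derive_mult (K := R_AbsRing)); auto. intros; apply Rmult_comm. Qed.

Lemma cder_mult f g x l m :
  cder f x l -> cder g x m -> cder (fun y => f y * g y) x (l * g x + f x * m).
Proof.
  intros [A B] [A' B']; split.
  - eapply is_derive_eq.
    + apply (is_derive_minus (K := R_AbsRing) (V := R_NormedModule));
        apply is_derive_Rmult; eassumption.
    + simpl. unfold minus, plus, opp, Re, Im; simpl. ring.
  - eapply is_derive_eq.
    + apply (is_derive_plus (K := R_AbsRing) (V := R_NormedModule));
        apply is_derive_Rmult; eassumption.
    + simpl. unfold plus, Re, Im; simpl. ring.
Qed.

Lemma cder_scal (c : C) f x l : cder f x l -> cder (fun y => c * f y) x (c * l).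
Proof.
  intro H. eapply cder_eq; [apply (cder_mult (fun _ => c)); [apply cder_const | exact H]|].
  simpl. ring.
Qed.

Lemma is_derive_Rcomp (f g : R -> R) x l m :
  is_derive f (g x) l -> is_derive g x m -> is_derive (fun y => f (g y)) x (m * l)%R.
Proof. intros H H'. exact (is_derive_comp f g x l m H H'). Qed.

Lemma cder_Cexp f x l : cder f x l -> cder (fun y => Cexp (f y)) x (l * Cexp (f x)).
Proof.
  intros [A B]; split; simpl.
  - eapply is_derive_eq.
    + apply is_derive_Rmult.
      * apply (is_derive_Rcomp exp _ x _ _ (is_derive_exp _) A).
      * apply (is_derive_Rcomp cos _ x _ _ (is_derive_cos _) B).
    + unfold Re, Im; simpl. ring.
  - eapply is_derive_eq.
    + apply is_derive_Rmult.
      * apply (is_derive_Rcomp exp _ x _ _ (is_derive_exp _) A).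
      * apply (is_derive_Rcomp sin _ x _ _ (is_derive_sin _) B).
    + unfold Re, Im; simpl. ring.
Qed.

Lemma is_derive_cont (f : R -> R) x l : is_derive f x l -> continuous f x.
Proof.
  intro H. apply (ex_derive_continuous (K := R_AbsRing) (V := R_NormedModule)).
  now exists l.
Qed.

Lemma cder_ccont f x l : cder f x l -> ccont f x.
Proof. intros [A B]; split; eapply is_derive_cont; eassumption. Qed.

Lemma cder_Clog f x l : cder f x l -> (0 < Re (f x))%R ->
  cder (fun y => Clog (f y)) x (l / f x).
Proof.
  intros [A B] Hp.
  assert (L : locally x (fun y => 0 < Re (f y))%R).
  { apply (is_derive_cont _ _ _ A). now apply open_gt. }
  set (X := fun y => Re (f y)) in *. set (Y := fun y => Im (f y)) in *.
  assert (Hs : (0 < Rsqr (X x) + Rsqr (Y x))%R).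
  { pose proof (Rlt_0_sqr (X x) ltac:(unfold X; lra)); pose proof (Rle_0_sqr (Y x)); lra. }
  split.
  - apply (is_derive_ext_loc (fun y => ln (X y * X y + Y y * Y y) * / 2)%R).
    + eapply filter_imp; [|exact L]. intros y Hy.
      rewrite (Clog_Re_pos (f y)) by assumption. reflexivity.
    + eapply is_derive_eq.
      * apply is_derive_Rmult; [|apply (is_derive_const (K := R_AbsRing) (V := R_NormedModule))].
        apply (is_derive_Rcomp ln).
        -- apply is_derive_ln. exact Hs.
        -- apply (is_derive_plus (K := R_AbsRing) (V := R_NormedModule));
             apply is_derive_Rmult; eassumption.
      * unfold zero, plus; simpl. subst X Y. unfold Rsqr, Re, Im in *. clear A B L. revert Hp Hs. generalize (f x). intros [a b] Hp Hs.
        destruct l as [c d]. simpl in *. field.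
        repeat split; nra.
  - apply (is_derive_ext_loc (fun y => atan (Y y * / X y))).
    + eapply filter_imp; [|exact L]. intros y Hy.
      rewrite (Clog_Re_pos (f y)) by assumption. reflexivity.
    + eapply is_derive_eq.
      * apply (is_derive_Rcomp atan); [apply is_derive_atan|].
        apply is_derive_Rmult; [exact B|].
        apply is_derive_inv; [exact A | unfold X; lra].
      * simpl. subst X Y. unfold Rsqr, Re, Im in *. clear A B L. revert Hp Hs. generalize (f x). intros [a b] Hp Hs.
        destruct l as [c d]. simpl in *. field.
        repeat split; nra.
Qed.

Section Continuity.
Context {U : UniformSpace}.
Implicit Types (f g : U -> C) (p : U).

Lemma continuous_Rmult (f g : U -> R) p :
  continuous f p -> continuous g p -> continuous (fun q => f q * g q)%R p.
Proof. apply (continuous_mult (K := R_AbsRing)). Qed.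

Lemma continuous_Rplus (f g : U -> R) p :
  continuous f p -> continuous g p -> continuous (fun q => f q + g q)%R p.
Proof. apply (continuous_plus (K := R_AbsRing) (V := R_NormedModule)). Qed.

Lemma continuous_Rminus (f g : U -> R) p :
  continuous f p -> continuous g p -> continuous (fun q => f q - g q)%R p.
Proof. apply (continuous_minus (K := R_AbsRing) (V := R_NormedModule)). Qed.

Lemma continuous_Ropp (f : U -> R) p :
  continuous f p -> continuous (fun q => - f q)%R p.
Proof. apply (continuous_opp (K := R_AbsRing) (V := R_NormedModule)). Qed.

Lemma continuous_via (h : R -> R) (f : U -> R) p l :
  continuous f p -> is_derive h (f p) l -> continuous (fun q => h (f q)) p.
Proof. intros Hf Hh. apply continuous_comp; [assumption|]. eapply is_derive_cont; eassumption. Qed.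

Lemma ccont_const (c : C) p : ccont (fun _ : U => c) p.
Proof. split; apply continuous_const. Qed.

Lemma ccont_RtoC (f : U -> R) p : continuous f p -> ccont (fun q => RtoC (f q)) p.
Proof. intro; split; simpl; [assumption | apply continuous_const]. Qed.

Lemma ccont_plus f g p : ccont f p -> ccont g p -> ccont (fun q => f q + g q) p.
Proof. intros [A B] [A' B']; split; simpl; now apply continuous_Rplus. Qed.

Lemma ccont_opp f p : ccont f p -> ccont (fun q => - f q) p.
Proof. intros [A B]; split; simpl; now apply continuous_Ropp. Qed.

Lemma ccont_minus f g p : ccont f p -> ccont g p -> ccont (fun q => f q - g q) p.
Proof. intros H H'. apply ccont_plus; [assumption|]. now apply ccont_opp. Qed.

Lemma ccont_mult f g p : ccont f p -> ccont g p -> ccont (fun q => f q * g q) p.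
Proof.
  intros [A B] [A' B']; split; simpl.
  - apply continuous_Rminus; now apply continuous_Rmult.
  - apply continuous_Rplus; now apply continuous_Rmult.
Qed.

Lemma ccont_Cexp f p : ccont f p -> ccont (fun q => Cexp (f q)) p.
Proof.
  intros [A B]; split; simpl.
  - apply continuous_Rmult.
    + eapply (continuous_via exp); [exact A | apply is_derive_exp].
    + eapply (continuous_via cos); [exact B | apply is_derive_cos].
  - apply continuous_Rmult.
    + eapply (continuous_via exp); [exact A | apply is_derive_exp].
    + eapply (continuous_via sin); [exact B | apply is_derive_sin].
Qed.

Lemma continuous_ext_loc' (f g : U -> R) p :
  locally p (fun q => f q = g q) -> continuous f p -> continuous g p.
Proof.
  intros L H. eapply continuous_ext_loc; [|exact H]. exact L.
Qed.

Lemma ccont_Clog f p : ccont f p -> (0 < Re (f p))%R -> ccont (fun q => Clog (f q)) p.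
Proof.
  intros [A B] Hp.
  assert (L : locally p (fun q => 0 < Re (f q))%R).
  { apply A. now apply open_gt. }
  assert (Hs : (0 < Rsqr (Re (f p)) + Rsqr (Im (f p)))%R).
  { pose proof (Rlt_0_sqr (Re (f p)) ltac:(lra)); pose proof (Rle_0_sqr (Im (f p))); lra. }
  split.
  - apply (continuous_ext_loc' (fun q => ln (Re (f q) * Re (f q) + Im (f q) * Im (f q)) * / 2)%R).
    + eapply filter_imp; [|exact L]. intros y Hy.
      rewrite (Clog_Re_pos (f y)) by assumption. reflexivity.
    + apply continuous_Rmult; [|apply continuous_const].
      eapply (continuous_via ln); [|apply is_derive_ln; exact Hs].
      apply continuous_Rplus; now apply continuous_Rmult.
  - apply (continuous_ext_loc' (fun q => atan (Im (f q) * / Re (f q)))).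
    + eapply filter_imp; [|exact L]. intros y Hy.
      rewrite (Clog_Re_pos (f y)) by assumption. reflexivity.
    + eapply (continuous_via atan); [|apply is_derive_atan].
      apply continuous_Rmult; [exact B|].
      eapply (continuous_via Rinv _ _ _ A).
      apply (is_derive_inv (fun x => x) (Re (f p)) 1); [apply (is_derive_id (K := R_AbsRing)) | lra].
Qed.

End Continuity.

Lemma ccont_comp {U V : UniformSpace} (h : U -> V) (f : V -> C) p :
  continuous h p -> ccont f (h p) -> ccont (fun q => f (h q)) p.
Proof.
  intros H [A B]; split.
  - apply (continuous_comp h (fun v => Re (f v))); assumption.
  - apply (continuous_comp h (fun v => Im (f v))); assumption.
Qed.

(** * Integrals of complex-valued functions over an interval *)

Definition cint (f : R -> C) (a b : R) : C := @RInt C_R_CompleteNormedModule f a b.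
Definition is_cint (f : R -> C) (a b : R) (l : C) : Prop := @is_RInt C_R_NormedModule f a b l.

Lemma ccont_continuous {U : UniformSpace} (f : U -> C) p : ccont f p -> continuous f p.
Proof.
  intros [A B].
  apply (continuous_ext (fun q => (Re (f q), Im (f q)))).
  { intro q. now destruct (f q). }
  apply (continuous_comp_2 (fun q => Re (f q)) (fun q => Im (f q)) (fun x y => (x, y) : C) p A B).
  apply (continuous_ext (fun z : R * R => z)).
  { intro z. now destruct z. }
  apply continuous_id.
Qed.

Lemma is_cint_pair f a b l :
  is_RInt (fun t => Re (f t)) a b (Re l) -> is_RInt (fun t => Im (f t)) a b (Im l) ->
  is_cint f a b l.
Proof.
  intros A B. unfold is_cint. destruct l as [u v].
  exact (is_RInt_fct_extend_pair (U := R_NormedModule) (V := R_NormedModule) f a b u v A B).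
Qed.

Lemma is_cint_Re f a b l : is_cint f a b l -> is_RInt (fun t => Re (f t)) a b (Re l).
Proof. intro H. exact (is_RInt_fct_extend_fst (U := R_NormedModule) (V := R_NormedModule) f a b l H). Qed.

Lemma is_cint_Im f a b l : is_cint f a b l -> is_RInt (fun t => Im (f t)) a b (Im l).
Proof. intro H. exact (is_RInt_fct_extend_snd (U := R_NormedModule) (V := R_NormedModule) f a b l H). Qed.

Lemma is_cint_unique f a b l : is_cint f a b l -> cint f a b = l.
Proof. apply (is_RInt_unique (V := C_R_CompleteNormedModule)). Qed.

Lemma is_cint_cint f a b l : is_cint f a b l -> is_cint f a b (cint f a b).
Proof. intro H. now rewrite (is_cint_unique _ _ _ _ H). Qed.

Lemma cint_correct f a b : (a <= b)%R -> (forall x, (a <= x <= b)%R -> ccont f x) ->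
  is_cint f a b (cint f a b).
Proof.
  intros Hab H. apply (RInt_correct (V := C_R_CompleteNormedModule)).
  apply (ex_RInt_continuous (V := C_R_CompleteNormedModule)).
  rewrite Rmin_left, Rmax_right by assumption.
  intros z Hz. now apply (ccont_continuous (U := R_UniformSpace)), H.
Qed.

Lemma is_cint_plus f g a b l m :
  is_cint f a b l -> is_cint g a b m -> is_cint (fun t => f t + g t) a b (l + m).
Proof. apply (is_RInt_plus (V := C_R_NormedModule)). Qed.

Lemma is_cint_minus f g a b l m :
  is_cint f a b l -> is_cint g a b m -> is_cint (fun t => f t - g t) a b (l - m).
Proof. apply (is_RInt_minus (V := C_R_NormedModule)). Qed.

Lemma is_cint_scal (c : C) f a b l : is_cint f a b l -> is_cint (fun t => c * f t) a b (c * l).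
Proof.
  intro H. pose proof (is_cint_Re _ _ _ _ H) as A. pose proof (is_cint_Im _ _ _ _ H) as B.
  apply is_cint_pair; simpl.
  - apply (is_RInt_minus (V := R_NormedModule) (fun t => Re c * Re (f t))%R (fun t => Im c * Im (f t))%R);
    now apply (is_RInt_scal (V := R_NormedModule)).
  - apply (is_RInt_plus (V := R_NormedModule) (fun t => Re c * Im (f t))%R (fun t => Im c * Re (f t))%R);
    now apply (is_RInt_scal (V := R_NormedModule)).
Qed.

Lemma is_cint_ext f g a b l : (a <= b)%R ->
  (forall x, (a < x < b)%R -> f x = g x) -> is_cint f a b l -> is_cint g a b l.
Proof.
  intros Hab E. apply (is_RInt_ext (V := C_R_NormedModule)).
  rewrite Rmin_left, Rmax_right by assumption. exact E.
Qed.

Lemma cint_ext f g a b : (a <= b)%R ->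
  (forall x, (a < x < b)%R -> f x = g x) -> cint f a b = cint g a b.
Proof.
  intros Hab E. apply (RInt_ext (V := C_R_CompleteNormedModule)).
  rewrite Rmin_left, Rmax_right by assumption. exact E.
Qed.

Lemma is_cint_const (c : C) a b : is_cint (fun _ => c) a b (RtoC (b - a) * c).
Proof.
  apply is_cint_pair; simpl.
  - replace (_ - _)%R with (scal (b - a)%R (Re c)).
    apply (is_RInt_const (V := R_NormedModule)). unfold Re, Im, scal; simpl; unfold mult; simpl; ring.
  - replace (_ + _)%R with (scal (b - a)%R (Im c)).
    apply (is_RInt_const (V := R_NormedModule)). unfold Re, Im, scal; simpl; unfold mult; simpl; ring.
Qed.

Lemma cint_scal (c : C) f a b : (a <= b)%R -> (forall x, (a <= x <= b)%R -> ccont f x) ->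
  cint (fun t => c * f t) a b = c * cint f a b.
Proof. intros. now apply is_cint_unique, is_cint_scal, cint_correct. Qed.

Lemma cint_minus f g a b : (a <= b)%R ->
  (forall x, (a <= x <= b)%R -> ccont f x) -> (forall x, (a <= x <= b)%R -> ccont g x) ->
  cint (fun t => f t - g t) a b = cint f a b - cint g a b.
Proof. intros. apply is_cint_unique, is_cint_minus; now apply cint_correct. Qed.

(** [is_cint] lives in the product module [R * R], whose norm is Euclidean; through this identity
    the norm estimates for integrals become estimates in [Cmod]. *)
Lemma norm_C_R (z : C) : @norm R_AbsRing C_R_NormedModule z = Cmod z.
Proof.
  unfold norm; simpl. unfold prod_norm, norm; simpl. unfold abs; simpl. unfold Cmod.
  f_equal. rewrite !Rmult_1_r, <- !Rabs_mult, !Rabs_pos_eq by nra. ring.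
Qed.

Lemma is_cint_norm_le f g a b l m : (a <= b)%R ->
  (forall x, (a <= x <= b)%R -> (Cmod (f x) <= g x)%R) ->
  is_cint f a b l -> is_RInt g a b m -> (Cmod l <= m)%R.
Proof.
  intros Hab H Hf Hg.
  rewrite <- norm_C_R.
  refine (norm_RInt_le (V := C_R_NormedModule) f g a b l m Hab _ Hf Hg).
  intros x Hx. rewrite norm_C_R. auto.
Qed.

Lemma is_cint_norm_const f M a b l : (a <= b)%R ->
  (forall x, (a <= x <= b)%R -> (Cmod (f x) <= M)%R) ->
  is_cint f a b l -> (Cmod l <= (b - a) * M)%R.
Proof.
  intros Hab H Hf. eapply is_cint_norm_le; [exact Hab | exact H | exact Hf|].
  apply (is_RInt_const (V := R_NormedModule)).
Qed.

Lemma is_cint_derive F f a b : (a <= b)%R ->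
  (forall x, (a <= x <= b)%R -> cder F x (f x)) ->
  (forall x, (a <= x <= b)%R -> ccont f x) ->
  is_cint f a b (F b - F a).
Proof.
  intros Hab D Cf. apply is_cint_pair.
  - apply (is_RInt_derive (fun x => Re (F x)) (fun x => Re (f x)));
      rewrite Rmin_left, Rmax_right by assumption; intros x Hx; [now apply D | now apply (Cf x Hx)].
  - apply (is_RInt_derive (fun x => Im (F x)) (fun x => Im (f x)));
      rewrite Rmin_left, Rmax_right by assumption; intros x Hx; [now apply D | now apply (Cf x Hx)].
Qed.

Lemma is_cint_Chasles f a b c l m :
  is_cint f a b l -> is_cint f b c m -> is_cint f a c (l + m).
Proof. apply (is_RInt_Chasles (V := C_R_NormedModule)). Qed.

(** Serves to reverse one edge of the triangle when boundary terms are matched in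
    [sigma_edge_u_0]. *)
Lemma cint_flip f : (forall x, I01 x -> ccont f x) ->
  cint (fun v => f (1 - v)%R) 0 1 = cint f 0 1.
Proof.
  intro H. apply is_cint_unique.
  assert (A : is_cint f 1 0 (- cint f 0 1)).
  { apply (is_RInt_swap (V := C_R_NormedModule)). apply cint_correct; [lra | exact H]. }
  pose proof (is_RInt_comp_lin (V := C_R_NormedModule) f (-1) 1 0 1 (- cint f 0 1)) as B.
  replace (-1 * 0 + 1)%R with 1%R in B by ring. replace (-1 * 1 + 1)%R with 0%R in B by ring.
  specialize (B A). apply (is_RInt_opp (V := C_R_NormedModule)) in B.
  replace (cint f 0 1) with (opp (- cint f 0 1) : C_R_NormedModule).
  2:{ unfold opp; simpl. unfold prod_opp, opp; simpl. destruct (cint f 0 1); simpl. f_equal; ring. }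
  eapply (is_RInt_ext (V := C_R_NormedModule)); [|exact B].
  intros x _. simpl. replace (-1 * x + 1)%R with (1 - x)%R by ring.
  unfold opp, scal; simpl. unfold prod_opp, prod_scal, opp, scal; simpl. unfold mult; simpl.
  destruct (f (1 - x)%R) as [p q]; simpl. f_equal; ring.
Qed.

(** * Fubini on a rectangle *)

Lemma continuity_2d_pt_slice (f : R -> R -> R) (u z : R) :
  continuity_2d_pt f u z -> continuous (f u) z.
Proof.
  intro Hf. apply (continuous_comp_2 (fun _ => u) (fun v => v) f z);
    [apply continuous_const | apply continuous_id | apply continuity_2d_pt_filterlim, Hf].
Qed.

Lemma ex_RInt_slice (f : R -> R -> R) (c d u : R) :
  (forall u v, continuity_2d_pt f u v) -> ex_RInt (f u) c d.
Proof.
  intro Hf. apply (ex_RInt_continuous (V := R_CompleteNormedModule)). intros z _.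
  apply continuity_2d_pt_slice, Hf.
Qed.

Lemma continuous_RInt_param (f : R -> R -> R) (c d x : R) : (c <= d)%R ->
  (forall u v, continuity_2d_pt f u v) -> continuous (fun u => RInt (f u) c d) x.
Proof.
  intros Hcd Hf.
  apply filterlim_locally. intros [e He].
  (* The [+ 1] keeps the quotient meaningful when c = d. *)
  assert (He' : (0 < e / (d - c + 1))%R) by (apply Rdiv_lt_0_compat; lra).
  destruct (uniform_continuity_2d_1d' f c d x (fun y _ => Hf x y) (mkposreal _ He')) as [dl Hd].
  exists dl. intros u Hu. change (Rabs (RInt (f u) c d - RInt (f x) c d) < e)%R.
  change (Rabs (u - x) < dl)%R in Hu. apply Rabs_def2 in Hu. simpl in Hd.
  destruct dl as [dl Hdl]; simpl in *.
  assert (A : (Rabs (RInt (f u) c d - RInt (f x) c d) <= (d - c) * (e / (d - c + 1)))%R).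
  { refine (norm_RInt_le_const (V := R_NormedModule) (fun y => f u y - f x y)%R c d _ _ Hcd _ _).
    - intros y Hy. apply Rlt_le. apply (Hd y x y u); try lra.
      rewrite Rminus_diag. rewrite Rabs_R0. lra.
    - apply (is_RInt_minus (V := R_NormedModule));
        apply (RInt_correct (V := R_CompleteNormedModule)), ex_RInt_slice, Hf. }
  eapply Rle_lt_trans; [exact A|].
  apply (Rmult_lt_reg_r (d - c + 1)); [lra|].
  replace ((d - c) * (e / (d - c + 1)) * (d - c + 1))%R with ((d - c) * e)%R by (field; lra). nra.
Qed.

(** Replace the upper end b by a variable x. The right-hand side then becomes [G x], and
    differentiation under the integral sign gives [G] the derivative [RInt (f x) c d]; the
    fundamental theorem of calculus concludes. *)
Lemma RInt_swap_continuous (f : R -> R -> R) (a b c d : R) : (a <= b)%R -> (c <= d)%R ->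
  (forall u v, continuity_2d_pt f u v) ->
  RInt (fun x => RInt (f x) c d) a b = RInt (fun y => RInt (fun x => f x y) a b) c d.
Proof.
  intros Hab Hcd Hf.
  assert (Hf' : forall u v, continuity_2d_pt (fun y x => f x y) u v).
  { intros u v e. destruct (Hf v u e) as [dl Hd]. exists dl. intros; now apply Hd. }
  set (G := fun x => RInt (fun y => RInt (fun t => f t y) a x) c d).
  assert (D0 : forall z t, is_derive (fun u => RInt (fun t0 => f t0 t) a u) z (f z t)).
  { intros z t. apply (is_derive_RInt (V := R_NormedModule) (fun t0 => f t0 t) (fun z => RInt (fun t0 => f t0 t) a z) a).
    - apply filter_forall. intro y. apply (RInt_correct (V := R_CompleteNormedModule)).
      apply (ex_RInt_slice (fun y x => f x y)), Hf'.
    - apply (continuity_2d_pt_slice (fun y x => f x y)), Hf'. }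
  assert (DG : forall x, is_derive G x (RInt (f x) c d)).
  { intro x.
    assert (E : RInt (fun t => Derive (fun u => RInt (fun t0 => f t0 t) a u) x) c d = RInt (f x) c d).
    { apply RInt_ext. intros t _. apply is_derive_unique, D0. }
    rewrite <- E. apply is_derive_RInt_param.
    - apply filter_forall. intros z t _. exists (f z t). apply D0.
    - intros t _. apply (continuity_2d_pt_ext f); [|apply Hf].
      intros u v. symmetry. apply is_derive_unique, D0.
    - apply filter_forall. intro y.
      apply (ex_RInt_continuous (V := R_CompleteNormedModule)). intros z _.
      destruct (Rle_dec a y).
      + apply (continuous_RInt_param (fun v t => f t v)); assumption.
      + apply (continuous_ext (fun v => opp (RInt (fun t => f t v) y a))).
        { intro v. apply (opp_RInt_swap (V := R_CompleteNormedModule)).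
          apply (ex_RInt_slice (fun y x => f x y)), Hf'. }
        apply (continuous_opp (V := R_NormedModule)).
        apply (continuous_RInt_param (fun v t => f t v)); [lra | assumption]. }
  apply is_RInt_unique.
  replace (RInt (fun y => RInt (fun x => f x y) a b) c d) with (minus (G b) (G a)).
  - apply (is_RInt_derive (V := R_CompleteNormedModule) G).
    + intros; apply DG.
    + intros. now apply continuous_RInt_param.
  - unfold G, minus, plus, opp; simpl.
    replace (RInt (fun y => RInt (fun t => f t y) a a) c d) with 0%R; [ring|].
    rewrite (RInt_ext _ (fun _ => 0%R)).
    + rewrite RInt_const. unfold scal; simpl; unfold mult; simpl; ring.
    + intros y _. apply (RInt_point (V := R_CompleteNormedModule)).
Qed.

(** For a <= b, the retraction of the line onto [a, b]. Composition with it extends a function from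
    a rectangle to the whole plane without losing continuity, so that the Fubini theorem for
    globally continuous functions applies. *)
Definition clamp (a b x : R) : R := Rmax a (Rmin b x).

Lemma clamp_in a b x : (a <= b)%R -> (a <= clamp a b x <= b)%R.
Proof.
  intro H. unfold clamp. split; [apply Rmax_l|]. apply Rmax_lub; [assumption | apply Rmin_l].
Qed.

Lemma clamp_id a b x : (a <= x <= b)%R -> clamp a b x = x.
Proof. intro H. unfold clamp. now rewrite Rmin_right, Rmax_right by lra. Qed.

Lemma clamp_lip a b x y : (a <= b)%R -> (Rabs (clamp a b x - clamp a b y) <= Rabs (x - y))%R.
Proof.
  intro H. unfold clamp, Rmin. destruct (Rle_dec b x), (Rle_dec b y); unfold Rmax, Rabs;
  repeat match goal with |- context [if ?c then _ else _] => destruct c end; lra.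
Qed.

(* Continuity in the plane at each point of the closed rectangle, not merely
   relative to the rectangle. *)
Definition ccont2 (f : R -> R -> C) (a b c d : R) : Prop :=
  forall u v, (a <= u <= b)%R -> (c <= v <= d)%R ->
    ccont (fun q : R * R => f (fst q) (snd q)) (u, v).

Lemma continuity_2d_pt_clamp (f : R -> R -> R) a b c d : (a <= b)%R -> (c <= d)%R ->
  (forall u v, (a <= u <= b)%R -> (c <= v <= d)%R -> continuity_2d_pt f u v) ->
  forall u v, continuity_2d_pt (fun x y => f (clamp a b x) (clamp c d y)) u v.
Proof.
  intros Hab Hcd H u v e.
  destruct (H _ _ (clamp_in a b u Hab) (clamp_in c d v Hcd) e) as [dl Hd].
  exists dl. intros x y Hx Hy. apply Hd.
  - eapply Rle_lt_trans; [now apply clamp_lip | exact Hx].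
  - eapply Rle_lt_trans; [now apply clamp_lip | exact Hy].
Qed.

Lemma RInt_swap_rectangle (f : R -> R -> R) (a b c d : R) : (a <= b)%R -> (c <= d)%R ->
  (forall u v, (a <= u <= b)%R -> (c <= v <= d)%R -> continuity_2d_pt f u v) ->
  ex_RInt (fun x => RInt (f x) c d) a b /\
  RInt (fun x => RInt (f x) c d) a b = RInt (fun y => RInt (fun x => f x y) a b) c d.
Proof.
  intros Hab Hcd Hf.
  pose proof (continuity_2d_pt_clamp f a b c d Hab Hcd Hf) as Hg.
  set (g := fun x y => f (clamp a b x) (clamp c d y)) in *.
  assert (E : forall x, (a <= x <= b)%R -> RInt (f x) c d = RInt (g x) c d).
  { intros x Hx. apply RInt_ext. rewrite Rmin_left, Rmax_right by assumption.
    intros y Hy. unfold g. rewrite !clamp_id by lra. reflexivity. }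
  split.
  - apply (ex_RInt_ext (fun x => RInt (g x) c d)).
    + rewrite Rmin_left, Rmax_right by assumption. intros x Hx. symmetry. apply E. lra.
    + apply (ex_RInt_continuous (V := R_CompleteNormedModule)). intros z _.
      now apply continuous_RInt_param.
  - rewrite (RInt_ext _ (fun x => RInt (g x) c d)).
    2:{ rewrite Rmin_left, Rmax_right by assumption. intros x Hx. apply E. lra. }
    rewrite RInt_swap_continuous by assumption.
    apply RInt_ext. rewrite Rmin_left, Rmax_right by assumption. intros y Hy.
    apply RInt_ext. rewrite Rmin_left, Rmax_right by assumption. intros x Hx.
    unfold g. rewrite !clamp_id by lra. reflexivity.
Qed.

Lemma ccont2_slice f a b c d u v : ccont2 f a b c d -> (a <= u <= b)%R -> (c <= v <= d)%R ->
  ccont (f u) v.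
Proof.
  intros H Hu Hv.
  apply (ccont_comp (U := R_UniformSpace) (V := prod_UniformSpace R_UniformSpace R_UniformSpace)
           (fun v => (u, v)) (fun q => f (fst q) (snd q)) v); [|now apply H].
  apply (continuous_comp_2 (fun _ : R => u) (fun v : R => v) (fun x y => (x, y)));
    [apply continuous_const | apply continuous_id |].
  apply (continuous_ext (fun z : R * R => z)); [now intros [] | apply continuous_id].
Qed.

Lemma ccont2_swap f a b c d : ccont2 f a b c d -> ccont2 (fun v u => f u v) c d a b.
Proof.
  intros H v u Hv Hu.
  apply (ccont_comp (U := prod_UniformSpace R_UniformSpace R_UniformSpace)
           (V := prod_UniformSpace R_UniformSpace R_UniformSpace)
           (fun q => (snd q, fst q)) (fun q => f (fst q) (snd q)) (v, u)); [|now apply H].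
  apply (continuous_comp_2 (fun q : R * R => snd q) (fun q : R * R => fst q) (fun x y => (x, y)));
    [apply continuous_snd | apply continuous_fst |].
  apply (continuous_ext (fun z : R * R => z)); [now intros [] | apply continuous_id].
Qed.

Lemma ccont2_cint f a b c d : (a <= b)%R -> (c <= d)%R -> ccont2 f a b c d ->
  is_cint (fun u => cint (f u) c d) a b (cint (fun u => cint (f u) c d) a b).
Proof.
  intros Hab Hcd H.
  assert (I : forall u, (a <= u <= b)%R -> is_cint (f u) c d (cint (f u) c d)).
  { intros u Hu. apply cint_correct; [assumption|]. intros v Hv.
    now apply (ccont2_slice f a b c d). }
  assert (ER : ex_RInt (fun u => RInt (fun v => Re (f u v)) c d) a b).
  { apply (RInt_swap_rectangle (fun u v => Re (f u v))); try assumption.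
    intros u v Hu Hv. apply continuity_2d_pt_filterlim, (H u v Hu Hv). }
  assert (EI : ex_RInt (fun u => RInt (fun v => Im (f u v)) c d) a b).
  { apply (RInt_swap_rectangle (fun u v => Im (f u v))); try assumption.
    intros u v Hu Hv. apply continuity_2d_pt_filterlim, (H u v Hu Hv). }
  apply RInt_correct in ER. apply RInt_correct in EI.
  eapply is_cint_cint, is_cint_pair.
  - instantiate (1 := (_, _)).
    eapply is_RInt_ext; [|exact ER].
    rewrite Rmin_left, Rmax_right by assumption. intros u Hu.
    apply is_RInt_unique, is_cint_Re, I. lra.
  - eapply is_RInt_ext; [|exact EI].
    rewrite Rmin_left, Rmax_right by assumption. intros u Hu.
    apply is_RInt_unique, is_cint_Im, I. lra.
Qed.

Lemma cint_swap f a b c d : (a <= b)%R -> (c <= d)%R -> ccont2 f a b c d ->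
  cint (fun u => cint (f u) c d) a b = cint (fun v => cint (fun u => f u v) a b) c d.
Proof.
  intros Hab Hcd H.
  pose proof (ccont2_cint f a b c d Hab Hcd H) as A.
  pose proof (ccont2_swap _ _ _ _ _ H) as H'.
  pose proof (ccont2_cint _ c d a b Hcd Hab H') as B.
  assert (I : forall u, (a <= u <= b)%R -> is_cint (f u) c d (cint (f u) c d)).
  { intros u Hu. apply cint_correct; [assumption|]. intros v Hv.
    now apply (ccont2_slice f a b c d). }
  assert (J : forall v, (c <= v <= d)%R -> is_cint (fun u => f u v) a b (cint (fun u => f u v) a b)).
  { intros v Hv. apply cint_correct; [assumption|]. intros u Hu.
    now apply (ccont2_slice _ c d a b v u H'). }
  apply C_eq.
  - transitivity (RInt (fun u => RInt (fun v => Re (f u v)) c d) a b).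
    + symmetry. apply is_RInt_unique. eapply is_RInt_ext; [|apply is_cint_Re, A].
      rewrite Rmin_left, Rmax_right by assumption. intros u Hu. symmetry.
      apply is_RInt_unique, is_cint_Re, I. lra.
    + destruct (RInt_swap_rectangle (fun u v => Re (f u v)) a b c d) as [_ ->]; try assumption.
      { intros u v Hu Hv. apply continuity_2d_pt_filterlim, (H u v Hu Hv). }
      apply is_RInt_unique. eapply is_RInt_ext; [|apply is_cint_Re, B].
      rewrite Rmin_left, Rmax_right by assumption. intros v Hv. symmetry.
      apply is_RInt_unique, is_cint_Re, J. lra.
  - transitivity (RInt (fun u => RInt (fun v => Im (f u v)) c d) a b).
    + symmetry. apply is_RInt_unique. eapply is_RInt_ext; [|apply is_cint_Im, A].
      rewrite Rmin_left, Rmax_right by assumption. intros u Hu. symmetry.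
      apply is_RInt_unique, is_cint_Im, I. lra.
    + destruct (RInt_swap_rectangle (fun u v => Im (f u v)) a b c d) as [_ ->]; try assumption.
      { intros u v Hu Hv. apply continuity_2d_pt_filterlim, (H u v Hu Hv). }
      apply is_RInt_unique. eapply is_RInt_ext; [|apply is_cint_Im, B].
      rewrite Rmin_left, Rmax_right by assumption. intros v Hv. symmetry.
      apply is_RInt_unique, is_cint_Im, J. lra.
Qed.

#[global] Arguments INR : simpl never.

(** * Estimates for the exponential *)

Lemma exp_mono (x y : R) : (x <= y)%R -> (exp x <= exp y)%R.
Proof. intros [H|H]; [left; now apply exp_increasing | right; now f_equal]. Qed.

Lemma Cmod_Cexp_le (w : C) : (Cmod (Cexp w) <= exp (Cmod w))%R.
Proof. rewrite Cmod_Cexp. apply exp_mono, Re_le_Cmod. Qed.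

Lemma Cmod_scal_le (t : R) (w : C) : I01 t -> (Cmod (t * w) <= Cmod w)%R.
Proof.
  intro Ht. rewrite Cmod_mult, Cmod_R, Rabs_pos_eq by lra.
  pose proof (Cmod_ge_0 w). nra.
Qed.

(** Taylor's formula with integral remainder: [Cexp w - 1] is the integral of [w * Cexp (t * w)]
    over [0, 1]. *)
Lemma Cmod_Cexp_sub_1 (w : C) : (Cmod (Cexp w - 1) <= Cmod w * exp (Cmod w))%R.
Proof.
  assert (A : is_cint (fun t => w * Cexp (t * w)) 0 1 (Cexp (1%R * w) - Cexp (0%R * w))).
  { apply (is_cint_derive (fun t => Cexp (t * w))); [lra | |].
    - intros x _. eapply cder_eq.
      + apply (cder_Cexp (fun t => t * w)). apply cder_mult; [apply cder_id | apply cder_const].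
      + cbn beta; ring.
    - intros x _. apply ccont_mult; [apply ccont_const|].
      apply (cder_ccont _ _ ((1 * w + x * 0) * Cexp (x * w))).
      apply (cder_Cexp (fun t => t * w)). apply cder_mult; [apply cder_id | apply cder_const]. }
  rewrite Cmult_0_l, Cmult_1_l, Cexp_0 in A.
  replace (Cmod w * exp (Cmod w))%R with ((1 - 0) * (Cmod w * exp (Cmod w)))%R by ring.
  refine (is_cint_norm_const _ _ _ _ _ _ _ A); [lra|].
  intros t Ht. rewrite Cmod_mult. apply Rmult_le_compat_l; [apply Cmod_ge_0|].
  eapply Rle_trans; [apply Cmod_Cexp_le|]. apply exp_mono. now apply Cmod_scal_le.
Qed.

(** One order further, the integrand is [w * (Cexp (t * w) - 1)], to which the preceding bound
    applies. *)
Lemma Cmod_Cexp_sub_1_sub (w : C) :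
  (Cmod (Cexp w - 1 - w) <= Cmod w * (Cmod w * exp (Cmod w)))%R.
Proof.
  assert (A : is_cint (fun t => w * (Cexp (t * w) - 1)) 0 1
                ((Cexp (1%R * w) - 1%R * w) - (Cexp (0%R * w) - 0%R * w))).
  { apply (is_cint_derive (fun t => Cexp (t * w) - t * w)); [lra | |].
    - intros x _. eapply cder_eq.
      + apply cder_minus; [apply (cder_Cexp (fun t => t * w))|];
          (apply cder_mult; [apply cder_id | apply cder_const]).
      + cbn beta; ring.
    - intros x _. apply ccont_mult; [apply ccont_const|].
      apply ccont_minus; [|apply ccont_const].
      apply (cder_ccont _ _ ((1 * w + x * 0) * Cexp (x * w))).
      apply (cder_Cexp (fun t => t * w)). apply cder_mult; [apply cder_id | apply cder_const]. }
  rewrite !Cmult_0_l, !Cmult_1_l, Cexp_0 in A.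
  replace (Cexp w - 1 - w) with (Cexp w - w - (1 - 0)) by ring.
  replace (Cmod w * (Cmod w * exp (Cmod w)))%R
    with ((1 - 0) * (Cmod w * (Cmod w * exp (Cmod w))))%R by ring.
  refine (is_cint_norm_const _ _ _ _ _ _ _ A); [lra|].
  intros t Ht. rewrite Cmod_mult. apply Rmult_le_compat_l; [apply Cmod_ge_0|].
  eapply Rle_trans; [apply Cmod_Cexp_sub_1|].
  pose proof (Cmod_scal_le t w Ht). pose proof (exp_mono _ _ H).
  pose proof (Cmod_ge_0 (t * w)). pose proof (exp_pos (Cmod (t * w))). nra.
Qed.

(** * Limits of complex sequences *)

Definition clim (s : nat -> C) (l : C) : Prop :=
  is_lim_seq (fun n => Re (s n)) (Re l) /\ is_lim_seq (fun n => Im (s n)) (Im l).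

Lemma clim_Cmod (s : nat -> C) (l : C) :
  is_lim_seq (fun n => Cmod (s n - l)) 0 -> clim s l.
Proof.
  intro H. split.
  - apply (is_lim_seq_ext (fun n => Re (s n - l) + Re l)%R); [intro; simpl; unfold Re; simpl; ring|].
    replace (Finite (Re l)) with (Finite (0 + Re l)) by (f_equal; ring).
    apply is_lim_seq_plus'; [|apply is_lim_seq_const].
    apply is_lim_seq_abs_0. apply (is_lim_seq_le_le (fun _ => 0%R) _ (fun n => Cmod (s n - l))).
    + intro n. split; [apply Rabs_pos | apply re_le_Cmod].
    + apply is_lim_seq_const.
    + exact H.
  - apply (is_lim_seq_ext (fun n => Im (s n - l) + Im l)%R); [intro; simpl; unfold Im; simpl; ring|].
    replace (Finite (Im l)) with (Finite (0 + Im l)) by (f_equal; ring).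
    apply is_lim_seq_plus'; [|apply is_lim_seq_const].
    apply is_lim_seq_abs_0. apply (is_lim_seq_le_le (fun _ => 0%R) _ (fun n => Cmod (s n - l))).
    + intro n. split; [apply Rabs_pos | apply im_le_Cmod].
    + apply is_lim_seq_const.
    + exact H.
Qed.

Lemma clim_Cmod_sub (s : nat -> C) (l : C) :
  clim s l -> is_lim_seq (fun n => Cmod (s n - l)) 0.
Proof.
  intros [A B].
  apply (is_lim_seq_le_le (fun _ => 0%R) _
           (fun n => Rabs (Re (s n) - Re l) + Rabs (Im (s n) - Im l))%R).
  - intro n. split; [apply Cmod_ge_0|]. apply (Cmod_le_Re_Im (s n - l)).
  - apply is_lim_seq_const.
  - replace (Finite 0) with (Finite (Rabs (Re l - Re l) + Rabs (Im l - Im l))).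
    2:{ now rewrite !Rminus_diag, !Rabs_R0, Rplus_0_l. }
    apply is_lim_seq_plus'.
    + apply (is_lim_seq_abs _ (Finite _)). apply is_lim_seq_minus'; [exact A | apply is_lim_seq_const].
    + apply (is_lim_seq_abs _ (Finite _)). apply is_lim_seq_minus'; [exact B | apply is_lim_seq_const].
Qed.

Lemma Clim_seq_clim s l : clim s l -> Clim_seq s = l.
Proof.
  intros [A B]. unfold Clim_seq.
  rewrite (is_lim_seq_unique _ _ A), (is_lim_seq_unique _ _ B). now destruct l.
Qed.

Lemma clim_unique s l m : clim s l -> clim s m -> l = m.
Proof. intros A B. now rewrite <- (Clim_seq_clim s l), <- (Clim_seq_clim s m). Qed.

Lemma clim_const c : clim (fun _ => c) c.
Proof. split; apply is_lim_seq_const. Qed.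

Lemma clim_ext_loc s t l : eventually (fun n => s n = t n) -> clim s l -> clim t l.
Proof.
  intros E [A B]; split.
  - eapply is_lim_seq_ext_loc; [|exact A]. eapply filter_imp; [|exact E]. now intros n ->.
  - eapply is_lim_seq_ext_loc; [|exact B]. eapply filter_imp; [|exact E]. now intros n ->.
Qed.

Lemma clim_ext s t l : (forall n, s n = t n) -> clim s l -> clim t l.
Proof. intro E. apply clim_ext_loc. now apply filter_forall. Qed.

Lemma clim_plus s t l m : clim s l -> clim t m -> clim (fun n => s n + t n) (l + m).
Proof. intros [A B] [A' B']. split; now apply is_lim_seq_plus'. Qed.

Lemma clim_mult s t l m : clim s l -> clim t m -> clim (fun n => s n * t n) (l * m).
Proof.
  intros [A B] [A' B']. split.
  - apply (is_lim_seq_minus' (fun n => Re (s n) * Re (t n))%R (fun n => Im (s n) * Im (t n))%R);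
      now apply is_lim_seq_mult'.
  - apply (is_lim_seq_plus' (fun n => Re (s n) * Im (t n))%R (fun n => Im (s n) * Re (t n))%R);
      now apply is_lim_seq_mult'.
Qed.

Lemma clim_inv s l : clim s l -> l <> 0 -> clim (fun n => / s n) (/ l).
Proof.
  intros [A B] Hl.
  assert (P : (Re l ^ 2 + Im l ^ 2 <> 0)%R).
  { intro E. apply Hl. apply C_eq; simpl; nra. }
  assert (D : is_lim_seq (fun n => Re (s n) ^ 2 + Im (s n) ^ 2)%R (Re l ^ 2 + Im l ^ 2)%R).
  { apply (is_lim_seq_ext (fun n => Re (s n) * Re (s n) + Im (s n) * Im (s n))%R).
    { intro; ring. }
    replace (Re l ^ 2 + Im l ^ 2)%R with (Re l * Re l + Im l * Im l)%R by ring.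
    apply is_lim_seq_plus'; now apply is_lim_seq_mult'. }
  split.
  - now apply (is_lim_seq_div' (fun n => Re (s n)) (fun n => Re (s n) ^ 2 + Im (s n) ^ 2)%R).
  - apply (is_lim_seq_div' (fun n => - Im (s n))%R (fun n => Re (s n) ^ 2 + Im (s n) ^ 2)%R (- Im l));
      try assumption.
    exact (proj1 (is_lim_seq_opp _ (Finite _)) B).
Qed.

Lemma clim_incr_1 s l : clim s l <-> clim (fun n => s (S n)) l.
Proof.
  split; intros [A B]; split.
  - now apply is_lim_seq_incr_1 in A.
  - now apply is_lim_seq_incr_1 in B.
  - apply is_lim_seq_incr_1. exact A.
  - apply is_lim_seq_incr_1. exact B.
Qed.

Lemma clim_le (s : nat -> C) (l : C) (r : nat -> R) :
  (forall n, (Cmod (s n - l) <= r n)%R) -> is_lim_seq r 0 -> clim s l.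
Proof.
  intros H Hr. apply clim_Cmod.
  apply (is_lim_seq_le_le (fun _ => 0%R) _ r); [|apply is_lim_seq_const | exact Hr].
  intro n. split; [apply Cmod_ge_0 | apply H].
Qed.

Lemma inv_INR_lim : is_lim_seq (fun n => / INR (S n))%R 0.
Proof.
  replace (Finite 0) with (Rbar_inv p_infty) by reflexivity.
  apply is_lim_seq_inv; [|discriminate].
  apply -> is_lim_seq_incr_1. apply is_lim_seq_INR.
Qed.

(** * Convergence of infinite products *)

Section Product.
Context (Q d : nat -> C) (K : R).
Hypothesis (HQ : forall n, Q (S n) = Q n * (1 + d n)).
Hypothesis (HQ0 : forall n, Q n <> 0).
Hypothesis (HK : (0 <= K)%R).
Hypothesis (Hd : forall n, (Cmod (d n) <= K * (/ INR (S n) - / INR (S (S n))))%R).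

(** With r the ratio so far, |r (1 + d) - 1| <= |r - 1| (1 + |d|) + |d|, and 1 + |d| <= exp |d|. The
    bounds on d telescope, so the exponent retains only its two end values. *)
Lemma product_ratio_bound (m k : nat) :
  (Cmod (Q (k + m) / Q m - 1) <= exp (K * (/ INR (S m) - / INR (S (k + m)))) - 1)%R.
Proof.
  induction k as [|k IH].
  - simpl (0 + m)%nat. rewrite Rminus_diag, Rmult_0_r, exp_0.
    replace (Q m / Q m - 1) with (RtoC 0) by (field; apply HQ0). rewrite Cmod_0. lra.
  - simpl (S k + m)%nat. rewrite HQ.
    set (r := Q (k + m)%nat / Q m) in *. set (n := (k + m)%nat) in *.
    replace (Q n * (1 + d n) / Q m - 1) with ((r - 1) * (1 + d n) + d n)
      by (unfold r; field; apply HQ0).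
    eapply Rle_trans; [apply Cmod_triangle|]. rewrite Cmod_mult.
    assert (B : (Cmod (1 + d n) <= 1 + Cmod (d n))%R).
    { eapply Rle_trans; [apply Cmod_triangle|]. rewrite Cmod_1. lra. }
    pose proof (Hd n) as Hn. pose proof (Cmod_ge_0 (d n)).
    replace (K * (/ INR (S m) - / INR (S (S n))))%R with
      (K * (/ INR (S m) - / INR (S n)) + K * (/ INR (S n) - / INR (S (S n))))%R by ring.
    rewrite exp_plus.
    set (e := exp (K * (/ INR (S m) - / INR (S n)))) in *.
    assert (E : (1 + Cmod (d n) <= exp (K * (/ INR (S n) - / INR (S (S n)))))%R).
    { eapply Rle_trans; [apply exp_ineq1_le | now apply exp_mono]. }
    pose proof (Cmod_ge_0 (r - 1)). assert (0 < e)%R by apply exp_pos.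
    pose proof (Cmod_ge_0 (1 + d n)).
    apply Rle_trans with ((e - 1) * (1 + Cmod (d n)) + Cmod (d n))%R.
    2:{ pose proof (Rmult_le_compat_l e _ _ ltac:(lra) E). lra. }
    apply Rplus_le_compat_r. apply Rmult_le_compat; assumption.
Qed.

Lemma product_ratio_bound' (m n : nat) : (m <= n)%nat ->
  (Cmod (Q n / Q m - 1) <= exp (K * / INR (S m)) - 1)%R.
Proof.
  intro H. replace n with ((n - m) + m)%nat by lia.
  eapply Rle_trans; [apply product_ratio_bound|].
  apply Rplus_le_compat_r, exp_mono.
  assert (0 < / INR (S (n - m + m)))%R by (apply Rinv_0_lt_compat, lt_0_INR; lia). nra.
Qed.

(** The ratio bound makes [Q] bounded, hence a Cauchy sequence. From an index N where the bound is
    below 1/2 on, |Q n| >= |Q N| / 2, so the limit is not 0. *)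
Lemma product_converges : exists l, clim Q l /\ l <> 0.
Proof.
  set (M := (Cmod (Q O) * exp K)%R).
  assert (HM : forall n, (Cmod (Q n) <= M)%R).
  { intro n. pose proof (product_ratio_bound' 0 n ltac:(lia)) as H.
    change (INR 1) with 1%R in H. rewrite Rinv_1, Rmult_1_r in H.
    replace (Q n) with (Q O * (1 + (Q n / Q O - 1))) by (field; apply HQ0).
    rewrite Cmod_mult. apply Rmult_le_compat_l; [apply Cmod_ge_0|].
    eapply Rle_trans; [apply Cmod_triangle|]. rewrite Cmod_1. lra. }
  assert (HM0 : (0 < M)%R).
  { apply Rlt_le_trans with (Cmod (Q O)); [apply Cmod_gt_0, HQ0 | apply HM]. }
  assert (small : is_lim_seq (fun m => exp (K * / INR (S m)) - 1)%R 0).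
  { replace 0%R with (exp (K * 0) - 1)%R by (rewrite Rmult_0_r, exp_0; ring).
    apply is_lim_seq_minus'; [|apply is_lim_seq_const].
    apply (is_lim_seq_continuous exp).
    { apply derivable_continuous_pt, derivable_pt_exp. }
    apply (is_lim_seq_scal_l _ K (Finite 0)), inv_INR_lim. }
  assert (Cau : forall e : posreal, exists N, forall m n, (N <= m)%nat -> (m <= n)%nat ->
            (Cmod (Q n - Q m) < e)%R).
  { intros [e He]. apply is_lim_seq_spec in small.
    destruct (small (mkposreal (e / M) (Rdiv_lt_0_compat _ _ He HM0))) as [N HN]. simpl in *.
    exists N. intros m n Hm Hn.
    replace (Q n - Q m) with (Q m * (Q n / Q m - 1)) by (field; apply HQ0).
    rewrite Cmod_mult. pose proof (product_ratio_bound' m n Hn). specialize (HN m Hm).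
    rewrite Rminus_0_r in HN.
    pose proof (Rle_abs (exp (K * / INR (S m)) - 1)). pose proof (HM m).
    pose proof (Cmod_ge_0 (Q m)). pose proof (Cmod_ge_0 (Q n / Q m - 1)).
    apply Rle_lt_trans with (M * (Cmod (Q n / Q m - 1)))%R; [nra|].
    apply Rlt_le_trans with (M * (e / M))%R; [|right; field; lra].
    apply Rmult_lt_compat_l; [assumption|].
    lra. }
  assert (CR : forall f : C -> R, (forall z w, f (z - w) = (f z - f w)%R) ->
            (forall z, Rabs (f z) <= Cmod z)%R -> ex_finite_lim_seq (fun n => f (Q n))).
  { intros f Hf1 Hf2. apply ex_lim_seq_cauchy_corr. intro e. destruct (Cau e) as [N HN].
    exists N. intros n m Hn Hm. rewrite <- Hf1.
    eapply Rle_lt_trans; [apply Hf2|]. destruct (Nat.le_ge_cases m n).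
    - now apply HN.
    - replace (Q n - Q m) with (- (Q m - Q n)) by ring. rewrite Cmod_opp. now apply HN. }
  destruct (CR Re) as [a Ha]; [intros; reflexivity | apply re_le_Cmod |].
  destruct (CR Im) as [b Hb]; [intros; reflexivity | apply im_le_Cmod |].
  exists (a, b). split; [split; assumption|]. intro E.
  apply is_lim_seq_spec in small. destruct (small (mkposreal (1/2) ltac:(lra))) as [N HN].
  specialize (HN N (Nat.le_refl N)). simpl in HN. rewrite Rminus_0_r in HN.
  pose proof (Rle_abs (exp (K * / INR (S N)) - 1)) as Hab.
  assert (L : is_lim_seq (fun n => Cmod (Q n)) 0).
  { apply (is_lim_seq_ext (fun n => Cmod (Q n - (a, b)))).
    { intro n. rewrite E. f_equal. ring. }
    apply clim_Cmod_sub. split; assumption. }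
  assert (B : (Cmod (Q N) / 2 <= 0)%R).
  { apply (is_lim_seq_le_loc (fun _ => Cmod (Q N) / 2)%R (fun n => Cmod (Q n))
             (Cmod (Q N) / 2)%R 0); [|apply is_lim_seq_const | exact L].
    exists N. intros n Hn. pose proof (product_ratio_bound' N n Hn) as H.
    replace (Q n) with (Q N * (1 + (Q n / Q N - 1))) by (field; apply HQ0).
    rewrite Cmod_mult. apply Rmult_le_compat_l; [apply Cmod_ge_0|].
    eapply Rle_trans; [|apply Cmod_sub_ge]. rewrite Cmod_1. lra. }
  pose proof (proj1 (Cmod_gt_0 _) (HQ0 N)). lra.
Qed.

End Product.

(** * The Gamma function *)

Definition not_nonpos_int (z : C) : Prop := forall n : nat, z + RtoC (INR n) <> 0.

(** The sequence inside [Cgamma], which is therefore [Clim_seq (euler z)] by conversion. *)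
Definition euler (z : C) (n : nat) : C :=
  RtoC (INR (fact n)) * Cexp (z * RtoC (ln (INR n))) / poch z (S n).

Lemma RtoC_neq_0 (r : R) : (r <> 0)%R -> RtoC r <> 0.
Proof. intros H E. injection E. exact H. Qed.

Lemma RtoC_INR_S_neq_0 (n : nat) : RtoC (INR (S n)) <> 0.
Proof. apply RtoC_neq_0, not_0_INR. discriminate. Qed.

Lemma poch_neq_0 z n : not_nonpos_int z -> poch z n <> 0.
Proof.
  intro H. induction n; simpl; [apply RtoC_neq_0; lra|].
  apply Cmult_neq_0; [assumption | apply H].
Qed.

Lemma poch_shift z n : poch z (S n) = z * poch (z + 1) n.
Proof.
  induction n as [|n IH]; [simpl; unfold INR; ring|].
  change (poch z (S (S n))) with (poch z (S n) * (z + RtoC (INR (S n)))).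
  rewrite IH. simpl. rewrite S_INR, RtoC_plus. ring.
Qed.

Lemma RtoC_fact_neq_0 n : RtoC (INR (fact n)) <> 0.
Proof. apply RtoC_neq_0, INR_fact_neq_0. Qed.

Lemma ln_le_sub_1 x : (0 < x)%R -> (ln x <= x - 1)%R.
Proof.
  intro H. pose proof (exp_ineq1_le (ln x)) as E. rewrite exp_ln in E by assumption. lra.
Qed.

(** With m = n + 1, h = 1/(m + 1) and dl = ln (m + 1) - ln m one has h <= dl <= 1/m. Writing rho for
    the second-order remainder of exp(- z dl), the quantity equals z (h - dl) - z^2 h dl + (1 + z h)
    rho, and each term is at most a constant times g = 1/m - h = h/m. *)
Lemma euler_step_bound (z : C) (n : nat) :
  (Cmod ((1 + z * RtoC (/ INR (S (S n)))) *
         Cexp (- z * RtoC (ln (INR (S (S n))) - ln (INR (S n)))) - 1)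
   <= (Cmod z + 2 * Cmod z * Cmod z + 2 * (1 + Cmod z) * (Cmod z * (Cmod z * exp (Cmod z))))
      * (/ INR (S n) - / INR (S (S n))))%R.
Proof.
  set (m := INR (S n)). assert (Hm : (1 <= m)%R) by (unfold m; rewrite S_INR; pose proof (pos_INR n); lra).
  replace (INR (S (S n))) with (m + 1)%R by (unfold m; now rewrite (S_INR (S n))).
  set (dl := (ln (m + 1) - ln m)%R). set (h := (/ (m + 1))%R).
  assert (Hh : (0 < h <= 1)%R).
  { unfold h. split; [apply Rinv_0_lt_compat; lra|]. rewrite <- Rinv_1. apply Rinv_le_contravar; lra. }
  assert (Hi : (0 < / m <= 1)%R).
  { split; [apply Rinv_0_lt_compat; lra|]. rewrite <- Rinv_1. apply Rinv_le_contravar; lra. }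
  assert (D1 : (dl <= / m)%R).
  { unfold dl. rewrite <- ln_div by lra. eapply Rle_trans; [apply ln_le_sub_1, Rdiv_lt_0_compat; lra|].
    right. field. lra. }
  assert (D2 : (h <= dl)%R).
  { assert (E : (- dl <= m / (m + 1) - 1)%R).
    { unfold dl. replace (- (ln (m + 1) - ln m))%R with (ln m - ln (m + 1))%R by ring.
      rewrite <- ln_div by lra. apply ln_le_sub_1, Rdiv_lt_0_compat; lra. }
    replace (m / (m + 1) - 1)%R with (- h)%R in E by (unfold h; field; lra). lra. }
  set (g := (/ m - h)%R).
  assert (Hg : (h * / m = g)%R) by (unfold g, h; field; lra).
  assert (Hg2 : (/ m * / m <= 2 * g)%R).
  { rewrite <- Hg. unfold h. replace (2 * (/ (m + 1) * / m))%R with ((2 * / (m + 1)) * / m)%R by ring.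
    apply Rmult_le_compat_r; [lra|]. apply (Rmult_le_reg_r (m * (m + 1))); [nra|].
    replace (/ m * (m * (m + 1)))%R with (m + 1)%R by (field; lra).
    replace (2 * / (m + 1) * (m * (m + 1)))%R with (2 * m)%R by (field; lra). lra. }
  assert (Hg0 : (0 <= g)%R) by (rewrite <- Hg; apply Rmult_le_pos; lra).
  set (w := - z * RtoC dl). set (rho := Cexp w - 1 - w).
  replace ((1 + z * RtoC h) * Cexp w - 1)
    with (z * RtoC (h - dl) - z * z * RtoC (h * dl) + (1 + z * RtoC h) * rho).
  2:{ unfold rho. unfold w at 2. rewrite RtoC_minus, RtoC_mult. ring. }
  assert (Hz := Cmod_ge_0 z).
  assert (Hw : (Cmod w <= Cmod z * / m)%R).
  { unfold w. rewrite Cmod_mult, Cmod_opp, Cmod_R, Rabs_pos_eq by lra.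
    apply Rmult_le_compat_l; assumption. }
  assert (Hw1 : (Cmod w <= Cmod z)%R) by nra.
  assert (Hrho : (Cmod rho <= (Cmod z * (Cmod z * exp (Cmod z))) * (2 * g))%R).
  { eapply Rle_trans; [apply Cmod_Cexp_sub_1_sub|].
    pose proof (Cmod_ge_0 w). pose proof (exp_pos (Cmod w)).
    pose proof (exp_mono _ _ Hw1).
    apply Rle_trans with (((Cmod z * / m) * (Cmod z * / m)) * exp (Cmod z))%R.
    - rewrite <- Rmult_assoc. apply Rmult_le_compat; try nra.
    - replace (Cmod z * / m * (Cmod z * / m) * exp (Cmod z))%R
        with ((Cmod z * (Cmod z * exp (Cmod z))) * (/ m * / m))%R by ring.
      apply Rmult_le_compat_l; [|assumption].
      pose proof (exp_pos (Cmod z)). nra. }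
  assert (T1 : (Cmod (z * RtoC (h - dl)) <= Cmod z * g)%R).
  { rewrite Cmod_mult, Cmod_R. apply Rmult_le_compat_l; [assumption|].
    rewrite Rabs_left1 by lra. unfold g. lra. }
  assert (T2 : (Cmod (z * z * RtoC (h * dl)) <= Cmod z * Cmod z * g)%R).
  { rewrite !Cmod_mult, Cmod_R. apply Rmult_le_compat_l; [nra|].
    rewrite Rabs_pos_eq by nra. rewrite <- Hg. apply Rmult_le_compat_l; lra. }
  assert (T3 : (Cmod (1 + z * RtoC h) <= 1 + Cmod z)%R).
  { eapply Rle_trans; [apply Cmod_triangle|]. rewrite Cmod_1, Cmod_mult, Cmod_R, Rabs_pos_eq by lra. nra. }
  eapply Rle_trans; [apply Cmod_triangle|].
  eapply Rle_trans; [apply Rplus_le_compat_r; apply Cmod_triangle|].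
  rewrite Cmod_opp, (Cmod_mult (1 + _)).
  assert (T4 : (Cmod (1 + z * RtoC h) * Cmod rho <=
    (1 + Cmod z) * ((Cmod z * (Cmod z * exp (Cmod z))) * (2 * g)))%R).
  { apply Rmult_le_compat; try apply Cmod_ge_0; assumption. }
  change (/ m - / (m + 1))%R with g.
  assert (0 <= Cmod z * Cmod z * g)%R by (repeat apply Rmult_le_pos; assumption).
  set (e := (Cmod z * (Cmod z * exp (Cmod z)))%R) in *. clearbody e.
  replace ((Cmod z + 2 * Cmod z * Cmod z + 2 * (1 + Cmod z) * e) * g)%R with
   (Cmod z * g + 2 * (Cmod z * Cmod z * g) + (1 + Cmod z) * (e * (2 * g)))%R by ring.
  lra.
Qed.

Lemma euler_limit (z : C) : not_nonpos_int z -> exists l, clim (euler z) l /\ l <> 0.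
Proof.
  intro Hz.
  (* The reciprocal of [euler z (S n)]: its successive quotients are the factors of
     [euler_step_bound]. Starting at [S n] keeps clear of the logarithm of 0. *)
  set (Q := fun n => poch z (S (S n)) / (RtoC (INR (fact (S n))) * Cexp (z * RtoC (ln (INR (S n)))))).
  set (K := (Cmod z + 2 * Cmod z * Cmod z + 2 * (1 + Cmod z) * (Cmod z * (Cmod z * exp (Cmod z))))%R).
  assert (HD : forall n, RtoC (INR (fact (S n))) * Cexp (z * RtoC (ln (INR (S n)))) <> 0).
  { intro n. apply Cmult_neq_0; [apply RtoC_fact_neq_0 | apply Cexp_neq_0]. }
  assert (HQ0 : forall n, Q n <> 0).
  { intro n. unfold Q, Cdiv. apply Cmult_neq_0; [now apply poch_neq_0|].
    intro E. pose proof (Cinv_r _ (HD n)) as E'. rewrite E, Cmult_0_r in E'. injection E'; lra. }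
  destruct (product_converges Q
     (fun n => (1 + z * RtoC (/ INR (S (S n)))) *
         Cexp (- z * RtoC (ln (INR (S (S n))) - ln (INR (S n)))) - 1) K) as [l [Hl Hl0]].
  - intro n. unfold Q.
    change (poch z (S (S (S n)))) with (poch z (S (S n)) * (z + RtoC (INR (S (S n))))).
    change (fact (S (S n))) with (S (S n) * fact (S n))%nat.
    rewrite mult_INR, !RtoC_mult, RtoC_minus.
    replace (- z * (RtoC (ln (INR (S (S n)))) - RtoC (ln (INR (S n)))))
      with (z * RtoC (ln (INR (S n))) - z * RtoC (ln (INR (S (S n))))) by ring.
    rewrite Cexp_minus, RtoC_inv.
    2:{ apply not_0_INR; discriminate. }
    field. repeat split; try apply Cexp_neq_0; try apply RtoC_fact_neq_0; apply RtoC_INR_S_neq_0.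
  - assumption.
  - unfold K. pose proof (Cmod_ge_0 z). pose proof (exp_pos (Cmod z)).
    assert (0 <= Cmod z * (Cmod z * exp (Cmod z)))%R by (repeat apply Rmult_le_pos; lra).
    nra.
  - intro n. apply euler_step_bound.
  - exists (/ l). split.
    + apply clim_incr_1. apply (clim_ext (fun n => / Q n)).
      * intro n. unfold Q, euler. field. repeat split;
          try apply Cexp_neq_0; try apply RtoC_fact_neq_0. now apply poch_neq_0.
      * now apply clim_inv.
    + intro E. pose proof (Cinv_r _ Hl0) as E'. rewrite E, Cmult_0_r in E'. injection E'; lra.
Qed.

Lemma Cgamma_spec (z : C) : not_nonpos_int z -> clim (euler z) (Cgamma z) /\ Cgamma z <> 0.
Proof.
  intro H. destruct (euler_limit z H) as [l [Hl Hl0]].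
  replace (Cgamma z) with l; [split; assumption|].
  symmetry. now apply Clim_seq_clim.
Qed.

Lemma not_nonpos_int_S z : not_nonpos_int z -> not_nonpos_int (z + 1).
Proof.
  intros H n E. apply (H (S n)). rewrite S_INR, RtoC_plus, <- E. ring.
Qed.

(** [euler (z + 1) n] is [z * euler z n] times n / (n + z + 1), and this factor tends to 1. *)
Lemma Cgamma_S (z : C) : not_nonpos_int z -> Cgamma (z + 1) = z * Cgamma z.
Proof.
  intro H. apply (clim_unique (euler (z + 1))).
  { now apply Cgamma_spec, not_nonpos_int_S. }
  assert (L : clim (fun n => / (1 + (z + 1) * RtoC (/ INR (S n)))) 1).
  { assert (E1 : / (1 + (z + 1) * RtoC 0) = 1).
    { rewrite Cmult_0_r, Cplus_0_r, <- RtoC_inv by lra. now rewrite Rinv_1. }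
    cut (clim (fun n => / (1 + (z + 1) * RtoC (/ INR (S n)))) (/ (1 + (z + 1) * RtoC 0))).
    { now rewrite E1. }
    apply clim_inv.
    - apply clim_plus; [apply clim_const|]. apply clim_mult; [apply clim_const|].
      split; simpl; [apply inv_INR_lim | apply is_lim_seq_const].
    - rewrite Cmult_0_r, Cplus_0_r. apply RtoC_neq_0; lra. }
  apply clim_incr_1.
  apply (clim_ext (fun n => z * euler z (S n) * / (1 + (z + 1) * RtoC (/ INR (S n))))).
  - intro n. unfold euler.
    assert (Hn : RtoC (INR (S n)) <> 0) by apply RtoC_INR_S_neq_0.
    assert (Hz := H O). change (INR 0) with 0%R in Hz. rewrite Cplus_0_r in Hz.
    assert (P : poch (z + 1) (S (S n)) = poch z (S (S n)) * (z + 1 + RtoC (INR (S n))) / z).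
    { change (poch (z + 1) (S (S n))) with (poch (z + 1) (S n) * (z + 1 + RtoC (INR (S n)))).
      rewrite (poch_shift z (S n)). field. assumption. }
    rewrite P. rewrite (Cmult_plus_distr_r z 1 (RtoC (ln _))), Cexp_plus, Cmult_1_l, Cexp_RtoC, exp_ln.
    2:{ apply lt_0_INR; lia. }
    rewrite RtoC_inv by (apply not_0_INR; discriminate).
    assert (H2 : z + 1 + RtoC (INR (S n)) <> 0).
    { intro E. apply (H (S (S n))). rewrite (S_INR (S n)), RtoC_plus, <- E. ring. }
    assert (H3 : poch z (S (S n)) <> 0) by now apply poch_neq_0.
    field. repeat split; try assumption.
  - rewrite <- (Cmult_1_r (z * Cgamma z)). apply clim_mult; [|exact L].
    apply clim_mult; [apply clim_const|]. apply -> clim_incr_1. now apply Cgamma_spec.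
Qed.

(** An exact form of the asymptotic relation (w)_(n+1) / (z)_(n+1) ~ Gamma(z) / Gamma(w) n^(w-z); it
    converts the Pochhammer quotients produced by the contiguity relations into Gamma values. *)
Lemma euler_ratio (z w : C) (n : nat) : not_nonpos_int z -> not_nonpos_int w ->
  poch w (S n) / poch z (S n) = euler z n / euler w n * Cexp ((w - z) * RtoC (ln (INR n))).
Proof.
  intros Hz Hw. unfold euler. replace ((w - z) * RtoC (ln (INR n))) with (w * RtoC (ln (INR n)) - z * RtoC (ln (INR n))) by ring.
  rewrite Cexp_minus.
  field. repeat split; try apply Cexp_neq_0; try apply RtoC_fact_neq_0; now apply poch_neq_0.
Qed.

#[global] Arguments Cexp : simpl never.

(** * Circles and the logarithm continued along them *)

Lemma circle_Cexp r u : (0 < r)%R -> circle r u = Cexp (circle_log r u).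
Proof.
  intro H. unfold circle, circle_log. now rewrite Cexp_plus, Cexp_RtoC, exp_ln.
Qed.

Lemma Re_2PIu (u : R) : Re (2 * PI * u * Ci) = 0%R.
Proof. unfold Re; simpl. ring. Qed.

Lemma Im_2PIu (u : R) : Im (2 * PI * u * Ci) = (2 * PI * u)%R.
Proof. unfold Im; simpl. ring. Qed.

Lemma Cmod_circle r u : (0 <= r)%R -> Cmod (circle r u) = r.
Proof.
  intro H. unfold circle. rewrite Cmod_mult, Cmod_R, Cmod_Cexp, Re_2PIu, exp_0, Rabs_pos_eq by lra. ring.
Qed.

Lemma Re_circle_le r u : (0 <= r)%R -> (- r <= Re (circle r u) <= r)%R.
Proof.
  intro H. pose proof (re_le_Cmod (circle r u)) as A. rewrite Cmod_circle in A by assumption.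
  apply Rabs_le_between in A. lra.
Qed.

Lemma Cexp_2PI_Ci : Cexp (2 * PI * Ci) = 1.
Proof.
  unfold Cexp. apply C_eq; unfold Re, Im; simpl;
    rewrite ?Rmult_0_l, ?Rmult_0_r, ?Rmult_1_r, ?Rminus_0_r, ?Rplus_0_r, ?Rplus_0_l, ?exp_0.
  - replace (2 * PI - 0 * 0)%R with (2 * PI)%R by ring. rewrite cos_2PI, Rminus_diag, exp_0. ring.
  - rewrite sin_2PI. ring.
Qed.

Lemma circle_0 r : circle r 0 = r.
Proof.
  unfold circle. replace (2 * PI * 0%R * Ci) with (RtoC 0) by ring. rewrite Cexp_0. ring.
Qed.

Lemma circle_1 r : circle r 1 = r.
Proof.
  unfold circle. replace (2 * PI * 1%R * Ci) with (2 * PI * Ci) by ring. rewrite Cexp_2PI_Ci. ring.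
Qed.

Lemma circle_log_0 r : circle_log r 0 = ln r.
Proof. unfold circle_log. ring. Qed.

Lemma circle_log_1 r : circle_log r 1 = ln r + 2 * PI * Ci.
Proof. unfold circle_log. ring. Qed.

Lemma Cexp_circle_log_1 p r :
  Cexp (p * circle_log r 1) = (monodromy_minus_1 p + 1) * Cexp (p * ln r).
Proof.
  rewrite circle_log_1. unfold monodromy_minus_1.
  replace (p * (ln r + 2 * PI * Ci)) with (2 * PI * Ci * p + p * ln r) by ring.
  rewrite Cexp_plus. ring.
Qed.

Lemma cder_2PIu (x : R) : cder (fun u => 2 * PI * RtoC u * Ci) x (2 * PI * Ci).
Proof.
  eapply cder_eq.
  - apply (cder_mult (fun u => 2 * PI * RtoC u) (fun _ => Ci)); [|apply cder_const].
    apply cder_scal, cder_id.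
  - cbn beta. ring.
Qed.

Lemma cder_circle_u r u : cder (circle r) u (2 * PI * Ci * circle r u).
Proof.
  unfold circle. eapply cder_eq; [apply cder_scal, (cder_Cexp (fun u => 2 * PI * RtoC u * Ci)), cder_2PIu|].
  cbn beta. ring.
Qed.

Lemma cder_circle_log_u r u : cder (circle_log r) u (2 * PI * Ci).
Proof.
  unfold circle_log. eapply cder_eq; [apply (cder_plus (fun _ => RtoC (ln r))); [apply cder_const | apply cder_2PIu]|].
  cbn beta. ring.
Qed.

Lemma cder_circle_r r u : cder (fun r => circle r u) r (Cexp (2 * PI * u * Ci)).
Proof.
  unfold circle. eapply cder_eq; [apply (cder_mult RtoC (fun _ => Cexp (2 * PI * u * Ci))); [apply cder_id | apply cder_const]|].
  cbn beta. ring.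
Qed.

Lemma cder_circle_log_r r u : (0 < r)%R -> cder (fun r => circle_log r u) r (RtoC (/ r)).
Proof.
  intro Hr. unfold circle_log. eapply cder_eq.
  - apply (cder_plus (fun r => RtoC (ln r)) (fun _ => 2 * PI * u * Ci)); [|apply cder_const].
    apply cder_RtoC. now apply is_derive_ln.
  - cbn beta. ring.
Qed.

Ltac ccont_step :=
  match goal with
  | |- ccont (fun _ => ?c) _ => apply ccont_const
  | |- ccont (fun _ => Cplus _ _) _ => apply ccont_plus
  | |- ccont (fun _ => Cminus _ _) _ => apply ccont_minus
  | |- ccont (fun _ => Copp _) _ => apply ccont_opp
  | |- ccont (fun _ => Cmult _ _) _ => apply ccont_mult
  | |- ccont (fun _ => Cexp _) _ => apply ccont_Cexp
  | |- ccont (fun _ => RtoC _) _ => apply ccont_RtoC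
  | |- ccont RtoC _ => apply (ccont_RtoC (fun x => x))
  | |- continuous fst _ => apply continuous_fst
  | |- continuous snd _ => apply continuous_snd
  | |- continuous (fun _ => fst _) _ => apply continuous_fst
  | |- continuous (fun _ => snd _) _ => apply continuous_snd
  | |- continuous (fun x => x) _ => apply continuous_id
  | |- continuous (fun _ => ?c) _ => apply continuous_const
  | |- continuous (fun _ => Rplus _ _) _ => apply continuous_Rplus
  | |- continuous (fun _ => Rminus _ _) _ => apply continuous_Rminus
  | |- continuous (fun _ => Ropp _) _ => apply continuous_Ropp
  | |- continuous (fun _ => Rmult _ _) _ => apply continuous_Rmult
  end.

Lemma ccont_circle {U : UniformSpace} (f g : U -> R) p :
  continuous f p -> continuous g p -> ccont (fun q => circle (f q) (g q)) p.
Proof. intros Hf Hg. unfold circle. repeat ccont_step; assumption. Qed.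

Lemma ccont_circle_log {U : UniformSpace} (f g : U -> R) p : (0 < f p)%R ->
  continuous f p -> continuous g p -> ccont (fun q => circle_log (f q) (g q)) p.
Proof.
  intros H0 Hf Hg. unfold circle_log. repeat ccont_step; try assumption.
  eapply (continuous_via ln); [exact Hf | now apply is_derive_ln].
Qed.

(** * Complex differentiability, along all curves *)

(** Functions are only ever composed with the real curves r |-> circle r u and u |-> circle r u.
    Testing along curves makes the chain rule a definition, while the common factor l for all
    velocities m retains the complex linearity behind the Cauchy-Riemann equations. *)
Definition cdiff (h : C -> C) (z l : C) : Prop :=
  forall (g : R -> C) (x : R) (m : C), g x = z -> cder g x m -> cder (fun t => h (g t)) x (l * m).

Lemma cdiff_eq h z l l' : cdiff h z l -> l = l' -> cdiff h z l'.
Proof. now intros H <-. Qed.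

Lemma cdiff_const c z : cdiff (fun _ => c) z 0.
Proof. intros g x m _ _. eapply cder_eq; [apply cder_const | ring]. Qed.

Lemma cdiff_id z : cdiff (fun z => z) z 1.
Proof. intros g x m _ H. eapply cder_eq; [exact H | ring]. Qed.

Lemma cdiff_plus f g z l m : cdiff f z l -> cdiff g z m -> cdiff (fun z => f z + g z) z (l + m).
Proof.
  intros A B c x k E H. eapply cder_eq; [apply cder_plus; [apply A | apply B]; eassumption | ring].
Qed.

Lemma cdiff_mult f g z l m : cdiff f z l -> cdiff g z m ->
  cdiff (fun z => f z * g z) z (l * g z + f z * m).
Proof.
  intros A B c x k E H. eapply cder_eq; [apply cder_mult; [apply A | apply B]; eassumption|].
  cbn beta. rewrite E. ring.
Qed.

Lemma cdiff_Cexp f z l : cdiff f z l -> cdiff (fun z => Cexp (f z)) z (l * Cexp (f z)).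
Proof.
  intros A c x k E H. eapply cder_eq; [apply (cder_Cexp (fun t => f (c t))), A; eassumption|].
  cbn beta. rewrite E. ring.
Qed.

Lemma cdiff_Clog f z l : cdiff f z l -> (0 < Re (f z))%R -> cdiff (fun z => Clog (f z)) z (l / f z).
Proof.
  intros A Hp c x k E H. eapply cder_eq.
  - apply (cder_Clog (fun t => f (c t))); [apply A; eassumption|]. now rewrite E.
  - cbn beta. rewrite E. field. now apply Re_pos_neq_0.
Qed.

(** * The regularized integral over a circle *)

(* r^alpha: since ln 0 = 0 in Rocq, [Cexp (alpha * ln r)] alone would take the
   junk value 1 at r = 0; with 0 there it is continuous when Re alpha > 0. *)
Definition rpow (alpha : C) (r : R) : C :=
  if Rle_dec r 0 then 0 else Cexp (alpha * ln r).

Lemma rpow_pos alpha r : (0 < r)%R -> rpow alpha r = Cexp (alpha * ln r).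
Proof. intro H. unfold rpow. destruct (Rle_dec r 0); [lra | reflexivity]. Qed.

Lemma Cmod_rpow alpha r : (0 < r)%R -> Cmod (rpow alpha r) = exp (Re alpha * ln r).
Proof.
  intro H. rewrite rpow_pos, Cmod_Cexp by assumption. f_equal. unfold Re; simpl. ring.
Qed.

Lemma Cmod_rpow_mono alpha r s : (0 <= Re alpha)%R -> (r <= s)%R -> (0 < s)%R ->
  (Cmod (rpow alpha r) <= Cmod (rpow alpha s))%R.
Proof.
  intros Ha Hrs Hs. destruct (Rle_dec r 0).
  - unfold rpow at 1. destruct (Rle_dec r 0); [|lra]. rewrite Cmod_0. apply Cmod_ge_0.
  - rewrite !Cmod_rpow by lra. apply exp_mono. apply Rmult_le_compat_l; [assumption|].
    destruct Hrs as [Hrs|<-]; [left; apply ln_increasing; lra | lra].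
Qed.

Lemma rpow_1 alpha : rpow alpha 1 = 1.
Proof. rewrite rpow_pos, ln_1, Cmult_0_r by lra. apply Cexp_0. Qed.

Lemma Cmod_rpow_le_1 alpha r : (0 <= Re alpha)%R -> (r <= 1)%R -> (Cmod (rpow alpha r) <= 1)%R.
Proof.
  intros Ha Hr. replace 1%R with (Cmod (rpow alpha 1)).
  - apply Cmod_rpow_mono; lra.
  - now rewrite rpow_1, Cmod_1.
Qed.

Lemma ccont_rpow alpha r : (0 < Re alpha)%R -> ccont (rpow alpha) r.
Proof.
  intro Ha. destruct (total_order_T r 0) as [[Hr|Hr]|Hr].
  - assert (L : locally r (fun y => y < 0)%R) by now apply (open_lt 0).
    split; (eapply (continuous_ext_loc' (U := R_UniformSpace) (fun _ => 0%R));
      [|apply continuous_const]); (eapply filter_imp; [|exact L]); intros y Hy; unfold rpow;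
      destruct (Rle_dec y 0); simpl; try reflexivity; lra.
  - subst r.
    (* For y > 0, |y^alpha| = y^(Re alpha), which is below e as soon as y < e^(1 / Re alpha). *)
    assert (S : forall e : posreal, locally 0%R (fun y => Cmod (rpow alpha y) < e)%R).
    { intros [e He]. simpl.
      exists (mkposreal _ (exp_pos (ln e / Re alpha))). intros y Hy.
      change (Rabs (y - 0) < exp (ln e / Re alpha))%R in Hy. rewrite Rminus_0_r in Hy.
      pose proof (Rle_abs y) as Hya.
      destruct (Rle_dec y 0).
      - unfold rpow. destruct (Rle_dec y 0); [|lra]. now rewrite Cmod_0.
      - rewrite Cmod_rpow by lra. apply Rlt_le_trans with (exp (ln e)); [|rewrite exp_ln; lra].
        apply exp_increasing.
        assert (ln y < ln e / Re alpha)%R.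
        { rewrite <- (ln_exp (ln e / Re alpha)). apply ln_increasing; lra. }
        apply (Rmult_lt_compat_l (Re alpha)) in H; [|assumption].
        replace (Re alpha * (ln e / Re alpha))%R with (ln e) in H by (field; lra). exact H. }
    assert (Z : rpow alpha 0 = 0).
    { unfold rpow. destruct (Rle_dec 0 0); [reflexivity | lra]. }
    split; apply filterlim_locally; intro e; (eapply filter_imp; [|apply (S e)]);
      intros y Hy; rewrite Z.
    + change (Rabs (Re (rpow alpha y) - 0) < e)%R. rewrite Rminus_0_r.
      eapply Rle_lt_trans; [apply re_le_Cmod | exact Hy].
    + change (Rabs (Im (rpow alpha y) - 0) < e)%R. rewrite Rminus_0_r.
      eapply Rle_lt_trans; [apply im_le_Cmod | exact Hy].
  - assert (L : locally r (fun y => 0 < y)%R) by now apply (open_gt 0).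
    assert (K : ccont (fun y => Cexp (alpha * RtoC (ln y))) r).
    { repeat ccont_step. eapply is_derive_cont. now apply is_derive_ln. }
    destruct K as [K1 K2].
    split.
    + eapply (continuous_ext_loc' (U := R_UniformSpace)); [|exact K1].
      eapply filter_imp; [|exact L]. intros y Hy. now rewrite rpow_pos.
    + eapply (continuous_ext_loc' (U := R_UniformSpace)); [|exact K2].
      eapply filter_imp; [|exact L]. intros y Hy. now rewrite rpow_pos.
Qed.

(** The integral of z^alpha h(z) dz along the circle, with z^alpha continued from the starting point
    r; the last factor is dz/du. *)
Definition circle_integral (alpha : C) (h : C -> C) (r : R) : C :=
  cint (fun u => Cexp (alpha * circle_log r u) * h (circle r u) * (2 * PI * Ci * circle r u)) 0 1.

Lemma Cmod_2PI_Ci : Cmod (2 * PI * Ci) = (2 * PI)%R.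
Proof.
  rewrite !Cmod_mult, Cmod_Ci, !Cmod_R, !Rabs_pos_eq; pose proof PI_RGT_0; lra.
Qed.

Section Circle.
Context (alpha : C) (h h' : C -> C) (eps M : R).
Hypothesis (Ha : (0 < Re alpha)%R) (He : (0 < eps)%R).
Hypothesis (Hd : forall z, (Cmod z <= eps)%R -> cdiff h z (h' z)).
Hypothesis (Hc : forall z, (Cmod z <= eps)%R -> ccont h z).
Hypothesis (Hc' : forall z, (Cmod z <= eps)%R -> ccont h' z).
Hypothesis (HM : forall z, (Cmod z <= eps)%R -> (Cmod (h z) <= M)%R).

Lemma ccont_h_circle {U : UniformSpace} (k : C -> C) (f g : U -> R) p :
  (forall z, (Cmod z <= eps)%R -> ccont k z) -> (0 <= f p <= eps)%R ->
  continuous f p -> continuous g p -> ccont (fun q => k (circle (f q) (g q))) p.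
Proof.
  intros Hk H0 Hf Hg.
  apply (ccont_comp (V := C_UniformSpace) (fun q => circle (f q) (g q)) k).
  - apply ccont_continuous. now apply ccont_circle.
  - apply Hk. rewrite Cmod_circle; lra.
Qed.

Lemma circle_integrand_cont r : (0 < r <= eps)%R -> forall u, I01 u ->
  ccont (fun u => Cexp (alpha * circle_log r u) * h (circle r u) * (2 * PI * Ci * circle r u)) u.
Proof.
  intros Hr u _. repeat ccont_step.
  - apply (ccont_circle_log (fun _ => r) (fun u => u)); [lra | apply continuous_const | apply continuous_id].
  - apply (ccont_h_circle h (fun _ => r) (fun u => u)); [assumption | lra | apply continuous_const | apply continuous_id].
  - apply (ccont_circle (fun _ => r) (fun u => u)); [apply continuous_const | apply continuous_id].
Qed.

(** Since Re alpha > 0, the integrand stays bounded as the radius shrinks, and the length 2 pi r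
    gives the factor r. The term 2 pi |Im alpha| accounts for the imaginary part 2 pi u of the
    continued logarithm. *)
Lemma circle_integral_bound r : (0 < r <= eps)%R ->
  (Cmod (circle_integral alpha h r)
   <= exp (Re alpha * ln eps + 2 * PI * Rabs (Im alpha)) * M * (2 * PI) * r)%R.
Proof.
  intro Hr. assert (HM0 : (0 <= M)%R).
  { eapply Rle_trans; [apply Cmod_ge_0|]. apply (HM 0). rewrite Cmod_0. lra. }
  unfold circle_integral.
  rewrite <- (Rmult_1_l (_ * r)). rewrite <- (Rminus_0_r 1) at 2.
  eapply is_cint_norm_const; [lra | | apply cint_correct; [lra | now apply circle_integrand_cont]].
  intros u Hu. cbn beta.
  rewrite (Cmod_mult _ (_ * circle r u)), (Cmod_mult (Cexp _)), (Cmod_mult (2 * PI * Ci)).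
  rewrite Cmod_2PI_Ci, Cmod_circle, Cmod_Cexp by lra.
  rewrite !Rmult_assoc. pose proof PI_RGT_0.
  apply Rmult_le_compat; [left; apply exp_pos | | |].
  - apply Rmult_le_pos; [apply Cmod_ge_0|]. apply Rmult_le_pos; [lra|]. apply Rmult_le_pos; lra.
  - apply exp_mono. unfold circle_log.
    assert (E : Re (alpha * (ln r + 2 * PI * u * Ci)) = (Re alpha * ln r - 2 * PI * u * Im alpha)%R)
      by (unfold Re, Im; simpl; ring).
    rewrite E.
    assert (ln r <= ln eps)%R.
    { destruct Hr as [Hr1 [Hr2| ->]]; [left; apply ln_increasing; lra | lra]. }
    pose proof (Rle_abs (- Im alpha)). rewrite Rabs_Ropp in H1.
    assert (Re alpha * ln r <= Re alpha * ln eps)%R by (apply Rmult_le_compat_l; lra).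
    assert (- (2 * PI * u * Im alpha) <= 2 * PI * Rabs (Im alpha))%R.
    { apply Rle_trans with (2 * PI * (u * Rabs (Im alpha)))%R.
      - replace (- (2 * PI * u * Im alpha))%R with (2 * PI * (u * - Im alpha))%R by ring.
        apply Rmult_le_compat_l; [lra|]. apply Rmult_le_compat_l; lra.
      - apply Rmult_le_compat_l; [lra|]. pose proof (Rabs_pos (Im alpha)). nra. }
    lra.
  - apply Rmult_le_compat_r; [apply Rmult_le_pos; [lra|]; apply Rmult_le_pos; lra|].
    apply HM. rewrite Cmod_circle; lra.
Qed.

(* In the coordinate L = ln r + 2 pi i u the integrand is holomorphic, so its
   r-derivative is a u-derivative, whose integral over the circle is the jump
   exp(2 pi i alpha) - 1 of the branch. *)
Lemma circle_integral_diff r0 : (0 < r0 <= eps)%R ->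
  circle_integral alpha h eps - circle_integral alpha h r0
  = monodromy_minus_1 alpha * cint (fun r => rpow alpha r * h (RtoC r)) r0 eps.
Proof.
  intro H0.
  (* The factor z of dz = z dL is absorbed into the exponent alpha + 1, whose monodromy is that of
     alpha. *)
  set (k := fun r u => Cexp ((alpha + 1) * circle_log r u) * h (circle r u)).
  set (k' := fun r u => Cexp ((alpha + 1) * circle_log r u)
                        * ((alpha + 1) * h (circle r u) + h' (circle r u) * circle r u)).
  assert (Dr : forall r u, (r0 <= r <= eps)%R ->
            cder (fun r => k r u) r (RtoC (/ r) * k' r u)).
  { intros r u Hr. eapply cder_eq.
    - apply cder_mult.
      + apply (cder_Cexp (fun r => (alpha + 1) * circle_log r u)), cder_scal, cder_circle_log_r. lra.
      + apply (Hd (circle r u)) with (g := fun r => circle r u);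
          [rewrite Cmod_circle; lra | reflexivity | apply cder_circle_r].
    - unfold k'. cbn beta. rewrite RtoC_inv by lra.
      assert (RtoC r <> 0) by (apply RtoC_neq_0; lra).
      unfold circle at 5. field. assumption. }
  assert (Du : forall r u, (r0 <= r <= eps)%R -> cder (fun u => k r u) u (2 * PI * Ci * k' r u)).
  { intros r u Hr. eapply cder_eq.
    - apply cder_mult.
      + apply (cder_Cexp (fun u => (alpha + 1) * circle_log r u)), cder_scal, cder_circle_log_u.
      + apply (Hd (circle r u)) with (g := fun u => circle r u);
          [rewrite Cmod_circle; lra | reflexivity | apply cder_circle_u].
    - unfold k'. cbn beta. ring. }
  assert (Ck' : ccont2 k' r0 eps 0 1).
  { intros r u Hr Hu. unfold k'. repeat ccont_step.
    - apply (ccont_circle_log fst snd); [simpl; lra | apply continuous_fst | apply continuous_snd].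
    - apply (ccont_h_circle h fst snd); [assumption | simpl; lra | apply continuous_fst | apply continuous_snd].
    - apply (ccont_h_circle h' fst snd); [assumption | simpl; lra | apply continuous_fst | apply continuous_snd].
    - apply (ccont_circle fst snd); [apply continuous_fst | apply continuous_snd]. }
  assert (Ck2 : ccont2 (fun r u => RtoC (/ r) * (2 * PI * Ci * k' r u)) r0 eps 0 1).
  { intros r u Hr Hu. apply ccont_mult.
    - apply ccont_RtoC. eapply (continuous_via Rinv _ (r, u)); [apply continuous_fst|].
      apply (is_derive_inv (fun x => x) r 1); [apply (is_derive_id (K := R_AbsRing)) | lra].
    - apply ccont_mult; [apply ccont_const | now apply Ck']. }
  assert (EI : forall r, (r0 <= r <= eps)%R ->
             circle_integral alpha h r = cint (fun u => 2 * PI * Ci * k r u) 0 1).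
  { intros r Hr. apply cint_ext; [lra|]. intros u _. unfold k.
    rewrite (circle_Cexp r u) at 2 by lra.
    rewrite Cmult_plus_distr_r, Cexp_plus, Cmult_1_l. ring. }
  assert (Ck : forall r, (r0 <= r <= eps)%R -> forall u, I01 u -> ccont (fun u => 2 * PI * Ci * k r u) u).
  { intros r Hr u _. apply ccont_mult; [apply ccont_const|]. eapply cder_ccont. now apply Du. }
  rewrite !EI by lra.
  rewrite <- cint_minus by (try apply Ck; lra).
  rewrite (cint_ext _ (fun u => cint (fun r => RtoC (/ r) * (2 * PI * Ci * k' r u)) r0 eps)).
  2: lra.
  2:{ intros u Hu. symmetry. apply is_cint_unique.
    replace (2 * PI * Ci * k eps u - 2 * PI * Ci * k r0 u)
      with (2 * PI * Ci * k eps u - (2 * PI * Ci * k r0 u)) by ring.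
    apply (is_cint_derive (fun r => 2 * PI * Ci * k r u)); [lra | |].
    - intros r Hr. eapply cder_eq; [apply cder_scal, Dr, Hr | ring].
    - intros r Hr. apply (ccont2_slice (fun u r => RtoC (/ r) * (2 * PI * Ci * k' r u)) 0 1 r0 eps u r);
        [now apply (ccont2_swap _ r0 eps 0 1 Ck2) | lra | lra]. }
  rewrite <- (cint_swap (fun r u => RtoC (/ r) * (2 * PI * Ci * k' r u)) r0 eps 0 1) by (assumption || lra).
  rewrite <- cint_scal.
  2: lra.
  2:{ intros r Hr. apply ccont_mult; [now apply ccont_rpow|].
    apply (ccont_comp (V := C_UniformSpace) RtoC h).
    - apply ccont_continuous. repeat ccont_step.
    - apply Hc. rewrite Cmod_R, Rabs_pos_eq; lra. }
  apply cint_ext; [lra|]. intros r Hr.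
  rewrite cint_scal.
  2: lra.
  2:{ intros u Hu. apply ccont_mult; [apply ccont_const|].
    apply (ccont2_slice k' r0 eps 0 1); [assumption | lra | lra]. }
  rewrite (is_cint_unique _ _ _ (k r 1 - k r 0)).
  - unfold k. rewrite Cexp_circle_log_1, circle_log_0, circle_0, circle_1, rpow_pos by lra.
    assert (Em : monodromy_minus_1 (alpha + 1) = monodromy_minus_1 alpha).
    { unfold monodromy_minus_1. rewrite Cmult_plus_distr_l, Cmult_1_r, Cexp_plus, Cexp_2PI_Ci. ring. }
    rewrite Em, (Cmult_plus_distr_r alpha 1), Cexp_plus, Cmult_1_l, Cexp_RtoC, exp_ln, RtoC_inv by lra.
    field. apply RtoC_neq_0; lra.
  - apply (is_cint_derive (fun u => k r u)); [lra | |].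
    + intros u Hu. apply Du. lra.
    + intros u Hu. apply ccont_mult; [apply ccont_const|].
      apply (ccont2_slice k' r0 eps 0 1); [assumption | lra | lra].
Qed.

Lemma ccont_rpow_h r : (0 <= r <= eps)%R -> ccont (fun r => rpow alpha r * h (RtoC r)) r.
Proof.
  intro Hr. apply ccont_mult; [now apply ccont_rpow|].
  apply (ccont_comp (V := C_UniformSpace) RtoC h).
  - apply ccont_continuous. repeat ccont_step.
  - apply Hc. rewrite Cmod_R, Rabs_pos_eq; lra.
Qed.

(** By [circle_integral_diff] the difference [D] of the two sides may be computed at any radius r <=
    eps. There the circle and the segment [0, r] both contribute O(r), so [D] is 0. *)
Theorem circle_integral_segment :
  circle_integral alpha h eps = monodromy_minus_1 alpha * cint (fun r => rpow alpha r * h (RtoC r)) 0 eps.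
Proof.
  set (c := monodromy_minus_1 alpha). set (f := fun r => rpow alpha r * h (RtoC r)).
  assert (HM0 : (0 <= M)%R).
  { eapply Rle_trans; [apply Cmod_ge_0|]. apply (HM 0). rewrite Cmod_0. lra. }
  set (D := circle_integral alpha h eps - c * cint f 0 eps).
  set (K := (exp (Re alpha * ln eps + 2 * PI * Rabs (Im alpha)) * M * (2 * PI)
             + Cmod c * (Cmod (rpow alpha eps) * M))%R).
  assert (HK : forall r, (0 < r <= eps)%R -> (Cmod D <= K * r)%R).
  { intros r Hr.
    assert (E : D = circle_integral alpha h r - c * cint f 0 r).
    { unfold D. rewrite (is_cint_unique f 0 eps (cint f 0 r + cint f r eps)).
      - pose proof (circle_integral_diff r Hr) as E. fold c f in E.
        replace (circle_integral alpha h eps)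
          with (circle_integral alpha h eps - circle_integral alpha h r + circle_integral alpha h r) by ring.
        rewrite E. ring.
      - apply (is_cint_Chasles _ _ r);
          (apply cint_correct; [lra|]; intros; apply ccont_rpow_h; lra). }
    rewrite E. eapply Rle_trans; [apply Cmod_triangle|].
    rewrite Cmod_opp, Cmod_mult. unfold K. rewrite Rmult_plus_distr_r.
    apply Rplus_le_compat; [now apply circle_integral_bound|].
    rewrite Rmult_assoc. apply Rmult_le_compat_l; [apply Cmod_ge_0|].
    rewrite Rmult_comm. replace r with (r - 0)%R at 2 by ring.
    eapply is_cint_norm_const; [lra | | apply cint_correct; [lra|]; intros; apply ccont_rpow_h; lra].
    intros x Hx. unfold f. rewrite Cmod_mult. apply Rmult_le_compat; try apply Cmod_ge_0.
    - apply Cmod_rpow_mono; lra.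
    - apply HM. rewrite Cmod_R, Rabs_pos_eq; lra. }
  assert (HK0 : (0 <= K)%R).
  { pose proof (HK eps ltac:(lra)). pose proof (Cmod_ge_0 D). nra. }
  assert (D0 : Cmod D = 0%R).
  { apply Rle_antisym; [|apply Cmod_ge_0]. apply Rnot_lt_le. intro HD.
    (* At this radius K r <= |D| / 2, against |D| <= K r; the [+ 1] avoids a division by zero. *)
    set (r := Rmin eps (Cmod D / (2 * (K + 1)))).
    assert (Hr : (0 < r)%R) by (apply Rmin_glb_lt; [assumption | apply Rdiv_lt_0_compat; lra]).
    pose proof (HK r ltac:(split; [assumption | apply Rmin_l])) as H1.
    pose proof (Rmin_r eps (Cmod D / (2 * (K + 1)))) as H2. fold r in H2.
    assert (K * r <= K * (Cmod D / (2 * (K + 1))))%R by now apply Rmult_le_compat_l.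
    assert (K * (Cmod D / (2 * (K + 1))) <= Cmod D / 2)%R.
    { apply (Rmult_le_reg_r (2 * (K + 1))); [lra|].
      replace (K * (Cmod D / (2 * (K + 1))) * (2 * (K + 1)))%R with (K * Cmod D)%R by (field; lra). nra. }
    lra. }
  apply Cmod_eq_0 in D0. unfold D in D0.
  replace (circle_integral alpha h eps)
    with (circle_integral alpha h eps - c * cint f 0 eps + c * cint f 0 eps) by ring.
  rewrite D0. ring.
Qed.

End Circle.

(** * Beta integrals *)

Lemma rpow_succ alpha r : rpow (alpha + 1) r = r * rpow alpha r.
Proof.
  unfold rpow. destruct (Rle_dec r 0) as [H|H]; [ring|].
  rewrite Cmult_plus_distr_r, Cexp_plus, Cmult_1_l, Cexp_RtoC, exp_ln by lra. ring.
Qed.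

Lemma rpow_0 alpha : rpow alpha 0 = 0.
Proof. unfold rpow. destruct (Rle_dec 0 0); [reflexivity | lra]. Qed.

(** The difference quotient at 0 is [g k]. This gives the derivative of s^(alpha+1) = s * s^alpha at
    the end point 0, where the logarithm cannot be differentiated. *)
Lemma is_derive_mul_id (g : R -> R) : continuous g 0%R -> is_derive (fun s => s * g s)%R 0%R (g 0%R).
Proof.
  intro H. apply is_derive_Reals. intros e He.
  apply filterlim_locally with (eps := mkposreal e He) in H. destruct H as [d Hd].
  exists d. intros k Hk Hkd. rewrite Rplus_0_l.
  replace ((k * g k - 0 * g 0) / k - g 0)%R with (g k - g 0)%R by (field; assumption).
  apply Hd. change (Rabs (k - 0) < d)%R. now rewrite Rminus_0_r.
Qed.

Lemma cder_rpow alpha r : (0 < Re alpha)%R -> (0 <= r)%R ->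
  cder (rpow (alpha + 1)) r ((alpha + 1) * rpow alpha r).
Proof.
  intros Ha [Hr|<-].
  - assert (K : cder (fun y => Cexp ((alpha + 1) * RtoC (ln y))) r ((alpha + 1) * rpow alpha r)).
    { eapply cder_eq.
      - apply (cder_Cexp (fun y => (alpha + 1) * RtoC (ln y))), cder_scal, cder_RtoC, is_derive_ln, Hr.
      - cbn beta. rewrite rpow_pos by assumption.
        rewrite (Cmult_plus_distr_r alpha 1 (RtoC (ln r))), Cexp_plus, Cmult_1_l, Cexp_RtoC, exp_ln, RtoC_inv by lra.
        field. apply RtoC_neq_0; lra. }
    assert (L : locally r (fun y => 0 < y)%R) by now apply (open_gt 0).
    destruct K as [K1 K2]. split.
    + eapply (is_derive_ext_loc (V := R_NormedModule)); [|exact K1]. eapply filter_imp; [|exact L].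
      intros y Hy. now rewrite rpow_pos.
    + eapply (is_derive_ext_loc (V := R_NormedModule)); [|exact K2]. eapply filter_imp; [|exact L].
      intros y Hy. now rewrite rpow_pos.
  - destruct (ccont_rpow alpha 0 Ha) as [A B].
    rewrite rpow_0, Cmult_0_r. split.
    + apply (is_derive_ext (fun s => s * Re (rpow alpha s))%R).
      { intro t. rewrite rpow_succ, Re_mult. simpl. ring. }
      eapply is_derive_eq; [now apply is_derive_mul_id | now rewrite rpow_0].
    + apply (is_derive_ext (fun s => s * Im (rpow alpha s))%R).
      { intro t. rewrite rpow_succ, Im_mult. simpl. ring. }
      eapply is_derive_eq; [now apply is_derive_mul_id | now rewrite rpow_0].
Qed.

(** Euler's B(x + 1, N + 1). *)
Definition beta (x : C) (N : nat) : C := cint (fun s => rpow x s * RtoC ((1 - s) ^ N)) 0 1.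

Lemma is_derive_one_sub_pow (N : nat) (s : R) :
  is_derive (fun s => (1 - s) ^ S N)%R s (- (INR (S N) * (1 - s) ^ N))%R.
Proof.
  auto_derive; [trivial|]. change (Nat.pred (S N)) with N. unfold Rminus. ring.
Qed.

Lemma ccont_beta x N s : (0 < Re x)%R -> ccont (fun s => rpow x s * RtoC ((1 - s) ^ N)) s.
Proof.
  intro H. apply ccont_mult; [now apply ccont_rpow|]. apply ccont_RtoC.
  destruct N; [apply continuous_const | eapply is_derive_cont, is_derive_one_sub_pow].
Qed.

Lemma Re_plus_1 x : Re (x + 1) = (Re x + 1)%R.
Proof. reflexivity. Qed.

Lemma C_sub_eq_0 (a b : C) : a - b = 0 -> a = b.
Proof. intro E. replace a with (a - b + b) by ring. rewrite E. ring. Qed.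

Lemma beta_S x N : (0 < Re x)%R -> (x + 1) * beta x (S N) = RtoC (INR (S N)) * beta (x + 1) N.
Proof.
  intro H. assert (H' : (0 < Re (x + 1))%R) by (rewrite Re_plus_1; lra).
  unfold beta. rewrite <- !cint_scal by (try lra; intros; now apply ccont_beta).
  assert (E : is_cint (fun s => (x + 1) * (rpow x s * RtoC ((1 - s) ^ S N))
                - RtoC (INR (S N)) * (rpow (x + 1) s * RtoC ((1 - s) ^ N))) 0 1 0).
  { replace (RtoC 0) with (rpow (x + 1) 1 * RtoC ((1 - 1) ^ S N) - rpow (x + 1) 0 * RtoC ((1 - 0) ^ S N)).
    2:{ rewrite rpow_0, Rminus_diag, pow_i by lia. ring. }
    apply (is_cint_derive (fun s => rpow (x + 1) s * RtoC ((1 - s) ^ S N))); [lra | |].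
    - intros s Hs. eapply cder_eq.
      + apply cder_mult; [apply cder_rpow; [assumption | lra] |].
        apply cder_RtoC, is_derive_one_sub_pow.
      + cbn beta. rewrite RtoC_opp, RtoC_mult. ring.
    - intros s Hs. apply ccont_minus; (apply ccont_mult; [apply ccont_const | now apply ccont_beta]). }
  apply is_cint_unique in E. apply C_sub_eq_0.
  rewrite <- cint_minus; [exact E | lra | |];
    intros; (apply ccont_mult; [apply ccont_const | now apply ccont_beta]).
Qed.

Lemma beta_0 x : (0 < Re x)%R -> (x + 1) * beta x 0 = 1.
Proof.
  intro H. unfold beta. rewrite <- cint_scal by (try lra; intros; now apply ccont_beta).
  assert (E : is_cint (fun s => (x + 1) * (rpow x s * RtoC ((1 - s) ^ 0))) 0 1
                (rpow (x + 1) 1 - rpow (x + 1) 0)).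
  { apply (is_cint_derive (rpow (x + 1))); [lra | |].
    - intros s Hs. eapply cder_eq; [apply cder_rpow; [assumption | lra]|]. simpl. ring.
    - intros s _. apply ccont_mult; [apply ccont_const | now apply ccont_beta]. }
  apply is_cint_unique in E. rewrite E, rpow_0, rpow_1. apply C_eq; simpl; ring.
Qed.

Lemma not_nonpos_int_Re_pos z : (0 < Re z)%R -> not_nonpos_int z.
Proof.
  intros H n E. pose proof (pos_INR n). apply (f_equal Re) in E. simpl in E. unfold Re in *. lra.
Qed.

Lemma beta_poch (N : nat) (x : C) : (0 < Re x)%R ->
  beta x N = RtoC (INR (fact N)) / poch (x + 1) (S N).
Proof.
  revert x. induction N as [|N IH]; intros x H.
  - assert (x + 1 <> 0) by (apply Re_pos_neq_0; rewrite Re_plus_1; lra).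
    pose proof (beta_0 x H) as E. simpl. change (INR 0) with 0%R. change (INR 1) with 1%R.
    rewrite <- E at 1. field. assumption.
  - assert (H' : (0 < Re (x + 1))%R) by (rewrite Re_plus_1; lra).
    assert (x + 1 <> 0) by (apply Re_pos_neq_0; lra).
    assert (P : poch (x + 1 + 1) (S N) <> 0).
    { apply poch_neq_0, not_nonpos_int_Re_pos. rewrite Re_plus_1. lra. }
    rewrite (poch_shift (x + 1) (S N)).
    change (fact (S N)) with (S N * fact N)%nat. rewrite mult_INR, RtoC_mult.
    replace (beta x (S N)) with ((x + 1) * beta x (S N) / (x + 1)) by (field; assumption).
    rewrite beta_S, IH by assumption. field. split; assumption.
Qed.

(** The bridge from integrals to [Cgamma]: Euler's quotient for Gamma(x + 1) is a normalised Beta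
    integral. *)
Lemma beta_euler (N : nat) (x : C) : (0 < Re x)%R ->
  Cexp ((x + 1) * ln (INR N)) * beta x N = euler (x + 1) N.
Proof. intro H. rewrite beta_poch by assumption. unfold euler, Cdiv. ring. Qed.

(** The real power with the same value 0 at s <= 0 as [rpow], so that |s^alpha| is [rp (Re alpha) s]
    for every s; it supplies the majorants of the corner estimate. *)
Definition rp (a s : R) : R := if Rle_dec s 0 then 0%R else exp (a * ln s).

Lemma rp_ge_0 a s : (0 <= rp a s)%R.
Proof. unfold rp. destruct (Rle_dec s 0); [lra | left; apply exp_pos]. Qed.

Lemma rpow_RtoC a s : rpow (RtoC a) s = RtoC (rp a s).
Proof.
  unfold rpow, rp. destruct (Rle_dec s 0); [reflexivity|].
  now rewrite <- RtoC_mult, Cexp_RtoC.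
Qed.

Lemma Cmod_rpow_rp alpha s : Cmod (rpow alpha s) = rp (Re alpha) s.
Proof.
  unfold rp. destruct (Rle_dec s 0).
  - unfold rpow. destruct (Rle_dec s 0); [apply Cmod_0 | lra].
  - apply Cmod_rpow. lra.
Qed.

Lemma rp_succ a s : rp (a + 1) s = (s * rp a s)%R.
Proof.
  unfold rp. destruct (Rle_dec s 0); [ring|].
  rewrite Rmult_plus_distr_r, exp_plus, Rmult_1_l, exp_ln by lra. ring.
Qed.

Definition rbeta (a : R) (N : nat) : R := RInt (fun s => rp a s * (1 - s) ^ N)%R 0 1.

Lemma continuous_rbeta a N s : (0 < a)%R -> continuous (fun s => rp a s * (1 - s) ^ N)%R s.
Proof.
  intro H. destruct (ccont_beta (RtoC a) N s H) as [A _].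
  eapply continuous_ext; [|exact A]. intro t. cbn beta. rewrite rpow_RtoC, <- RtoC_mult. reflexivity.
Qed.

Lemma is_RInt_rbeta a N u v : (0 < a)%R ->
  is_RInt (fun s => rp a s * (1 - s) ^ N)%R u v (RInt (fun s => rp a s * (1 - s) ^ N)%R u v).
Proof.
  intro H. apply (RInt_correct (V := R_CompleteNormedModule)), (ex_RInt_continuous (V := R_CompleteNormedModule)).
  intros; now apply continuous_rbeta.
Qed.

Lemma beta_rbeta a N : (0 < a)%R -> beta (RtoC a) N = RtoC (rbeta a N).
Proof.
  intro H. apply is_cint_unique, is_cint_pair.
  - eapply is_RInt_ext; [|now apply is_RInt_rbeta]. intros s _. cbn beta.
    rewrite rpow_RtoC, <- RtoC_mult. reflexivity.
  - apply (is_RInt_ext (fun _ => 0%R)).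
    + intros s _. rewrite rpow_RtoC, <- RtoC_mult. reflexivity.
    + replace (Im (RtoC (rbeta a N))) with (scal (1 - 0)%R 0%R).
      * apply (is_RInt_const (V := R_NormedModule)).
      * unfold scal; simpl; unfold mult; simpl. ring.
Qed.

Lemma rbeta_ge_0 a N : (0 < a)%R -> (0 <= rbeta a N)%R.
Proof.
  intro Ha. apply (RInt_ge_0 _ 0 1); [lra | eexists; now apply is_RInt_rbeta |].
  intros s Hs. apply Rmult_le_pos; [apply rp_ge_0 | apply pow_le; lra].
Qed.

(** An extra factor s under the integral costs a factor of order 1/N. This is the quantitative form
    of concentration at s = 0. *)
Lemma rbeta_succ a N : (0 < a)%R ->
  (rbeta (a + 1) N = (a + 1) / INR (S N) * rbeta a (S N))%R.
Proof.
  intro Ha. pose proof (beta_S (RtoC a) N Ha) as E.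
  rewrite <- RtoC_plus, !beta_rbeta, <- !RtoC_mult in E by lra.
  apply RtoC_inj in E. assert (INR (S N) <> 0)%R by (apply not_0_INR; discriminate).
  apply (Rmult_eq_reg_l (INR (S N))); [|assumption]. rewrite <- E. field. assumption.
Qed.

Lemma rbeta_S_le a N : (0 < a)%R -> (rbeta a (S N) <= rbeta a N)%R.
Proof.
  intro Ha. unfold rbeta. apply RInt_le; [lra | eexists; now apply is_RInt_rbeta | eexists; now apply is_RInt_rbeta |].
  intros s Hs. apply Rmult_le_compat_l; [apply rp_ge_0|]. simpl.
  pose proof (pow_le (1 - s) N ltac:(lra)). nra.
Qed.

Lemma rbeta_part_le a N e : (0 < a)%R -> I01 e ->
  (0 <= RInt (fun s => rp a s * (1 - s) ^ N) 0 e <= rbeta a N)%R.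
Proof.
  intros Ha He.
  assert (P : forall u v, (0 <= u <= v)%R -> (v <= 1)%R ->
    (0 <= RInt (fun s => rp a s * (1 - s) ^ N) u v)%R).
  { intros u v Hu Hv. apply (RInt_ge_0 _ u v); [lra | eexists; now apply is_RInt_rbeta |].
    intros s Hs. apply Rmult_le_pos; [apply rp_ge_0 | apply pow_le; lra]. }
  split; [apply P; lra|]. unfold rbeta.
  rewrite <- (RInt_Chasles (V := R_CompleteNormedModule) _ 0 e 1) by (eexists; now apply is_RInt_rbeta).
  unfold plus; simpl. pose proof (P e 1%R ltac:(lra) ltac:(lra)). unfold C_R_CompleteNormedModule in *. lra.
Qed.

Lemma is_RInt_lin3 (f1 f2 f3 : R -> R) a b I1 I2 I3 k1 k2 k3 :
  is_RInt f1 a b I1 -> is_RInt f2 a b I2 -> is_RInt f3 a b I3 ->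
  is_RInt (fun s => k1 * f1 s + k2 * f2 s + k3 * f3 s)%R a b (k1 * I1 + k2 * I2 + k3 * I3)%R.
Proof.
  intros H1 H2 H3.
  apply (is_RInt_plus (V := R_NormedModule)); [apply (is_RInt_plus (V := R_NormedModule))|];
    now apply (is_RInt_scal (V := R_NormedModule)).
Qed.

(** * Concentration of the integral at the corner l_1 = l_2 = 0 *)

Lemma pow_sub_le x y n : (0 <= x <= y)%R ->
  (0 <= y ^ S n - x ^ S n <= INR (S n) * (y - x) * y ^ n)%R.
Proof.
  intro H. induction n as [|n IH].
  - simpl. unfold INR. lra.
  - rewrite S_INR. set (k := INR (S n)) in *.
    change (y ^ S (S n))%R with (y * y ^ S n)%R. change (x ^ S (S n))%R with (x * x ^ S n)%R.
    pose proof (pow_le x (S n) ltac:(lra)). pose proof (pow_incr x y (S n) H).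
    assert (y ^ S n = y * y ^ n)%R by reflexivity.
    assert (0 <= k)%R by (unfold k; apply pos_INR). nra.
Qed.

(** The constant 3 comes from |ln x| <= 1/x - 1 = (1 - x)/x <= 3 (1 - x) for x in [1/3, 1]. *)
Lemma Cmod_Cexp_ln_sub_1 (g : C) (x : R) : (1 / 3 <= x <= 1)%R ->
  (Cmod (Cexp (g * ln x) - 1) <= 3 * Cmod g * exp (3 * Cmod g) * (1 - x))%R.
Proof.
  intro Hx.
  assert (L : (Rabs (ln x) <= 3 * (1 - x))%R).
  { assert (ln x <= 0)%R by (rewrite <- ln_1; apply ln_le; lra).
    rewrite Rabs_left1 by assumption. rewrite <- ln_Rinv by lra.
    eapply Rle_trans; [apply ln_le_sub_1, Rinv_0_lt_compat; lra|].
    apply (Rmult_le_reg_r x); [lra|]. rewrite Rmult_minus_distr_r, Rinv_l by lra. nra. }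
  eapply Rle_trans; [apply Cmod_Cexp_sub_1|].
  rewrite Cmod_mult, Cmod_R. pose proof (Cmod_ge_0 g). pose proof (Rabs_pos (ln x)).
  replace (3 * Cmod g * exp (3 * Cmod g) * (1 - x))%R
    with ((Cmod g * (3 * (1 - x))) * exp (3 * Cmod g))%R by ring.
  apply Rmult_le_compat.
  - now apply Rmult_le_pos.
  - left; apply exp_pos.
  - now apply Rmult_le_compat_l.
  - apply exp_mono. nra.
Qed.

Lemma pow_exp_ln x N : (0 < x)%R -> (x ^ N = exp (INR N * ln x))%R.
Proof. intro H. rewrite <- ln_pow, exp_ln by (assumption || now apply pow_lt). reflexivity. Qed.

(* (1 - s)(1 - t) - (1 - s - t) = s t, so that (1 - s - t)^N is close to the
   product (1 - s)^N (1 - t)^N near s = t = 0, where the integral concentrates. *)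
Lemma corner_pointwise (g : C) (s t : R) (n : nat) : (0 <= s)%R -> (0 <= t)%R -> (1 / 3 <= 1 - s - t)%R ->
  (Cmod (Cexp ((g + RtoC (INR (S n))) * RtoC (ln (1 - s - t))) - RtoC ((1 - s) ^ S n * (1 - t) ^ S n))
   <= 3 * Cmod g * exp (3 * Cmod g) * (s + t) * ((1 - s) ^ S n * (1 - t) ^ S n)
      + INR (S n) * (s * t) * ((1 - s) ^ n * (1 - t) ^ n))%R.
Proof.
  intros Hs Ht Hx. set (x := (1 - s - t)%R) in *. set (y := ((1 - s) * (1 - t))%R).
  assert (Hxy : (y - x = s * t)%R) by (unfold x, y; ring).
  rewrite <- !Rpow_mult_distr. fold y. rewrite <- Hxy.
  assert (0 <= s * t)%R by now apply Rmult_le_pos.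
  destruct (pow_sub_le x y n ltac:(lra)) as [P1 P2].
  rewrite Cmult_plus_distr_r, Cexp_plus, <- RtoC_mult, Cexp_RtoC, <- pow_exp_ln by lra.
  replace (Cexp (g * ln x) * RtoC (x ^ S n) - RtoC (y ^ S n))
    with ((Cexp (g * ln x) - 1) * RtoC (x ^ S n) + - (RtoC (y ^ S n - x ^ S n)))
    by (rewrite RtoC_minus; ring).
  eapply Rle_trans; [apply Cmod_triangle|].
  rewrite Cmod_opp, Cmod_mult, !Cmod_R, (Rabs_pos_eq (y ^ S n - _)) by assumption.
  pose proof (pow_le x (S n) ltac:(lra)) as P3. rewrite (Rabs_pos_eq (x ^ S n)) by assumption.
  apply Rplus_le_compat; [|assumption].
  apply Rmult_le_compat; [apply Cmod_ge_0 | assumption | | lra].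
  replace (s + t)%R with (1 - x)%R by (unfold x; ring).
  apply Cmod_Cexp_ln_sub_1. unfold x in *. lra.
Qed.

Section Corner.
Context (alpha bet gam : C) (eps : R).
Hypothesis (Ha : (0 < Re alpha)%R) (Hb : (0 < Re bet)%R) (He : (0 < eps < 1 / 3)%R).

Let a := Re alpha.
Let b := Re bet.
Let C1 := (3 * Cmod gam * exp (3 * Cmod gam))%R.

(** What the torus over the corner becomes once both circles are contracted to segments: s = l_1, t
    = l_2, and l_3 = 1 - s - t carries the exponent gam + N. *)
Definition corner (N : nat) : C :=
  cint (fun t => cint (fun s => rpow bet t * (rpow alpha s *
     Cexp ((gam + RtoC (INR N)) * RtoC (ln (1 - s - t))))) 0 eps) 0 eps.

Definition part_beta (x : C) (N : nat) : C := cint (fun s => rpow x s * RtoC ((1 - s) ^ N)) 0 eps.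

Lemma corner_ccont2 N : ccont2 (fun t s => rpow bet t * (rpow alpha s *
     Cexp ((gam + RtoC (INR N)) * RtoC (ln (1 - s - t))))) 0 eps 0 eps.
Proof.
  intros t s Ht Hs. apply ccont_mult; [|apply ccont_mult].
  - apply (ccont_comp (V := R_UniformSpace) fst (rpow bet)); [apply continuous_fst | now apply ccont_rpow].
  - apply (ccont_comp (V := R_UniformSpace) snd (rpow alpha)); [apply continuous_snd | now apply ccont_rpow].
  - repeat ccont_step.
    eapply (continuous_via ln); [|apply is_derive_ln; simpl; lra].
    repeat ccont_step.
Qed.

Lemma part_ccont2 N : ccont2 (fun t s => (rpow bet t * RtoC ((1 - t) ^ N)) *
    (rpow alpha s * RtoC ((1 - s) ^ N))) 0 eps 0 eps.
Proof.
  intros t s Ht Hs. apply ccont_mult.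
  - apply (ccont_comp (V := R_UniformSpace) fst (fun t => rpow bet t * RtoC ((1 - t) ^ N)));
      [apply continuous_fst | now apply ccont_beta].
  - apply (ccont_comp (V := R_UniformSpace) snd (fun s => rpow alpha s * RtoC ((1 - s) ^ N)));
      [apply continuous_snd | now apply ccont_beta].
Qed.

Lemma part_beta_product N :
  cint (fun t => cint (fun s => (rpow bet t * RtoC ((1 - t) ^ N)) *
    (rpow alpha s * RtoC ((1 - s) ^ N))) 0 eps) 0 eps = part_beta alpha N * part_beta bet N.
Proof.
  rewrite (cint_ext _ (fun t => part_beta alpha N * (rpow bet t * RtoC ((1 - t) ^ N)))); [|lra|].
  - apply cint_scal; [lra|]. intros; now apply ccont_beta.
  - intros t Ht. rewrite cint_scal; [unfold part_beta; ring | lra |]. intros; now apply ccont_beta.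
Qed.

(** In the pointwise bound, the terms with s and with t each gain 1/N by [rbeta_succ]; the term N s
    t gains 1/N twice and loses N once. All three are thus 1/N times the product of the Beta
    integrals. *)
Lemma corner_product (n : nat) :
  (Cmod (corner (S n) - part_beta alpha (S n) * part_beta bet (S n)) <=
   (C1 * (a + b + 2) + (a + 1) * (b + 1)) / INR (S n) * (rbeta a (S n) * rbeta b (S n)))%R.
Proof.
  set (N := S n). rewrite <- part_beta_product. unfold corner.
  set (U := fun x m => RInt (fun s => rp x s * (1 - s) ^ m)%R 0 eps).
  assert (HU : forall x m, (0 < x)%R -> is_RInt (fun s => rp x s * (1 - s) ^ m)%R 0 eps (U x m)).
  { intros; now apply is_RInt_rbeta. }
  assert (HUb : forall x m, (0 < x)%R -> (0 <= U x m <= rbeta x m)%R).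
  { intros x m Hx. apply rbeta_part_le; lra. }
  assert (Ha' : (0 < a)%R) by exact Ha. assert (Hb' : (0 < b)%R) by exact Hb.
  assert (HC1 : (0 <= C1)%R).
  { unfold C1. pose proof (Cmod_ge_0 gam). pose proof (exp_pos (3 * Cmod gam)). nra. }
  assert (HN : (0 < INR N)%R) by (apply lt_0_INR; unfold N; lia).
  apply Rle_trans with
    ((C1 * U (a + 1) N) * U b N + (C1 * U a N) * U (b + 1) N
     + (INR N * U (a + 1) n) * U (b + 1) n)%R.
  - eapply is_cint_norm_le.
    4:{ apply (is_RInt_lin3 (fun t => rp b t * (1 - t) ^ N)%R (fun t => rp (b + 1) t * (1 - t) ^ N)%R
               (fun t => rp (b + 1) t * (1 - t) ^ n)%R); apply HU; lra. }
    3:{ apply is_cint_minus; apply ccont2_cint; try lra; [apply corner_ccont2 | apply part_ccont2]. }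
    + lra.
    + intros t Ht. cbn beta.
      eapply Rle_trans.
      * eapply is_cint_norm_le.
        4:{ apply (is_RInt_lin3 (fun s => rp (a + 1) s * (1 - s) ^ N)%R (fun s => rp a s * (1 - s) ^ N)%R
                 (fun s => rp (a + 1) s * (1 - s) ^ n)%R 0 eps (U (a + 1)%R N) (U a N) (U (a + 1)%R n)
                 (C1 * (rp b t * (1 - t) ^ N)) (C1 * (rp (b + 1) t * (1 - t) ^ N))
                 (INR N * (rp (b + 1) t * (1 - t) ^ n))); apply HU; lra. }
        3:{ apply is_cint_minus; (apply cint_correct; [lra|]); intros s Hs.
            - apply (ccont2_slice _ 0 eps 0 eps _ _ (corner_ccont2 N)); lra.
            - apply (ccont2_slice _ 0 eps 0 eps _ _ (part_ccont2 N)); lra. }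
        -- lra.
        -- intros s Hs. cbn beta.
           pose proof (corner_pointwise gam s t n ltac:(lra) ltac:(lra) ltac:(lra)) as B.
           fold C1 N in B.
           match goal with |- (Cmod ?z <= _)%R =>
             replace z with (rpow bet t * rpow alpha s *
               (Cexp ((gam + RtoC (INR N)) * RtoC (ln (1 - s - t))) - RtoC ((1 - s) ^ N * (1 - t) ^ N)))
               by (rewrite RtoC_mult; ring) end.
           rewrite !Cmod_mult, !Cmod_rpow_rp. fold a b. rewrite !rp_succ.
           eapply Rle_trans; [apply Rmult_le_compat_l; [apply Rmult_le_pos; apply rp_ge_0 | exact B]|].
           right. ring.
      * right. ring.
  - pose proof (HUb a N Ha'). pose proof (HUb b N Hb').
    pose proof (HUb (a + 1)%R N ltac:(lra)) as HA. pose proof (HUb (b + 1)%R N ltac:(lra)) as HB.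
    pose proof (HUb (a + 1)%R n ltac:(lra)) as HA'. pose proof (HUb (b + 1)%R n ltac:(lra)) as HB'.
    assert (Q : forall x, (0 < x)%R -> (rbeta (x + 1) N <= (x + 1) / INR N * rbeta x N)%R).
    { intros x Hx. rewrite rbeta_succ by assumption.
      pose proof (rbeta_S_le x N Hx). pose proof (rbeta_ge_0 x (S N) Hx).
      apply Rmult_le_compat; [|assumption| |assumption].
      - apply Rdiv_le_0_compat; [lra | apply lt_0_INR; lia].
      - apply Rmult_le_compat_l; [lra|]. apply Rinv_le_contravar; [assumption|].
        apply le_INR. lia. }
    pose proof (Q a Ha') as QA. pose proof (Q b Hb') as QB.
    rewrite (rbeta_succ a n Ha') in HA'. rewrite (rbeta_succ b n Hb') in HB'. fold N in HA', HB'.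
    set (X := rbeta a N) in *. set (Y := rbeta b N) in *.
    apply Rle_trans with ((C1 * ((a + 1) / INR N * X)) * Y + (C1 * X) * ((b + 1) / INR N * Y)
       + (INR N * ((a + 1) / INR N * X)) * ((b + 1) / INR N * Y))%R.
    + apply Rplus_le_compat; [apply Rplus_le_compat|].
      * apply Rmult_le_compat; try lra; [apply Rmult_le_pos; lra | apply Rmult_le_compat_l; lra].
      * apply Rmult_le_compat; try lra; [apply Rmult_le_pos; lra | apply Rmult_le_compat_l; lra].
      * apply Rmult_le_compat; try lra; [apply Rmult_le_pos; lra | apply Rmult_le_compat_l; lra].
    + right. field. lra.
Qed.

(** The truncated part lies over [eps, 1], where (1 - s)^N <= (1 - eps)^N. *)
Lemma part_beta_bound x N : (0 < Re x)%R ->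
  (Cmod (part_beta x N - beta x N) <= (1 - eps) ^ N)%R /\ (Cmod (part_beta x N) <= 1)%R
  /\ (Cmod (beta x N) <= 1)%R.
Proof.
  intro Hx.
  assert (I : forall u v, (0 <= u <= v)%R -> (v <= 1)%R ->
    is_cint (fun s => rpow x s * RtoC ((1 - s) ^ N)) u v (cint (fun s => rpow x s * RtoC ((1 - s) ^ N)) u v)).
  { intros u v Hu Hv. apply cint_correct; [lra|]. intros; now apply ccont_beta. }
  assert (B : forall s, I01 s -> (Cmod (rpow x s * RtoC ((1 - s) ^ N)) <= 1 * (1 - s) ^ N)%R).
  { intros s Hs. rewrite Cmod_mult, Cmod_R, (Rabs_pos_eq (_ ^ _)) by (apply pow_le; lra).
    apply Rmult_le_compat_r; [apply pow_le; lra|]. apply Cmod_rpow_le_1; lra. }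
  assert (B1 : forall s, I01 s -> (Cmod (rpow x s * RtoC ((1 - s) ^ N)) <= 1)%R).
  { intros s Hs. eapply Rle_trans; [now apply B|]. rewrite Rmult_1_l.
    apply Rle_trans with (1 ^ N)%R; [apply pow_incr; lra | rewrite pow1; lra]. }
  repeat split.
  - replace (part_beta x N - beta x N) with (- cint (fun s => rpow x s * RtoC ((1 - s) ^ N)) eps 1).
    + rewrite Cmod_opp.
      apply Rle_trans with ((1 - eps) * (1 - eps) ^ N)%R.
      * eapply is_cint_norm_const; [lra | | apply I; lra].
        intros s Hs. eapply Rle_trans; [apply B; lra|]. rewrite Rmult_1_l. apply pow_incr. lra.
      * pose proof (pow_le (1 - eps) N ltac:(lra)). nra.
    + unfold beta. rewrite (is_cint_unique _ 0 1 _ (is_cint_Chasles _ 0 eps 1 _ _ (I 0%R eps ltac:(lra) ltac:(lra)) (I eps 1%R ltac:(lra) ltac:(lra)))).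
      unfold part_beta. ring.
  - apply Rle_trans with ((eps - 0) * 1)%R; [|lra].
    eapply is_cint_norm_const; [lra | | apply I; lra]. intros s Hs. apply B1. lra.
  - apply Rle_trans with ((1 - 0) * 1)%R; [|lra].
    eapply is_cint_norm_const; [lra | | apply I; lra]. intros s Hs. apply B1. lra.
Qed.

End Corner.

(** n^c q^n is the general term of a series that converges by d'Alembert's criterion, consecutive
    quotients tending to q. *)
Lemma exp_ln_pow_lim (c q : R) : (0 < q < 1)%R ->
  is_lim_seq (fun n => exp (c * ln (INR (S n))) * q ^ S n)%R 0.
Proof.
  intro Hq. set (f := fun n => (exp (c * ln (INR (S n))) * q ^ S n)%R).
  assert (P : forall n, (0 < f n)%R).
  { intro n. apply Rmult_lt_0_compat; [apply exp_pos | apply pow_lt; lra]. }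
  assert (S : ex_series (fun n => Rabs (f n))).
  { apply (ex_series_DAlembert f q); [lra | intro n; pose proof (P n); lra |].
    apply (is_lim_seq_ext (fun n => exp (c * (ln (INR (S (S n))) - ln (INR (S n)))) * q)%R).
    - intro n. rewrite Rabs_pos_eq by (apply Rlt_le, Rdiv_lt_0_compat; apply P).
      unfold f. rewrite Rmult_minus_distr_l. unfold Rminus. rewrite exp_plus, exp_Ropp. simpl.
      field. repeat split; try (apply pow_nonzero; lra); try lra.
      apply Rgt_not_eq, exp_pos.
    - replace (Finite q) with (Finite (exp (c * 0) * q)).
      2:{ rewrite Rmult_0_r, exp_0, Rmult_1_l. reflexivity. }
      apply is_lim_seq_mult'; [|apply is_lim_seq_const].
      apply (is_lim_seq_continuous exp).
      { apply derivable_continuous_pt, derivable_pt_exp. }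
      apply (is_lim_seq_scal_l _ c (Finite 0)).
      apply (is_lim_seq_le_le (fun _ => 0%R) _ (fun n => / INR (S n))%R).
      + intro n. rewrite (S_INR (S n)). set (m := INR (S n)).
        assert (Hm : (0 < m)%R) by (apply lt_0_INR; lia). split.
        * assert (ln m < ln (m + 1))%R by (apply ln_increasing; lra). lra.
        * rewrite <- ln_div by lra. eapply Rle_trans; [apply ln_le_sub_1, Rdiv_lt_0_compat; lra|].
          right. field. lra.
      + apply is_lim_seq_const.
      + apply inv_INR_lim. }
  apply ex_series_lim_0 in S. apply is_lim_seq_abs_0. exact S.
Qed.

(** N^(alpha+bet+2) splits as N^(alpha+1) N^(bet+1) and turns the product of the full Beta integrals
    into two Euler quotients. Two errors remain: the one of [corner_product], which is 1/N times a
    convergent sequence, and the truncation to [0, eps], which is a power of N times (1 - eps)^N. *)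
Theorem corner_asymptotic (alpha bet gam : C) (eps : R) :
  (0 < Re alpha)%R -> (0 < Re bet)%R -> (0 < eps < 1 / 3)%R ->
  clim (fun n => Cexp ((alpha + bet + 2) * RtoC (ln (INR (S n)))) * corner alpha bet gam eps (S n))
       (Cgamma (alpha + 1) * Cgamma (bet + 1)).
Proof.
  intros Ha Hb He. set (a := Re alpha). set (b := Re bet).
  set (Bn := fun n => Cexp ((alpha + bet + 2) * RtoC (ln (INR (S n)))) * (beta alpha (S n) * beta bet (S n))).
  assert (EE : forall n, Cexp ((alpha + bet + 2) * RtoC (ln (INR (S n)))) =
    Cexp ((alpha + 1) * RtoC (ln (INR (S n)))) * Cexp ((bet + 1) * RtoC (ln (INR (S n))))).
  { intro n. rewrite <- Cexp_plus. f_equal. ring. }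
  assert (LB : clim Bn (Cgamma (alpha + 1) * Cgamma (bet + 1))).
  { apply (clim_ext (fun n => euler (alpha + 1) (S n) * euler (bet + 1) (S n))).
    - intro n. unfold Bn. rewrite EE, <- !beta_euler by assumption. ring.
    - apply clim_mult; apply -> clim_incr_1; apply Cgamma_spec, not_nonpos_int_Re_pos; rewrite Re_plus_1; lra. }
  set (K := (3 * Cmod gam * exp (3 * Cmod gam) * (a + b + 2) + (a + 1) * (b + 1))%R).
  (* For real x > 0 this is an Euler quotient of Gamma(x + 1), hence convergent; it controls the
     normalised majorants. *)
  set (V := fun x n => (exp ((x + 1) * ln (INR (S n))) * rbeta x (S n))%R).
  assert (LV : forall x, (0 < x)%R -> exists l : R, is_lim_seq (V x) l).
  { intros x Hx. destruct (Cgamma_spec (RtoC x + 1)) as [[L _] _].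
    { apply not_nonpos_int_Re_pos. simpl. lra. }
    exists (Re (Cgamma (RtoC x + 1))).
    apply is_lim_seq_incr_1 in L.
    eapply is_lim_seq_ext; [|exact L]. intro n. cbn beta.
    rewrite <- beta_euler by exact Hx.
    rewrite beta_rbeta, <- RtoC_plus, <- RtoC_mult, Cexp_RtoC, <- RtoC_mult by assumption.
    reflexivity. }
  destruct (LV a Ha) as [la Hla]. destruct (LV b Hb) as [lb Hlb].
  assert (L0 : is_lim_seq (fun n => K * (/ INR (S n) * (V a n * V b n))
                 + 2 * (exp ((a + b + 2) * ln (INR (S n))) * (1 - eps) ^ S n))%R 0).
  { replace (Finite 0) with (Finite (K * (0 * (la * lb)) + 2 * 0)) by (f_equal; ring).
    apply is_lim_seq_plus'.
    - apply (is_lim_seq_scal_l _ K (Finite _)). apply is_lim_seq_mult'; [apply inv_INR_lim|].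
      now apply is_lim_seq_mult'.
    - apply (is_lim_seq_scal_l _ 2 (Finite _)). apply exp_ln_pow_lim. lra. }
  replace (Cgamma (alpha + 1) * Cgamma (bet + 1)) with (0 + Cgamma (alpha + 1) * Cgamma (bet + 1)) by ring.
  apply (clim_ext (fun n => (Cexp ((alpha + bet + 2) * RtoC (ln (INR (S n)))) * corner alpha bet gam eps (S n)
                             - Bn n) + Bn n)); [intro; ring|].
  apply clim_plus; [|exact LB].
  eapply clim_le; [|exact L0]. intro n. cbn beta.
  set (e := exp ((a + b + 2) * ln (INR (S n)))).
  assert (Ee : Cmod (Cexp ((alpha + bet + 2) * RtoC (ln (INR (S n))))) = e).
  { rewrite Cmod_Cexp. unfold e, a, b. f_equal. unfold Re; simpl. ring. }
  assert (He0 : (0 < e)%R) by apply exp_pos.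
  set (X := part_beta eps alpha (S n)). set (Y := part_beta eps bet (S n)).
  replace (Cexp ((alpha + bet + 2) * RtoC (ln (INR (S n)))) * corner alpha bet gam eps (S n) - Bn n - 0)
    with (Cexp ((alpha + bet + 2) * RtoC (ln (INR (S n)))) *
      ((corner alpha bet gam eps (S n) - X * Y) + ((X - beta alpha (S n)) * Y
        + beta alpha (S n) * (Y - beta bet (S n))))) by (unfold Bn; ring).
  rewrite Cmod_mult, Ee.
  destruct (part_beta_bound eps He alpha (S n) Ha) as [A1 [A2 A3]].
  destruct (part_beta_bound eps He bet (S n) Hb) as [B1 [B2 B3]].
  fold X in A1, A2. fold Y in B1, B2.
  pose proof (corner_product alpha bet gam eps Ha Hb He n) as HP. fold X Y a b in HP. fold K in HP.
  assert (HV : (V a n * V b n = e * (rbeta a (S n) * rbeta b (S n)))%R).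
  { unfold V, e. replace ((a + b + 2) * ln (INR (S n)))%R
      with ((a + 1) * ln (INR (S n)) + (b + 1) * ln (INR (S n)))%R by ring.
    rewrite exp_plus. ring. }
  rewrite HV.
  apply Rle_trans with (e * (K / INR (S n) * (rbeta a (S n) * rbeta b (S n)) + 2 * (1 - eps) ^ S n))%R.
  - apply Rmult_le_compat_l; [lra|].
    eapply Rle_trans; [apply Cmod_triangle|]. apply Rplus_le_compat; [exact HP|].
    eapply Rle_trans; [apply Cmod_triangle|]. rewrite !Cmod_mult.
    pose proof (Cmod_ge_0 (X - beta alpha (S n))). pose proof (Cmod_ge_0 (Y - beta bet (S n))).
    pose proof (Cmod_ge_0 Y). pose proof (Cmod_ge_0 (beta alpha (S n))). nra.
  - right. unfold Rdiv. ring.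
Qed.

(** * Integration over cells *)

(** Uniform continuity yields n such that each of n equal steps on the segment from (0, 0) to (u, v)
    changes the function by less than 1. Hence n bounds the total change. *)
Lemma ccont2_bounded (f : R -> R -> C) : ccont2 f 0 1 0 1 ->
  exists K, forall u v, I01 u -> I01 v -> (Cmod (f u v) <= K)%R.
Proof.
  intro H.
  assert (B : forall g : R -> R -> R,
    (forall u v, I01 u -> I01 v -> continuity_2d_pt g u v) ->
    exists K, forall u v, I01 u -> I01 v -> (Rabs (g u v) <= K)%R).
  { intros g Hg.
    destruct (uniform_continuity_2d g 0 1 0 1 Hg (mkposreal 1 Rlt_0_1)) as [[d Hd] Hu]; simpl in Hu.
    destruct (nfloor_ex (/ d)) as [m Hm]; [left; now apply Rinv_0_lt_compat|].
    set (n := S m). assert (Hn : (/ INR n < d)%R).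
    { rewrite <- (Rinv_inv d). apply Rinv_lt_contravar; unfold n; rewrite S_INR; [|lra].
      apply Rmult_lt_0_compat; [now apply Rinv_0_lt_compat | pose proof (pos_INR m); lra]. }
    assert (Hn0 : (0 < INR n)%R) by (apply lt_0_INR; unfold n; lia).
    exists (Rabs (g 0 0) + INR n)%R. intros u v Hu' Hv'.
    assert (S : forall k, (k <= n)%nat ->
      (Rabs (g (INR k / INR n * u) (INR k / INR n * v) - g 0 0) <= INR k)%R).
    { induction k as [|k IH]; intro Hk.
      - change (INR 0) with 0%R. unfold Rdiv. rewrite !Rmult_0_l, Rminus_diag, Rabs_R0. lra.
      - specialize (IH ltac:(lia)).
        assert (Q : forall j, (j <= n)%nat -> (0 <= INR j / INR n <= 1)%R).
        { intros j Hj. split; [apply Rdiv_le_0_compat; [apply pos_INR | assumption]|].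
          apply (Rmult_le_reg_r (INR n)); [assumption|]. unfold Rdiv.
          rewrite Rmult_assoc, Rinv_l, Rmult_1_l, Rmult_1_r by lra. now apply le_INR. }
        pose proof (Q k ltac:(lia)). pose proof (Q (Datatypes.S k) Hk).
        assert (E : (INR (Datatypes.S k) / INR n - INR k / INR n = / INR n)%R)
          by (rewrite S_INR; field; lra).
        assert (D : forall x, I01 x ->
          (Rabs (INR (Datatypes.S k) / INR n * x - INR k / INR n * x) < d)%R).
        { intros x Hx. rewrite <- Rmult_minus_distr_r, E, Rabs_pos_eq.
          - assert (0 < / INR n)%R by now apply Rinv_0_lt_compat. nra.
          - apply Rmult_le_pos; [left; now apply Rinv_0_lt_compat | lra]. }
        assert (G := Hu (INR k / INR n * u)%R (INR k / INR n * v)%R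
          (INR (Datatypes.S k) / INR n * u)%R (INR (Datatypes.S k) / INR n * v)%R
          ltac:(nra) ltac:(nra) ltac:(nra) ltac:(nra) (D u Hu') (D v Hv')).
        rewrite (S_INR k) at 3. clear -IH G.
        apply Rabs_def2 in G. apply Rabs_le_between in IH. apply Rabs_le_between. lra. }
    specialize (S n (Nat.le_refl n)).
    replace (INR n / INR n)%R with 1%R in S by (field; lra). rewrite !Rmult_1_l in S.
    pose proof (Rabs_triang_inv (g u v) (g 0 0)). lra. }
  destruct (B (fun u v => Re (f u v))) as [K1 H1].
  { intros u v Hu Hv. apply continuity_2d_pt_filterlim, (H u v Hu Hv). }
  destruct (B (fun u v => Im (f u v))) as [K2 H2].
  { intros u v Hu Hv. apply continuity_2d_pt_filterlim, (H u v Hu Hv). }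
  exists (K1 + K2)%R. intros u v Hu Hv. eapply Rle_trans; [apply Cmod_le_Re_Im|].
  apply Rplus_le_compat; auto.
Qed.

Definition wt (p : line -> C) (P : loaded_point) : C :=
  Cexp (p L1 * branch P L1 + p L2 * branch P L2 + p L3 * branch P L3).

Definition cell_int (p : line -> C) (c : cell) : C :=
  cint (fun u => cint (fun v => wt p (c u v) * jacobian c u v) 0 1) 0 1.

(* The vector with dl_i = x and dl_(next i) = y, as the function j |-> dl_j. *)
Definition vec (i : line) (x y : C) (j : line) : C :=
  if line_eqb j i then x else if line_eqb j (next i) then y else - x - y.

Definition lower (p : line -> C) (i : line) (j : line) : C :=
  if line_eqb j i then p j - 1 else p j.

Definition ccont_all (f : R -> R -> C) : Prop :=
  forall u v, ccont (fun q : R * R => f (fst q) (snd q)) (u, v).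

Set Implicit Arguments.
(* The last clause lists the three ways in which the logarithm of a form is
   continued along a cell of the regularization. *)
Record param_cell (c : cell) (i : line) (z w zu wu wv wuv : R -> R -> C) : Prop := {
  pc_form : forall u v j, form (c u v) j = point_at i (z u v) (w u v) j;
  pc_zu : forall u v, cder (fun x => z x v) u (zu u v);
  pc_zv : forall u v, cder (fun y => z u y) v 0;
  pc_wu : forall u v, cder (fun x => w x v) u (wu u v);
  pc_wv : forall u v, cder (fun y => w u y) v (wv u v);
  pc_zuv : forall u v, cder (fun y => zu u y) v 0;
  pc_wuv : forall u v, cder (fun y => wu u y) v (wuv u v);
  pc_wvu : forall u v, cder (fun x => wv x v) u (wuv u v);
  pc_cont_z : ccont_all z;
  pc_cont_w : ccont_all w;
  pc_cont_zu : ccont_all zu;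
  pc_cont_wu : ccont_all wu;
  pc_cont_wv : ccont_all wv;
  pc_cont_wuv : ccont_all wuv;
  pc_branch : forall j,
    ((forall u v, branch (c u v) j = Clog (form (c u v) j)) /\
     (forall u v, I01 u -> I01 v -> (0 < Re (form (c u v) j))%R))
    \/ (exists e, (0 < e)%R /\ forall u v, branch (c u v) j = circle_log e u /\ form (c u v) j = circle e u)
    \/ (exists e, (0 < e)%R /\ forall u v, branch (c u v) j = circle_log e v /\ form (c u v) j = circle e v)
}.

Unset Implicit Arguments.

Lemma cder_vec (i j : line) (f g : R -> C) x l m : cder f x l -> cder g x m ->
  cder (fun t => vec i (f t) (g t) j) x (vec i l m j).
Proof.
  intros Hf Hg. unfold vec. destruct (line_eqb j i); [assumption|].
  destruct (line_eqb j (next i)); [assumption|]. apply cder_minus; [now apply cder_opp | assumption].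
Qed.

Lemma cder_point_at (i j : line) (f g : R -> C) x l m : cder f x l -> cder g x m ->
  cder (fun t => point_at i (f t) (g t) j) x (vec i l m j).
Proof.
  intros Hf Hg. unfold vec, point_at. destruct (line_eqb j i); [assumption|].
  destruct (line_eqb j (next i)); [assumption|]. apply cder_minus; [|assumption].
  eapply cder_eq; [apply (cder_minus (fun _ => RtoC 1)); [apply cder_const | exact Hf]|]. ring.
Qed.

Lemma ccont_vec {U : UniformSpace} (i j : line) (f g : U -> C) x : ccont f x -> ccont g x ->
  ccont (fun t => vec i (f t) (g t) j) x.
Proof.
  intros Hf Hg. unfold vec. destruct (line_eqb j i); [assumption|].
  destruct (line_eqb j (next i)); [assumption|]. apply ccont_minus; [now apply ccont_opp | assumption].
Qed.

Lemma ccont_point_at {U : UniformSpace} (i j : line) (f g : U -> C) x : ccont f x -> ccont g x ->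
  ccont (fun t => point_at i (f t) (g t) j) x.
Proof.
  intros Hf Hg. unfold point_at. destruct (line_eqb j i); [assumption|].
  destruct (line_eqb j (next i)); [assumption|].
  apply ccont_minus; [apply ccont_minus; [apply ccont_const | assumption] | assumption].
Qed.

Lemma ccont_ext {U : UniformSpace} (f g : U -> C) p : (forall q, f q = g q) -> ccont f p -> ccont g p.
Proof.
  intros E [A B]; split; [eapply continuous_ext; [|exact A] | eapply continuous_ext; [|exact B]];
    intro q; cbv beta; f_equal; apply E.
Qed.

Lemma cder_unique f x l m : cder f x l -> cder f x m -> l = m.
Proof. intros A B. now rewrite <- (CDerive_cder _ _ _ A), <- (CDerive_cder _ _ _ B). Qed.

Section ParamCell.
Context {c : cell} {i : line} {z w zu wu wv wuv : R -> R -> C}.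
Hypothesis (H : param_cell c i z w zu wu wv wuv).

Lemma pc_form_u u v j : cder (fun x => form (c x v) j) u (vec i (zu u v) (wu u v) j).
Proof.
  apply (cder_ext (fun x => point_at i (z x v) (w x v) j)).
  { intro y. symmetry. apply (pc_form H). }
  apply cder_point_at; [apply (pc_zu H) | apply (pc_wu H)].
Qed.

Lemma pc_form_v u v j : cder (fun y => form (c u y) j) v (vec i 0 (wv u v) j).
Proof.
  apply (cder_ext (fun y => point_at i (z u y) (w u y) j)).
  { intro y. symmetry. apply (pc_form H). }
  apply cder_point_at; [apply (pc_zv H) | apply (pc_wv H)].
Qed.

(** dl_i /\ dl_(next i) = ds /\ dt for every i, and l_i = z does not depend on v, so the determinant
    reduces to a single product. *)
Lemma pc_jacobian u v : jacobian c u v = zu u v * wv u v.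
Proof.
  unfold jacobian.
  rewrite (CDerive_cder _ _ _ (pc_form_u u v L1)), (CDerive_cder _ _ _ (pc_form_u u v L2)).
  rewrite (CDerive_cder _ _ _ (pc_form_v u v L1)), (CDerive_cder _ _ _ (pc_form_v u v L2)).
  destruct i; unfold vec; simpl; ring.
Qed.

Lemma pc_cont_form j : ccont_all (fun u v => form (c u v) j).
Proof.
  intros u v. apply (ccont_ext (fun q : R * R => point_at i (z (fst q) (snd q)) (w (fst q) (snd q)) j)).
  { intro q. symmetry. apply (pc_form H). }
  apply ccont_point_at; [apply (pc_cont_z H) | apply (pc_cont_w H)].
Qed.

Lemma pc_exp u v j : I01 u -> I01 v -> Cexp (branch (c u v) j) = form (c u v) j.
Proof.
  intros Hu Hv. destruct (pc_branch H j) as [[A B]|[[e [He A]]|[e [He A]]]].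
  - rewrite A. apply Cexp_Clog. now apply B.
  - destruct (A u v) as [-> ->]. symmetry. now apply circle_Cexp.
  - destruct (A u v) as [-> ->]. symmetry. now apply circle_Cexp.
Qed.

Lemma pc_form_neq_0 u v j : I01 u -> I01 v -> form (c u v) j <> 0.
Proof. intros Hu Hv. rewrite <- pc_exp by assumption. apply Cexp_neq_0. Qed.

Lemma circle_neq_0 e u : (0 < e)%R -> circle e u <> 0.
Proof. intros He. rewrite circle_Cexp by assumption. apply Cexp_neq_0. Qed.

(** The relation d(log l) = dl / l holds for each way of continuing the logarithm. In the circle
    cases the velocity of the form is identified by uniqueness of the derivative. *)
Lemma pc_branch_u u v j : I01 u -> I01 v ->
  cder (fun x => branch (c x v) j) u (vec i (zu u v) (wu u v) j / form (c u v) j).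
Proof.
  intros Hu Hv. pose proof (pc_form_u u v j) as D.
  destruct (pc_branch H j) as [[A B]|[[e [He A]]|[e [He A]]]].
  - apply (cder_ext (fun x => Clog (form (c x v) j))); [intro; symmetry; apply A|].
    apply (cder_Clog (fun x => form (c x v) j)); [exact D | now apply B].
  - apply (cder_ext (circle_log e)); [intro x; symmetry; apply (A x v)|].
    assert (E : vec i (zu u v) (wu u v) j = 2 * PI * Ci * circle e u).
    { apply (cder_unique _ _ _ _ D).
      apply (cder_ext (circle e)); [intro x; symmetry; apply (A x v) | apply cder_circle_u]. }
    destruct (A u v) as [_ ->]. rewrite E.
    eapply cder_eq; [apply cder_circle_log_u|]. field. now apply circle_neq_0.
  - apply (cder_ext (fun _ => circle_log e v)); [intro x; symmetry; apply (A x v)|].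
    assert (E : vec i (zu u v) (wu u v) j = 0).
    { apply (cder_unique _ _ _ _ D).
      apply (cder_ext (fun _ => circle e v)); [intro x; symmetry; apply (A x v) | apply cder_const]. }
    rewrite E. eapply cder_eq; [apply cder_const|]. field. now apply pc_form_neq_0.
Qed.

Lemma pc_branch_v u v j : I01 u -> I01 v ->
  cder (fun y => branch (c u y) j) v (vec i 0 (wv u v) j / form (c u v) j).
Proof.
  intros Hu Hv. pose proof (pc_form_v u v j) as D.
  destruct (pc_branch H j) as [[A B]|[[e [He A]]|[e [He A]]]].
  - apply (cder_ext (fun y => Clog (form (c u y) j))); [intro; symmetry; apply A|].
    apply (cder_Clog (fun y => form (c u y) j)); [exact D | now apply B].
  - apply (cder_ext (fun _ => circle_log e u)); [intro y; symmetry; apply (A u y)|].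
    assert (E : vec i 0 (wv u v) j = 0).
    { apply (cder_unique _ _ _ _ D).
      apply (cder_ext (fun _ => circle e u)); [intro y; symmetry; apply (A u y) | apply cder_const]. }
    rewrite E. eapply cder_eq; [apply cder_const|]. field. now apply pc_form_neq_0.
  - apply (cder_ext (circle_log e)); [intro y; symmetry; apply (A u y)|].
    assert (E : vec i 0 (wv u v) j = 2 * PI * Ci * circle e v).
    { apply (cder_unique _ _ _ _ D).
      apply (cder_ext (circle e)); [intro y; symmetry; apply (A u y) | apply cder_circle_u]. }
    destruct (A u v) as [_ ->]. rewrite E.
    eapply cder_eq; [apply cder_circle_log_u|]. field. now apply circle_neq_0.
Qed.

Lemma pc_cont_branch j : ccont2 (fun u v => branch (c u v) j) 0 1 0 1.
Proof.
  intros u v Hu Hv.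
  destruct (pc_branch H j) as [[A B]|[[e [He A]]|[e [He A]]]].
  - apply (ccont_ext (fun q : R * R => Clog (form (c (fst q) (snd q)) j))); [intro; symmetry; apply A|].
    apply (ccont_Clog (fun q : R * R => form (c (fst q) (snd q)) j)); [apply pc_cont_form | now apply B].
  - apply (ccont_ext (fun q : R * R => circle_log e (fst q))); [intro q; symmetry; apply (A (fst q) (snd q))|].
    apply (ccont_circle_log (fun _ => e)); [assumption | apply continuous_const | apply continuous_fst].
  - apply (ccont_ext (fun q : R * R => circle_log e (snd q))); [intro q; symmetry; apply (A (fst q) (snd q))|].
    apply (ccont_circle_log (fun _ => e)); [assumption | apply continuous_const | apply continuous_snd].
Qed.

Lemma pc_cont_wt p : ccont2 (fun u v => wt p (c u v)) 0 1 0 1.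
Proof.
  intros u v Hu Hv. unfold wt. repeat ccont_step; now apply pc_cont_branch.
Qed.

Lemma pc_cont_integrand p : ccont2 (fun u v => wt p (c u v) * jacobian c u v) 0 1 0 1.
Proof.
  intros u v Hu Hv.
  apply (ccont_ext (fun q : R * R => wt p (c (fst q) (snd q)) * (zu (fst q) (snd q) * wv (fst q) (snd q)))).
  { intro q. now rewrite pc_jacobian. }
  apply ccont_mult; [now apply pc_cont_wt|]. apply ccont_mult; [apply (pc_cont_zu H) | apply (pc_cont_wv H)].
Qed.

Lemma pc_wt_lower p j u v : I01 u -> I01 v ->
  wt (lower p j) (c u v) = wt p (c u v) / form (c u v) j.
Proof.
  intros Hu Hv. rewrite <- (pc_exp u v j) by assumption. unfold wt. rewrite <- Cexp_minus.
  f_equal. destruct j; unfold lower; simpl; ring.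
Qed.

Lemma pc_wt_u p u v : I01 u -> I01 v ->
  let d j := p j * (vec i (zu u v) (wu u v) j / form (c u v) j) in
  cder (fun x => wt p (c x v)) u ((d L1 + d L2 + d L3) * wt p (c u v)).
Proof.
  intros Hu Hv d. unfold wt.
  apply (cder_Cexp (fun x => p L1 * branch (c x v) L1 + p L2 * branch (c x v) L2 + p L3 * branch (c x v) L3)).
  repeat apply cder_plus; apply cder_scal; now apply pc_branch_u.
Qed.

Lemma pc_wt_v p u v : I01 u -> I01 v ->
  let d j := p j * (vec i 0 (wv u v) j / form (c u v) j) in
  cder (fun y => wt p (c u y)) v ((d L1 + d L2 + d L3) * wt p (c u v)).
Proof.
  intros Hu Hv d. unfold wt.
  apply (cder_Cexp (fun y => p L1 * branch (c u y) L1 + p L2 * branch (c u y) L2 + p L3 * branch (c u y) L3)).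
  repeat apply cder_plus; apply cder_scal; now apply pc_branch_v.
Qed.

(** The integral of the 1-form [wt p * dl_k] along the side of the parameter square on which u runs
    and v is fixed; [edge_v] is its analogue with v running. *)
Definition edge_u (p : line -> C) (k : line) (v : R) : C :=
  cint (fun u => wt p (c u v) * vec i (zu u v) (wu u v) k) 0 1.
Definition edge_v (p : line -> C) (k : line) (u : R) : C :=
  cint (fun v => wt p (c u v) * vec i 0 (wv u v) k) 0 1.

(* Stokes' formula for the 1-form [wt p * dl_k]. *)
Lemma cell_stokes p k :
  p (next (next k)) * cell_int (lower p (next (next k))) c - p (next k) * cell_int (lower p (next k)) c
  = edge_v p k 1 - edge_v p k 0 - (edge_u p k 1 - edge_u p k 0).
Proof.
  set (d := fun (U : line -> C) u v j => p j * (U j / form (c u v) j)).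
  set (U := fun u v => vec i (zu u v) (wu u v)). set (V := fun u v => vec i 0 (wv u v)).
  set (M := fun u v => vec i 0 (wuv u v)).
  (* Both [Du] and [Dv] contain the mixed second derivative in the form wt * M, and it cancels in
     their difference. *)
  set (Du := fun u v => (d (U u v) u v L1 + d (U u v) u v L2 + d (U u v) u v L3) * wt p (c u v) * V u v k
                        + wt p (c u v) * M u v k).
  set (Dv := fun u v => (d (V u v) u v L1 + d (V u v) u v L2 + d (V u v) u v L3) * wt p (c u v) * U u v k
                        + wt p (c u v) * M u v k).
  assert (HDu : forall u v, I01 u -> I01 v ->
    cder (fun x => wt p (c x v) * V x v k) u (Du u v)).
  { intros u v Hu Hv. apply cder_mult; [now apply pc_wt_u|].
    apply (cder_vec i k (fun _ => 0)); [apply cder_const | apply (pc_wvu H)]. }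
  assert (HDv : forall u v, I01 u -> I01 v ->
    cder (fun y => wt p (c u y) * U u y k) v (Dv u v)).
  { intros u v Hu Hv. apply cder_mult; [now apply pc_wt_v|].
    apply cder_vec; [apply (pc_zuv H) | apply (pc_wuv H)]. }
  assert (Cinvf : forall j, ccont2 (fun u v => wt p (c u v) / form (c u v) j) 0 1 0 1).
  { intros j u v Hu Hv.
    apply (ccont_ext (fun q : R * R => wt p (c (fst q) (snd q)) * / form (c (fst q) (snd q)) j)); [reflexivity|].
    apply ccont_mult; [now apply pc_cont_wt|].
    pose proof (pc_cont_form j u v) as [A B].
    pose proof (pc_form_neq_0 u v j Hu Hv) as N0.
    assert (N : ((Re (form (c u v) j) * Re (form (c u v) j) + Im (form (c u v) j) * Im (form (c u v) j)) <> 0)%R).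
    { intro E. apply N0. apply C_eq; simpl; nra. }
    assert (Di : continuous (fun q : R * R => / (Re (form (c (fst q) (snd q)) j) * Re (form (c (fst q) (snd q)) j)
        + Im (form (c (fst q) (snd q)) j) * Im (form (c (fst q) (snd q)) j)))%R (u, v)).
    { eapply (continuous_via Rinv).
      - apply continuous_Rplus; now apply continuous_Rmult.
      - apply (is_derive_inv (fun x => x) _ 1); [apply (is_derive_id (K := R_AbsRing)) | exact N]. }
    split.
    - eapply continuous_ext; [|apply continuous_Rmult; [exact A | exact Di]].
      intro q. simpl. unfold Rdiv. now rewrite !Rmult_1_r.
    - eapply continuous_ext; [|apply continuous_Rmult; [apply continuous_Ropp, B | exact Di]].
      intro q. simpl. unfold Rdiv. now rewrite !Rmult_1_r. }
  assert (CU : forall j, ccont_all (fun u v => U u v j)).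
  { intros j u v. apply ccont_vec; [apply (pc_cont_zu H) | apply (pc_cont_wu H)]. }
  assert (CV : forall j, ccont_all (fun u v => V u v j)).
  { intros j u v. apply ccont_vec; [apply ccont_const | apply (pc_cont_wv H)]. }
  assert (CM : forall j, ccont_all (fun u v => M u v j)).
  { intros j u v. apply ccont_vec; [apply ccont_const | apply (pc_cont_wuv H)]. }
  assert (CDu : ccont2 Du 0 1 0 1).
  { intros u v Hu Hv.
    apply (ccont_ext (fun q : R * R =>
      (p L1 * U (fst q) (snd q) L1 * (wt p (c (fst q) (snd q)) / form (c (fst q) (snd q)) L1)
       + p L2 * U (fst q) (snd q) L2 * (wt p (c (fst q) (snd q)) / form (c (fst q) (snd q)) L2)
       + p L3 * U (fst q) (snd q) L3 * (wt p (c (fst q) (snd q)) / form (c (fst q) (snd q)) L3))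
      * V (fst q) (snd q) k + wt p (c (fst q) (snd q)) * M (fst q) (snd q) k)).
    { intro q. unfold Du, d, Cdiv. ring. }
    repeat ccont_step;
      match goal with
      | |- ccont (fun _ => wt _ _) _ => now apply pc_cont_wt
      | |- ccont (fun q => Cdiv _ (form _ ?j)) _ => now apply (Cinvf j)
      | |- ccont (fun _ => U _ _ ?j) _ => apply (CU j)
      | |- ccont (fun _ => V _ _ ?j) _ => apply (CV j)
      | |- ccont (fun _ => M _ _ ?j) _ => apply (CM j)
      end. }
  assert (CDv : ccont2 Dv 0 1 0 1).
  { intros u v Hu Hv.
    apply (ccont_ext (fun q : R * R =>
      (p L1 * V (fst q) (snd q) L1 * (wt p (c (fst q) (snd q)) / form (c (fst q) (snd q)) L1)
       + p L2 * V (fst q) (snd q) L2 * (wt p (c (fst q) (snd q)) / form (c (fst q) (snd q)) L2)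
       + p L3 * V (fst q) (snd q) L3 * (wt p (c (fst q) (snd q)) / form (c (fst q) (snd q)) L3))
      * U (fst q) (snd q) k + wt p (c (fst q) (snd q)) * M (fst q) (snd q) k)).
    { intro q. unfold Dv, d, Cdiv. ring. }
    repeat ccont_step;
      match goal with
      | |- ccont (fun _ => wt _ _) _ => now apply pc_cont_wt
      | |- ccont (fun q => Cdiv _ (form _ ?j)) _ => now apply (Cinvf j)
      | |- ccont (fun _ => U _ _ ?j) _ => apply (CU j)
      | |- ccont (fun _ => V _ _ ?j) _ => apply (CV j)
      | |- ccont (fun _ => M _ _ ?j) _ => apply (CM j)
      end. }
  assert (Eu : cint (fun u => cint (Du u) 0 1) 0 1 = edge_v p k 1 - edge_v p k 0).
  { rewrite (cint_swap Du 0 1 0 1) by (lra || assumption).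
    unfold edge_v. fold (V 1%R) (V 0%R).
    assert (CE : forall u, I01 u -> forall v, I01 v ->
      ccont (fun v => wt p (c u v) * vec i 0 (wv u v) k) v).
    { intros u Hu v Hv. apply (ccont2_slice (fun u v => wt p (c u v) * V u v k) 0 1 0 1); try assumption.
      intros u' v' Hu' Hv'. apply ccont_mult; [now apply pc_cont_wt | apply CV]. }
    rewrite <- cint_minus by (try lra; apply CE; lra).
    apply cint_ext; [lra|]. intros v Hv. apply is_cint_unique.
    apply (is_cint_derive (fun x => wt p (c x v) * V x v k)); [lra | |].
    - intros u Hu. apply HDu; lra.
    - intros u Hu. apply (ccont2_slice (fun v u => Du u v) 0 1 0 1); [now apply ccont2_swap | lra | lra]. }
  assert (Ev : cint (fun u => cint (Dv u) 0 1) 0 1 = edge_u p k 1 - edge_u p k 0).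
  { unfold edge_u.
    assert (CE : forall v, I01 v -> forall u, I01 u ->
      ccont (fun u => wt p (c u v) * vec i (zu u v) (wu u v) k) u).
    { intros v Hv u Hu. apply (ccont2_slice (fun v u => wt p (c u v) * U u v k) 0 1 0 1); try assumption.
      apply (ccont2_swap (fun u v => wt p (c u v) * U u v k)).
      intros u' v' Hu' Hv'. apply ccont_mult; [now apply pc_cont_wt | apply CU]. }
    rewrite <- cint_minus by (try lra; apply CE; lra).
    apply cint_ext; [lra|]. intros u Hu. apply is_cint_unique.
    apply (is_cint_derive (fun y => wt p (c u y) * U u y k)); [lra | |].
    - intros v Hv. apply HDv; lra.
    - intros v Hv. apply (ccont2_slice Dv 0 1 0 1); [assumption | lra | lra]. }
  rewrite <- Eu, <- Ev.
  assert (I : forall f, ccont2 f 0 1 0 1 -> forall u, I01 u -> is_cint (f u) 0 1 (cint (f u) 0 1)).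
  { intros f Hf u Hu. apply cint_correct; [lra|]. intros v Hv. now apply (ccont2_slice f 0 1 0 1). }
  rewrite <- (is_cint_unique _ _ _ _ (is_cint_minus _ _ _ _ _ _ (ccont2_cint Du 0 1 0 1 ltac:(lra) ltac:(lra) CDu)
                                 (ccont2_cint Dv 0 1 0 1 ltac:(lra) ltac:(lra) CDv))).
  unfold cell_int. symmetry.
  rewrite <- (is_cint_unique _ _ _ _ (is_cint_minus _ _ _ _ _ _
    (is_cint_scal (p (next (next k))) _ _ _ _ (ccont2_cint _ 0 1 0 1 ltac:(lra) ltac:(lra) (pc_cont_integrand (lower p (next (next k))))))
    (is_cint_scal (p (next k)) _ _ _ _ (ccont2_cint _ 0 1 0 1 ltac:(lra) ltac:(lra) (pc_cont_integrand (lower p (next k))))))).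
  apply cint_ext; [lra|]. intros u Hu.
  rewrite <- (is_cint_unique _ _ _ _ (is_cint_minus _ _ _ _ _ _ (I Du CDu u ltac:(lra)) (I Dv CDv u ltac:(lra)))).
  rewrite <- (is_cint_unique _ _ _ _ (is_cint_minus _ _ _ _ _ _
    (is_cint_scal (p (next (next k))) _ _ _ _ (I _ (pc_cont_integrand (lower p (next (next k)))) u ltac:(lra)))
    (is_cint_scal (p (next k)) _ _ _ _ (I _ (pc_cont_integrand (lower p (next k))) u ltac:(lra))))).
  apply cint_ext; [lra|]. intros v Hv.
  rewrite !pc_wt_lower, pc_jacobian by lra.
  unfold Du, Dv, d, U, V, M, Cdiv.
  (* Pointwise, d(wt dl_k) is the sum over j of p_j (wt / l_j) dl_j /\ dl_k. The term j = k
     vanishes, j = next (next k) gives ds /\ dt, and j = next k gives its opposite. *)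
  clear.
  destruct k; simpl next;
  generalize (wt p (c u v)) (/ form (c u v) L1) (/ form (c u v) L2) (/ form (c u v) L3)
    (zu u v) (wu u v) (wv u v) (wuv u v);
  intros; destruct i; unfold vec; simpl; ring.
Qed.

End ParamCell.

#[global] Arguments edge_u : clear implicits.
#[global] Arguments edge_v : clear implicits.

Ltac cder_step :=
  match goal with
  | |- cder (fun _ => ?c) _ _ => apply cder_const
  | |- cder (fun x => RtoC x) _ _ => apply cder_id
  | |- cder RtoC _ _ => apply cder_id
  | |- cder (fun x => circle _ x) _ _ => apply cder_circle_u
  | |- cder (circle _) _ _ => apply cder_circle_u
  | |- cder (fun _ => Cplus _ _) _ _ => apply cder_plus
  | |- cder (fun _ => Cminus _ _) _ _ => apply cder_minus
  | |- cder (fun _ => Copp _) _ _ => apply cder_opp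
  | |- cder (fun _ => Cmult _ _) _ _ => apply cder_mult
  end.

Ltac cder_auto := intros; eapply cder_eq; [repeat cder_step | cbn beta; ring].

Ltac ccont_auto :=
  intros ? ?;
  repeat first [match goal with |- ccont (fun _ => circle _ _) _ => apply ccont_circle end | ccont_step].

Ltac param_auto :=
  split;
  lazymatch goal with
  | |- forall u v, cder _ _ _ => cder_auto
  | |- ccont_all _ => ccont_auto
  | _ => idtac
  end.

(** * The cells of the regularization and the matching of their edges *)

Section Cells.
Context (eps : R).
Hypothesis (He : (0 < eps < 1 / 3)%R).

Let kappa : C := 1 - 3 * eps.

Lemma sigma_Re u v j : I01 u -> I01 v ->
  (eps <= Re (form (sigma_cell eps u v) j))%R.
Proof.
  intros Hu Hv. assert (0 <= (1 - u) * v <= 1 - u)%R by nra.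
  destruct j; unfold Re; simpl; nra.
Qed.

Lemma sigma_L3 u v : I01 u -> I01 v ->
  (Cmod (form (sigma_cell eps u v) L3) <= 1 - eps)%R.
Proof.
  intros Hu Hv. assert (0 <= (1 - u) * v <= 1 - u)%R by nra.
  replace (form (sigma_cell eps u v) L3)
    with (RtoC (1 - (eps + (1 - 3 * eps) * u) - (eps + (1 - 3 * eps) * (1 - u) * v))).
  2:{ simpl. unfold point_at; simpl. apply C_eq; unfold Re, Im; simpl; ring. }
  rewrite Cmod_R, Rabs_pos_eq; nra.
Qed.

Lemma sigma_param : param_cell (sigma_cell eps) L1
  (fun u v => eps + kappa * u) (fun u v => eps + kappa * (1 - u) * v)
  (fun u v => kappa) (fun u v => - kappa * v) (fun u v => kappa * (1 - u)) (fun u v => - kappa).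
Proof.
  param_auto.
  - reflexivity.
  - intro j. left. split; [reflexivity|]. intros u v Hu Hv.
    pose proof (sigma_Re u v j Hu Hv). lra.
Qed.

Definition tube_w (u v : R) : C := (1 - v) * eps + v * (1 - circle eps u - eps).

(** Both real parts are convex combinations of eps and 1 - Re z - eps, with z on the circle. The
    latter is at least 1 - 2 eps, which exceeds eps because eps < 1/3. *)
Lemma Re_tube_w u v : I01 v -> (eps <= Re (tube_w u v) )%R /\
  (eps <= Re (1 - circle eps u - tube_w u v))%R.
Proof.
  intro Hv. pose proof (Re_circle_le eps u ltac:(lra)) as Hc.
  assert (A : Re (tube_w u v) = ((1 - v) * eps + v * (1 - Re (circle eps u) - eps))%R)
    by (unfold tube_w, Re; simpl; ring).
  assert (B : Re (1 - circle eps u - tube_w u v)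
              = (v * eps + (1 - v) * (1 - Re (circle eps u) - eps))%R)
    by (unfold tube_w, Re; simpl; ring).
  rewrite A, B. split; nra.
Qed.

Lemma line_eqb_refl i : line_eqb i i = true.
Proof. now destruct i. Qed.

Lemma tube_Re i u v j : I01 v -> line_eqb j i = false ->
  (eps <= Re (form (tube_cell eps i u v) j))%R.
Proof.
  intros Hv Hj. destruct (Re_tube_w u v Hv) as [A B]. simpl. unfold point_at. rewrite Hj.
  destruct (line_eqb j (next i)); [exact A | exact B].
Qed.

Lemma torus_Re i u v j : line_eqb j i = false -> line_eqb j (next i) = false ->
  (eps <= Re (form (torus_cell eps i u v) j))%R.
Proof.
  intros Hj Hj'. simpl. unfold point_at. rewrite Hj, Hj'.
  pose proof (Re_circle_le eps u ltac:(lra)). pose proof (Re_circle_le eps v ltac:(lra)).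
  change (eps <= 1 - Re (circle eps u) - Re (circle eps v))%R. lra.
Qed.

Lemma tube_param i : param_cell (tube_cell eps i) i
  (fun u v => circle eps u) tube_w
  (fun u v => 2 * PI * Ci * circle eps u) (fun u v => - v * (2 * PI * Ci * circle eps u))
  (fun u v => 1 - circle eps u - eps - eps) (fun u v => - (2 * PI * Ci * circle eps u)).
Proof.
  unfold tube_w.
  param_auto.
  - reflexivity.
  - intro j. destruct (line_eqb j i) eqn:E.
    + right; left. exists eps. split; [lra|]. intros u v. simpl. unfold point_at. now rewrite E.
    + left. split.
      * intros u v. simpl. now rewrite E.
      * intros u v Hu Hv. pose proof (tube_Re i u v j Hv E). lra.
Qed.

Lemma torus_param i : param_cell (torus_cell eps i) i
  (fun u v => circle eps u) (fun u v => circle eps v)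
  (fun u v => 2 * PI * Ci * circle eps u) (fun u v => 0)
  (fun u v => 2 * PI * Ci * circle eps v) (fun u v => 0).
Proof.
  param_auto.
  - reflexivity.
  - intro j. destruct (line_eqb j i) eqn:E.
    + right; left. exists eps. split; [lra|]. intros u v. simpl. unfold point_at. now rewrite E.
    + destruct (line_eqb j (next i)) eqn:E'.
      * right; right. exists eps. split; [lra|]. intros u v. simpl. unfold point_at. now rewrite E, E'.
      * left. split.
        -- intros u v. simpl. now rewrite E, E'.
        -- intros u v Hu Hv. pose proof (torus_Re i u v j E E'). lra.
Qed.

Lemma wt_ext p P Q : (forall j, branch P j = branch Q j) -> wt p P = wt p Q.
Proof. intro E. unfold wt. now rewrite !E. Qed.

Lemma wt_monodromy p i P Q :
  (forall j, branch P j = if line_eqb j i then branch Q j + 2 * PI * Ci else branch Q j) ->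
  wt p P = (monodromy_minus_1 (p i) + 1) * wt p Q.
Proof.
  intro E. unfold wt, monodromy_minus_1. rewrite !E.
  replace (Cexp (2 * PI * Ci * p i) - 1 + 1) with (Cexp (2 * PI * Ci * p i)) by ring.
  rewrite <- Cexp_plus. f_equal. destruct i; simpl; ring.
Qed.

Definition tube_edge_v (p : line -> C) (k i : line) : R -> C :=
  edge_v (tube_cell eps i) i (fun u v => 1 - circle eps u - eps - eps) p k.
Definition tube_edge_u (p : line -> C) (k i : line) : R -> C :=
  edge_u (tube_cell eps i) i (fun u v => 2 * PI * Ci * circle eps u)
    (fun u v => - v * (2 * PI * Ci * circle eps u)) p k.

(** After one turn of the circle the forms return to their values, and only the logarithm of l_i has
    increased, by 2 pi i. *)
Lemma tube_edge_v_1 p k i : tube_edge_v p k i 1 = (monodromy_minus_1 (p i) + 1) * tube_edge_v p k i 0.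
Proof.
  unfold tube_edge_v, edge_v. rewrite <- cint_scal; [|lra|].
  - apply cint_ext; [lra|]. intros v Hv. rewrite circle_0, circle_1, Cmult_assoc. f_equal.
    apply wt_monodromy. intro j. simpl. rewrite circle_0, circle_1, circle_log_0, circle_log_1.
    now destruct (line_eqb j i).
  - intros v Hv. apply ccont_mult.
    + apply (ccont2_slice (fun u v => wt p (tube_cell eps i u v)) 0 1 0 1); [|lra|lra].
      eapply pc_cont_wt, tube_param.
    + apply ccont_const.
Qed.

(** At u = 0 the torus has l_i = eps while l_(next i) runs over its circle: this is the end v = 1 of
    the tube around [next i]. *)
Lemma torus_edge_v_0 p k i :
  edge_v (torus_cell eps i) i (fun u v => 2 * PI * Ci * circle eps v) p k 0 = tube_edge_u p k (next i) 1.
Proof.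
  apply cint_ext; [lra|]. intros v Hv. f_equal.
  - apply wt_ext. intro j. simpl. rewrite circle_0, circle_log_0. unfold point_at.
    destruct i, j; simpl; try reflexivity;
      rewrite <- ?Clog_RtoC by lra; f_equal; ring.
  - destruct i, k; unfold vec; simpl; ring.
Qed.

Lemma torus_edge_v_1 p k i :
  edge_v (torus_cell eps i) i (fun u v => 2 * PI * Ci * circle eps v) p k 1
  = (monodromy_minus_1 (p i) + 1) * tube_edge_u p k (next i) 1.
Proof.
  rewrite <- torus_edge_v_0. unfold edge_v. rewrite <- cint_scal; [|lra|].
  - apply cint_ext; [lra|]. intros v Hv. rewrite Cmult_assoc. f_equal.
    apply wt_monodromy. intro j. simpl. rewrite circle_0, circle_1, circle_log_0, circle_log_1.
    now destruct (line_eqb j i).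
  - intros v Hv. apply ccont_mult.
    + apply (ccont2_slice (fun u v => wt p (torus_cell eps i u v)) 0 1 0 1); [|lra|lra].
      eapply pc_cont_wt, torus_param.
    + apply ccont_vec; repeat first [ccont_step | apply (ccont_circle (fun _ => eps) (fun v => v))].
Qed.

(** At v = 0 one has l_(next i) = eps, which is the beginning of the tube around i. *)
Lemma torus_edge_u_0 p k i :
  edge_u (torus_cell eps i) i (fun u v => 2 * PI * Ci * circle eps u) (fun u v => 0) p k 0
  = tube_edge_u p k i 0.
Proof.
  apply cint_ext; [lra|]. intros u Hu. f_equal.
  - apply wt_ext. intro j. simpl. rewrite circle_0, circle_log_0. unfold point_at.
    destruct i, j; simpl; try reflexivity;
      rewrite <- ?Clog_RtoC by lra; f_equal; ring.
  - destruct i, k; unfold vec; simpl; ring.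
Qed.

Lemma torus_edge_u_1 p k i :
  edge_u (torus_cell eps i) i (fun u v => 2 * PI * Ci * circle eps u) (fun u v => 0) p k 1
  = (monodromy_minus_1 (p (next i)) + 1) * tube_edge_u p k i 0.
Proof.
  rewrite <- torus_edge_u_0. unfold edge_u. rewrite <- cint_scal; [|lra|].
  - apply cint_ext; [lra|]. intros u Hu. rewrite Cmult_assoc. f_equal.
    apply wt_monodromy. intro j. simpl. rewrite circle_0, circle_1, circle_log_0, circle_log_1.
    destruct i, j; reflexivity.
  - intros u Hu. apply ccont_mult.
    + apply (ccont2_slice (fun v u => wt p (torus_cell eps i u v)) 0 1 0 1); [|lra|lra].
      apply (ccont2_swap (fun u v => wt p (torus_cell eps i u v))). eapply pc_cont_wt, torus_param.
    + apply ccont_vec; repeat first [ccont_step | apply (ccont_circle (fun _ => eps) (fun v => v))].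
Qed.

(** The parametrization of the triangle collapses the side u = 1 of the square to a vertex. *)
Lemma sigma_edge_v_1 p k :
  edge_v (sigma_cell eps) L1 (fun u v => kappa * (1 - u)) p k 1 = 0.
Proof.
  unfold edge_v. rewrite (cint_ext _ (fun _ => 0)); [|lra|].
  - apply is_cint_unique. pose proof (is_cint_const 0 0 1) as E. now rewrite Cmult_0_r in E.
  - intros v Hv. destruct k; unfold vec; simpl; ring.
Qed.

Lemma sigma_edge_v_0 p k :
  edge_v (sigma_cell eps) L1 (fun u v => kappa * (1 - u)) p k 0 = tube_edge_v p k L1 0.
Proof.
  apply cint_ext; [lra|]. intros v Hv. f_equal.
  - apply wt_ext. intro j. simpl. rewrite circle_0, circle_log_0. unfold point_at.
    destruct j; simpl; try reflexivity;
      rewrite <- ?Clog_RtoC by lra; f_equal; ring.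
  - rewrite circle_0. destruct k; unfold vec, kappa; simpl; ring.
Qed.

Lemma sigma_edge_u_1 p k :
  edge_u (sigma_cell eps) L1 (fun u v => kappa) (fun u v => - kappa * v) p k 1 = tube_edge_v p k L3 0.
Proof.
  apply cint_ext; [lra|]. intros v Hv. f_equal.
  - apply wt_ext. intro j. simpl. rewrite circle_0, circle_log_0. unfold point_at.
    destruct j; simpl; try reflexivity;
      rewrite <- ?Clog_RtoC by lra; f_equal; ring.
  - rewrite circle_0. destruct k; unfold vec, kappa; simpl; ring.
Qed.

(** On v = 0 the coordinate l_1 increases with u, whereas the tube around l_2 starts at l_3 = eps
    and moves towards smaller l_1; hence the reversal and the sign. *)
Lemma sigma_edge_u_0 p k :
  edge_u (sigma_cell eps) L1 (fun u v => kappa) (fun u v => - kappa * v) p k 0 = - tube_edge_v p k L2 0.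
Proof.
  unfold edge_u. rewrite <- cint_flip.
  - replace (- tube_edge_v p k L2 0) with (RtoC (- (1)) * tube_edge_v p k L2 0)
      by (rewrite RtoC_opp; ring).
    unfold tube_edge_v, edge_v. rewrite <- cint_scal; [|lra|].
    + apply cint_ext; [lra|]. intros v Hv.
      replace (wt p (sigma_cell eps (1 - v)%R 0)) with (wt p (tube_cell eps L2 0 v)).
      * rewrite circle_0, RtoC_opp. destruct k; unfold vec, kappa; simpl; ring.
      * apply wt_ext. intro j. simpl. rewrite circle_0, circle_log_0, RtoC_minus. unfold point_at.
        destruct j; simpl; try reflexivity;
          rewrite <- ?Clog_RtoC by lra; f_equal; ring.
    + intros v Hv. apply ccont_mult.
      * apply (ccont2_slice (fun u v => wt p (tube_cell eps L2 u v)) 0 1 0 1); [|lra|lra].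
        eapply pc_cont_wt, tube_param.
      * apply ccont_const.
  - intros u Hu. apply ccont_mult.
    + apply (ccont2_slice (fun v u => wt p (sigma_cell eps u v)) 0 1 0 1); [|lra|lra].
      apply (ccont2_swap (fun u v => wt p (sigma_cell eps u v))). eapply pc_cont_wt, sigma_param.
    + apply ccont_const.
Qed.

(** * The regularized integral and its contiguity relations *)

(** The coefficients of the chain come from [p0] and the weight from [p]. The contiguity relations
    compare weights whose exponents differ by integers over one and the same chain. *)
Definition chain_int (p0 p : line -> C) : C :=
  Csum (fun kc => fst kc * cell_int p (snd kc)) (regularization p0 eps).

Section Chain.
Context (p0 : line -> C).
Hypothesis (Hp0 : forall i, monodromy_minus_1 (p0 i) <> 0).

(* In the boundary of the chain, the torus over the lines i and [next i]
   cancels the ends of the two adjacent tubes, and the remaining edge of the tube i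
   cancels the edge i of sigma. *)
Lemma chain_stokes p k : (forall i, monodromy_minus_1 (p i) = monodromy_minus_1 (p0 i)) ->
  p (next (next k)) * chain_int p0 (lower p (next (next k))) = p (next k) * chain_int p0 (lower p (next k)).
Proof.
  intro Hp. apply C_sub_eq_0. unfold chain_int. simpl.
  pose proof (cell_stokes sigma_param p k) as Es.
  pose proof (fun i => cell_stokes (tube_param i) p k) as Et.
  pose proof (fun i => cell_stokes (torus_param i) p k) as Eu.
  rewrite sigma_edge_v_0, sigma_edge_v_1, sigma_edge_u_0, sigma_edge_u_1 in Es.
  assert (Et' : forall i, p (next (next k)) * cell_int (lower p (next (next k))) (tube_cell eps i) -
     p (next k) * cell_int (lower p (next k)) (tube_cell eps i)
     = monodromy_minus_1 (p0 i) * tube_edge_v p k i 0 - (tube_edge_u p k i 1 - tube_edge_u p k i 0)).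
  { intro i. rewrite Et. fold (tube_edge_v p k i) (tube_edge_u p k i).
    rewrite tube_edge_v_1, Hp. ring. }
  assert (Eu' : forall i, p (next (next k)) * cell_int (lower p (next (next k))) (torus_cell eps i) -
     p (next k) * cell_int (lower p (next k)) (torus_cell eps i)
     = monodromy_minus_1 (p0 i) * tube_edge_u p k (next i) 1
       - monodromy_minus_1 (p0 (next i)) * tube_edge_u p k i 0).
  { intro i. rewrite Eu, torus_edge_v_0, torus_edge_v_1, torus_edge_u_0, torus_edge_u_1, !Hp. ring. }
  clear Et Eu.
  set (pa := p (next (next k))) in *. set (pb := p (next k)) in *.
  set (qa := lower p (next (next k))) in *. set (qb := lower p (next k)) in *.
  pose proof (Hp0 L1) as N1. pose proof (Hp0 L2) as N2. pose proof (Hp0 L3) as N3.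
  pose proof (Et' L1) as T1. pose proof (Et' L2) as T2. pose proof (Et' L3) as T3.
  pose proof (Eu' L1) as U1. pose proof (Eu' L2) as U2. pose proof (Eu' L3) as U3. simpl in U1, U2, U3.
  set (c1 := monodromy_minus_1 (p0 L1)) in *. set (c2 := monodromy_minus_1 (p0 L2)) in *.
  set (c3 := monodromy_minus_1 (p0 L3)) in *.
  transitivity ((pa * cell_int qa (sigma_cell eps) - pb * cell_int qb (sigma_cell eps))
    + 1 / c1 * (pa * cell_int qa (tube_cell eps L1) - pb * cell_int qb (tube_cell eps L1))
    + 1 / c2 * (pa * cell_int qa (tube_cell eps L2) - pb * cell_int qb (tube_cell eps L2))
    + 1 / c3 * (pa * cell_int qa (tube_cell eps L3) - pb * cell_int qb (tube_cell eps L3))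
    + 1 / (c1 * c2) * (pa * cell_int qa (torus_cell eps L1) - pb * cell_int qb (torus_cell eps L1))
    + 1 / (c2 * c3) * (pa * cell_int qa (torus_cell eps L2) - pb * cell_int qb (torus_cell eps L2))
    + 1 / (c3 * c1) * (pa * cell_int qa (torus_cell eps L3) - pb * cell_int qb (torus_cell eps L3))).
  { field. repeat split; assumption. }
  rewrite Es, T1, T2, T3, U1, U2, U3. field. repeat split; assumption.
Qed.

Lemma reg_cells k c : In (k, c) (regularization p0 eps) ->
  c = sigma_cell eps \/ (exists i, c = tube_cell eps i) \/ (exists i, c = torus_cell eps i).
Proof.
  unfold regularization. simpl. intro H.
  repeat (destruct H as [H|H]; [apply (f_equal snd) in H; simpl in H; subst c; eauto|]).
  contradiction.
Qed.

Lemma reg_cell_param k c : In (k, c) (regularization p0 eps) ->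
  exists i z w zu wu wv wuv, param_cell c i z w zu wu wv wuv.
Proof.
  intro H. destruct (reg_cells k c H) as [->|[[i ->]|[i ->]]]; do 7 eexists;
    first [apply sigma_param | apply tube_param | apply torus_param].
Qed.

Lemma Csum_ext {T} (f g : T -> C) l : (forall x, In x l -> f x = g x) -> Csum f l = Csum g l.
Proof.
  induction l as [|x l IH]; simpl; intro E; [reflexivity|].
  rewrite E by now left. f_equal. apply IH. intros; apply E; now right.
Qed.

Lemma Csum_plus {T} (f g : T -> C) l : Csum (fun x => f x + g x) l = Csum f l + Csum g l.
Proof. induction l as [|x l IH]; simpl; [ring | rewrite IH; ring]. Qed.

Lemma Csum_scal {T} (a : C) (f : T -> C) l : Csum (fun x => a * f x) l = a * Csum f l.
Proof. induction l as [|x l IH]; simpl; [ring | rewrite IH; ring]. Qed.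

Lemma point_at_sum i z w : point_at i z w L1 + point_at i z w L2 + point_at i z w L3 = 1.
Proof. destruct i; unfold point_at; simpl; ring. Qed.

Definition shift (p : line -> C) (i : line) (x : C) (j : line) : C :=
  if line_eqb j i then p j + x else p j.

Lemma wt_shift {c i z w zu wu wv wuv} p j u v : param_cell c i z w zu wu wv wuv ->
  I01 u -> I01 v -> wt (shift p j 1) (c u v) = form (c u v) j * wt p (c u v).
Proof.
  intros H Hu Hv. rewrite <- (pc_exp H u v j) by assumption. unfold wt. rewrite <- Cexp_plus.
  f_equal. destruct j; unfold shift; simpl; ring.
Qed.

Lemma chain_int_ext p q : (forall j, p j = q j) -> chain_int p0 p = chain_int p0 q.
Proof.
  intro E. apply Csum_ext. intros [k c] _. simpl. apply (f_equal (Cmult k)). unfold cell_int.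
  apply cint_ext; [lra|]. intros u _. apply cint_ext; [lra|]. intros v _. unfold wt. now rewrite !E.
Qed.

(* l_1 + l_2 + l_3 = 1 *)
Lemma chain_sum p :
  chain_int p0 (shift p L1 1) + chain_int p0 (shift p L2 1) + chain_int p0 (shift p L3 1) = chain_int p0 p.
Proof.
  unfold chain_int. rewrite <- !Csum_plus. apply Csum_ext. intros [k c] Hc. simpl.
  destruct (reg_cell_param k c Hc) as (i & z & w & zu & wu & wv & wuv & H).
  rewrite <- !Cmult_plus_distr_l. apply (f_equal (Cmult k)). unfold cell_int.
  assert (I := fun p => ccont2_cint _ 0 1 0 1 ltac:(lra) ltac:(lra) (pc_cont_integrand H p)).
  rewrite <- (is_cint_unique _ _ _ _ (is_cint_plus _ _ _ _ _ _ (is_cint_plus _ _ _ _ _ _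
     (I (shift p L1 1)) (I (shift p L2 1))) (I (shift p L3 1)))).
  apply cint_ext; [lra|]. intros u Hu.
  assert (J : forall p, is_cint (fun v => wt p (c u v) * jacobian c u v) 0 1
                                (cint (fun v => wt p (c u v) * jacobian c u v) 0 1)).
  { intro q. apply cint_correct; [lra|]. intros v Hv.
    apply (ccont2_slice _ 0 1 0 1 _ _ (pc_cont_integrand H q)); lra. }
  rewrite <- (is_cint_unique _ _ _ _ (is_cint_plus _ _ _ _ _ _ (is_cint_plus _ _ _ _ _ _
     (J (shift p L1 1)) (J (shift p L2 1))) (J (shift p L3 1)))).
  apply cint_ext; [lra|]. intros v Hv.
  rewrite !(wt_shift p _ u v H) by lra.
  rewrite !(pc_form H).
  transitivity ((point_at i (z u v) (w u v) L1 + point_at i (z u v) (w u v) L2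
     + point_at i (z u v) (w u v) L3) * (wt p (c u v) * jacobian c u v)); [ring|].
  rewrite point_at_sum. ring.
Qed.

Lemma monodromy_1 p : monodromy_minus_1 (p + 1) = monodromy_minus_1 p.
Proof. unfold monodromy_minus_1. rewrite Cmult_plus_distr_l, Cmult_1_r, Cexp_plus, Cexp_2PI_Ci. ring. Qed.

Lemma monodromy_nat p n : monodromy_minus_1 (p + RtoC (INR n)) = monodromy_minus_1 p.
Proof.
  induction n as [|n IH].
  - change (INR 0) with 0%R. f_equal. ring.
  - rewrite S_INR, RtoC_plus, Cplus_assoc, monodromy_1. exact IH.
Qed.

Definition same_monodromy (p : line -> C) : Prop :=
  forall i, monodromy_minus_1 (p i) = monodromy_minus_1 (p0 i).

Lemma same_monodromy_shift p a n : same_monodromy p -> same_monodromy (shift p a (RtoC (INR n))).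
Proof.
  intros Hp i. unfold shift. destruct (line_eqb i a); [rewrite monodromy_nat|]; apply Hp.
Qed.

(** Stokes' formula for the 1-form with dl_k, at the exponents p raised by 1 on both lines other
    than k, relates exactly these two lines. *)
Lemma chain_contiguous p a b : same_monodromy p ->
  (p a + 1) * chain_int p0 (shift p b 1) = (p b + 1) * chain_int p0 (shift p a 1).
Proof.
  intro Hp.
  assert (K : forall k, (p (next (next k)) + 1) * chain_int p0 (shift p (next k) 1)
                        = (p (next k) + 1) * chain_int p0 (shift p (next (next k)) 1)).
  { intro k.
    pose proof (chain_stokes (shift (shift p (next (next k)) 1) (next k) 1) k) as E.
    assert (Hq : forall i, monodromy_minus_1 (shift (shift p (next (next k)) 1) (next k) 1 i) = monodromy_minus_1 (p0 i)).
    { change (RtoC 1) with (RtoC (INR 1)). apply same_monodromy_shift, same_monodromy_shift, Hp. }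
    specialize (E Hq).
    assert (E1 : chain_int p0 (lower (shift (shift p (next (next k)) 1) (next k) 1) (next (next k)))
                 = chain_int p0 (shift p (next k) 1)).
    { apply chain_int_ext. intro j; destruct j, k; unfold lower, shift; simpl; ring. }
    assert (E2 : chain_int p0 (lower (shift (shift p (next (next k)) 1) (next k) 1) (next k))
                 = chain_int p0 (shift p (next (next k)) 1)).
    { apply chain_int_ext. intro j; destruct j, k; unfold lower, shift; simpl; ring. }
    rewrite E1, E2 in E.
    clear - E. destruct k; exact E. }
  (* Each pair of distinct lines omits one k; the opposite order of the pair is obtained by
     symmetry. *)
  destruct a, b; [reflexivity | exact (eq_sym (K L3)) | exact (K L2) | exact (K L3) | reflexivity
    | exact (eq_sym (K L1)) | exact (eq_sym (K L2)) | exact (K L1) | reflexivity].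
Qed.

Lemma chain_raise p a : same_monodromy p ->
  (p a + 1) * chain_int p0 p = (p L1 + p L2 + p L3 + 3) * chain_int p0 (shift p a 1).
Proof.
  intro Hp. rewrite <- (chain_sum p), !Cmult_plus_distr_l.
  rewrite (chain_contiguous p a L1 Hp), (chain_contiguous p a L2 Hp), (chain_contiguous p a L3 Hp). ring.
Qed.

Lemma chain_raise_n p a n : same_monodromy p ->
  poch (p a + 1) n * chain_int p0 p
  = poch (p L1 + p L2 + p L3 + 3) n * chain_int p0 (shift p a (RtoC (INR n))).
Proof.
  intro Hp. induction n as [|n IH].
  - simpl. change (INR 0) with 0%R. rewrite !Cmult_1_l. apply chain_int_ext.
    intro j. unfold shift. destruct (line_eqb j a); ring.
  - simpl poch.
    replace (poch (p a + 1) n * (p a + 1 + RtoC (INR n)) * chain_int p0 p)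
      with ((p a + 1 + RtoC (INR n)) * (poch (p a + 1) n * chain_int p0 p)) by ring.
    rewrite IH.
    pose proof (chain_raise (shift p a (RtoC (INR n))) a (same_monodromy_shift p a n Hp)) as E.
    assert (E1 : chain_int p0 (shift (shift p a (RtoC (INR n))) a 1)
                 = chain_int p0 (shift p a (RtoC (INR (S n))))).
    { apply chain_int_ext. intro j. rewrite S_INR, RtoC_plus. unfold shift.
      destruct (line_eqb j a); ring. }
    rewrite E1 in E.
    transitivity (poch (p L1 + p L2 + p L3 + 3) n *
      ((shift p a (RtoC (INR n)) a + 1) * chain_int p0 (shift p a (RtoC (INR n))))).
    + unfold shift at 2. rewrite line_eqb_refl. ring.
    + rewrite E. destruct a; unfold shift; simpl; ring.
Qed.

End Chain.
End Cells.

(** * Evaluation of the regularized integral *)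

Lemma Cmod_Clog_le (x : C) (e B : R) : (0 < e)%R -> (e <= Re x)%R -> (Cmod x <= B)%R ->
  (Cmod (Clog x) <= Rabs (ln e) + Rabs (ln B) + PI)%R.
Proof.
  intros He Hx HB.
  pose proof (Re_le_Cmod x) as Hc.
  eapply Rle_trans; [apply Cmod_le_Re_Im|]. apply Rplus_le_compat.
  - change (Re (Clog x)) with (ln (Cmod x)).
    assert (ln e <= ln (Cmod x) <= ln B)%R by (split; apply ln_le; lra).
    unfold Rabs. repeat destruct Rcase_abs; lra.
  - rewrite Clog_Re_pos by lra. simpl. pose proof (atan_bound (Im x / Re x)). pose proof PI_RGT_0.
    apply Rabs_le_between. lra.
Qed.

Lemma Cmod_Cexp_Clog_le (q x : C) (e B : R) : (0 < e)%R -> (e <= Re x)%R -> (Cmod x <= B)%R ->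
  (Cmod (Cexp (q * Clog x)) <= exp (Cmod q * (Rabs (ln e) + Rabs (ln B) + PI)))%R.
Proof.
  intros He Hx HB. eapply Rle_trans; [apply Cmod_Cexp_le|]. apply exp_mono.
  rewrite Cmod_mult. apply Rmult_le_compat_l; [apply Cmod_ge_0 | now apply Cmod_Clog_le].
Qed.

(** * Functions whose circle integrals can be contracted *)

Section Nice.
Context (eps : R).

(** The hypotheses of [circle_integral_segment] on the closed disc of radius eps, bundled so that
    they pass to products. *)
Definition nice (h : C -> C) : Prop :=
  (exists h', forall z, (Cmod z <= eps)%R -> cdiff h z (h' z) /\ ccont h z /\ ccont h' z) /\
  (exists M, forall z, (Cmod z <= eps)%R -> (Cmod (h z) <= M)%R).

Lemma circle_integral_nice alpha h : (0 < Re alpha)%R -> (0 < eps)%R -> nice h ->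
  circle_integral alpha h eps = monodromy_minus_1 alpha * cint (fun r => rpow alpha r * h (RtoC r)) 0 eps.
Proof.
  intros Ha He [[h' D] [M HM]].
  apply (circle_integral_segment alpha h h' eps M Ha He); [| | |exact HM]; intros z0 Hz; apply (D z0 Hz).
Qed.

Lemma nice_mult f g : nice f -> nice g -> nice (fun z => f z * g z).
Proof.
  intros [[f' Df] [M HM]] [[g' Dg] [N HN]]. split.
  - exists (fun z => f' z * g z + f z * g' z). intros z Hz.
    destruct (Df z Hz) as (A & B & E). destruct (Dg z Hz) as (A' & B' & E'). split; [|split].
    + now apply cdiff_mult.
    + now apply ccont_mult.
    + now apply (ccont_plus _ _ z (ccont_mult f' g z E B') (ccont_mult f g' z B E')).
  - exists (M * N)%R. intros z Hz. rewrite Cmod_mult.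
    apply Rmult_le_compat; try apply Cmod_ge_0; auto.
Qed.

Lemma nice_const c : nice (fun _ => c).
Proof.
  split.
  - exists (fun _ => 0). intros z _. split; [apply cdiff_const|]. split; apply ccont_const.
  - exists (Cmod c). intros; lra.
Qed.

Lemma ccont_C_id (z : C) : ccont (fun z : C => z) z.
Proof. split; [apply (continuous_fst (U := R_UniformSpace) (V := R_UniformSpace)) | apply (continuous_snd (U := R_UniformSpace) (V := R_UniformSpace))]. Qed.

Lemma cdiff_affine a b z : cdiff (fun z => a + b * z) z b.
Proof.
  eapply cdiff_eq.
  - apply cdiff_plus; [apply cdiff_const|]. apply (cdiff_mult (fun _ => b)); [apply cdiff_const | apply cdiff_id].
  - cbn beta. ring.
Qed.

Lemma ccont_affine (a b z : C) : ccont (fun z : C => a + b * z) z.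
Proof.
  apply ccont_plus; [apply ccont_const|]. apply ccont_mult; [apply ccont_const | apply ccont_C_id].
Qed.

Lemma nice_affine a b : nice (fun z => a + b * z).
Proof.
  split.
  - exists (fun _ => b). intros z _. split; [apply cdiff_affine|].
    split; [apply ccont_affine | apply ccont_const].
  - exists (Cmod a + Cmod b * Rabs eps)%R. intros z Hz.
    eapply Rle_trans; [apply Cmod_triangle|]. apply Rplus_le_compat_l. rewrite Cmod_mult.
    apply Rmult_le_compat_l; [apply Cmod_ge_0|]. pose proof (Rle_abs eps). lra.
Qed.

Lemma nice_power q a b e B : (0 < e)%R ->
  (forall z, (Cmod z <= eps)%R -> (e <= Re (a + b * z))%R /\ (Cmod (a + b * z) <= B)%R) ->
  nice (fun z => Cexp (q * Clog (a + b * z))).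
Proof.
  intros He H. split.
  - exists (fun z => q * b * Cexp (- Clog (a + b * z)) * Cexp (q * Clog (a + b * z))).
    intros z Hz. destruct (H z Hz) as [H1 _].
    assert (L : ccont (fun z : C => Clog (a + b * z)) z)
      by (apply (ccont_Clog (fun z : C => a + b * z)); [apply ccont_affine | lra]).
    assert (E : ccont (fun z : C => Cexp (q * Clog (a + b * z))) z).
    { apply ccont_Cexp. apply ccont_mult; [apply ccont_const | exact L]. }
    split; [|split; [exact E|]].
    + eapply cdiff_eq.
      * apply (cdiff_Cexp (fun z => q * Clog (a + b * z))).
        apply (cdiff_mult (fun _ => q)); [apply cdiff_const|].
        apply (cdiff_Clog (fun z => a + b * z)); [apply cdiff_affine | lra].
      * cbn beta. rewrite Cexp_opp, Cexp_Clog by lra. field. apply Re_pos_neq_0; lra.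
    + apply ccont_mult; [|exact E]. apply ccont_mult; [apply ccont_const|].
      apply ccont_Cexp, ccont_opp, L.
  - eexists. intros z Hz. destruct (H z Hz) as [H1 H2].
    eapply Cmod_Cexp_Clog_le; eassumption.
Qed.

Lemma nice_ext f g : (forall z, f z = g z) -> nice f -> nice g.
Proof.
  intros E [[f' D] [M HM]]. split.
  - exists f'. intros z Hz. destruct (D z Hz) as (A & B & F). split; [|split].
    + intros c x m Hc Hd. apply (cder_ext (fun t => f (c t))); [intro; apply E | now apply A].
    + now apply (ccont_ext f g z E).
    + exact F.
  - exists M. intros z Hz. rewrite <- E. auto.
Qed.

End Nice.

Section Eval.
Context (eps : R).
Hypothesis (He : (0 < eps < 1 / 3)%R).

Lemma wt_shift_n {c i z w zu wu wv wuv} p j n u v : param_cell c i z w zu wu wv wuv ->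
  I01 u -> I01 v ->
  wt (shift p j (RtoC (INR n))) (c u v) = form (c u v) j ^ n * wt p (c u v).
Proof.
  intros H Hu Hv. induction n as [|n IH].
  - simpl. rewrite Cmult_1_l. unfold wt. change (INR 0) with 0%R.
    f_equal. destruct j; unfold shift; simpl; ring.
  - change (form (c u v) j ^ S n) with (form (c u v) j * form (c u v) j ^ n).
    rewrite <- Cmult_assoc, <- IH, <- (wt_shift _ j u v H Hu Hv).
    unfold wt. f_equal. rewrite S_INR, RtoC_plus. destruct j; unfold shift; simpl; ring.
Qed.

(** Raising p_3 by n multiplies the integrand by l_3^n, while the remaining factor is bounded on the
    compact cell. This handles the triangle itself and every cell that winds around l_3 = 0, where
    |l_3| = eps. *)
Lemma far_cell {c i z w zu wu wv wuv} p q : param_cell c i z w zu wu wv wuv -> (0 <= q)%R ->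
  (forall u v, I01 u -> I01 v -> (Cmod (form (c u v) L3) <= q)%R) ->
  exists K, forall n, (Cmod (cell_int (shift p L3 (RtoC (INR n))) c) <= K * q ^ n)%R.
Proof.
  intros H Hq HL.
  destruct (ccont2_bounded _ (pc_cont_integrand H p)) as [K HK].
  exists K. intro n.
  assert (B : forall u v, I01 u -> I01 v ->
     (Cmod (wt (shift p L3 (RtoC (INR n))) (c u v) * jacobian c u v) <= K * q ^ n)%R).
  { intros u v Hu Hv. rewrite (wt_shift_n p L3 n u v H Hu Hv).
    rewrite <- Cmult_assoc, Cmod_mult, Cmod_pow, Rmult_comm.
    apply Rmult_le_compat; [apply Cmod_ge_0 | apply pow_le, Cmod_ge_0 | now apply HK |].
    apply pow_incr. split; [apply Cmod_ge_0 | now apply HL]. }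
  replace (K * q ^ n)%R with ((1 - 0) * (K * q ^ n))%R by ring.
  eapply is_cint_norm_const; [lra | | exact (ccont2_cint _ 0 1 0 1 ltac:(lra) ltac:(lra)
    (pc_cont_integrand H (shift p L3 (RtoC (INR n)))))].
  intros u Hu. cbn beta.
  replace (K * q ^ n)%R with ((1 - 0) * (K * q ^ n))%R by ring.
  eapply is_cint_norm_const; [lra | | apply cint_correct; [lra|]].
  - intros v Hv. exact (B u v Hu Hv).
  - intros v Hv. now apply (ccont2_slice _ 0 1 0 1 _ _ (pc_cont_integrand H (shift p L3 (RtoC (INR n))))).
Qed.

(** For fixed v the two other forms on a tube are affine in z = l_i, namely a - v z and (1 - a) + (v
    - 1) z. The bounds hold on the full disc, over which the circle has to be contracted. *)
Lemma affine_tube_bounds v z : I01 v -> (Cmod z <= eps)%R ->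
  let a := ((1 - v) * eps + v * (1 - eps))%R in
  ((eps <= Re (a + - v * z))%R /\ (Cmod (a + - v * z) <= 2)%R) /\
  ((eps <= Re ((1 - a) + (v - 1) * z))%R /\ (Cmod ((1 - a) + (v - 1) * z) <= 2)%R).
Proof.
  intros Hv Hz a.
  pose proof (re_le_Cmod z) as Hr. assert (Hz' : (- eps <= Re z <= eps)%R).
  { apply Rabs_le_between. lra. }
  assert (Ha : (eps <= a <= 1 - eps)%R) by (unfold a; nra).
  assert (Hva : (eps <= a - v * eps)%R) by (unfold a; nra).
  assert (Hvb : (eps <= (1 - a) - (1 - v) * eps)%R) by (unfold a; nra).
  assert (A : Re (a + - v * z) = (a - v * Re z)%R) by (unfold Re; simpl; ring).
  assert (B : Re ((1 - a) + (v - 1) * z) = ((1 - a) - (1 - v) * Re z)%R) by (unfold Re; simpl; ring).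
  rewrite A, B.
  assert (Cz := Cmod_ge_0 z).
  repeat split.
  - nra.
  - eapply Rle_trans; [apply Cmod_triangle|]. rewrite Cmod_mult, Cmod_opp, !Cmod_R, !Rabs_pos_eq by lra. nra.
  - nra.
  - eapply Rle_trans; [apply Cmod_triangle|].
    rewrite <- !RtoC_minus, Cmod_mult, !Cmod_R, (Rabs_pos_eq (1 - a)), (Rabs_left1 (v - 1)) by lra. nra.
Qed.

Lemma wt_tube p i u v :
  wt p (tube_cell eps i u v) = Cexp (p i * circle_log eps u)
    * (Cexp (p (next i) * Clog (tube_w eps u v))
       * Cexp (p (next (next i)) * Clog (1 - circle eps u - tube_w eps u v))).
Proof.
  unfold wt. rewrite <- !Cexp_plus. f_equal. destruct i; simpl; unfold point_at, tube_w; simpl; ring.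
Qed.

(* For [i <> L3] the circle around the line i is contracted to a segment, along
   which all forms are real and l_3 <= 1 - eps. *)
Lemma near_tube p i : (0 < Re (p i))%R -> line_eqb i L3 = false ->
  exists K, forall n, (Cmod (cell_int (shift p L3 (RtoC (INR n))) (tube_cell eps i)) <= K * (1 - eps) ^ n)%R.
Proof.
  intros Hp Hi.
  set (X := fun q : C => exp (Cmod q * (Rabs (ln eps) + Rabs (ln 2) + PI))).
  exists (Cmod (monodromy_minus_1 (p i)) * (eps * (X (p (next i)) * X (p (next (next i))) )))%R.
  intro n. set (q := shift p L3 (RtoC (INR n))).
  assert (Hqi : q i = p i) by (unfold q, shift; now rewrite Hi).
  set (a := fun v : R => ((1 - v) * eps + v * (1 - eps))%R).
  set (h := fun v z => Cexp (q (next i) * Clog (a v + - v * z))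
              * Cexp (q (next (next i)) * Clog ((1 - a v) + (v - 1) * z)) * ((1 - eps - eps) + - (1) * z)).
  assert (Nh : forall v, I01 v -> nice eps (h v)).
  { intros v Hv. unfold h. apply nice_mult; [apply nice_mult|].
    - apply (nice_power eps _ _ _ eps 2); [lra|]. intros z Hz. apply (affine_tube_bounds v z Hv Hz).
    - apply (nice_power eps _ _ _ eps 2); [lra|]. intros z Hz. apply (affine_tube_bounds v z Hv Hz).
    - apply nice_affine. }
  assert (E : cell_int q (tube_cell eps i)
    = cint (fun v => monodromy_minus_1 (p i) * cint (fun r => rpow (p i) r * h v (RtoC r)) 0 eps) 0 1).
  (* After the exchange the inner integral is a circle integral at fixed v, with the remaining
     factors collected in the holomorphic function [h v]. *)
  { unfold cell_int. rewrite cint_swap; [|lra|lra|].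
    2:{ eapply pc_cont_integrand, tube_param, He. }
    apply cint_ext; [lra|]. intros v Hv.
    rewrite <- (circle_integral_nice eps (p i) (h v)); [|assumption|lra|apply Nh; lra].
    apply cint_ext; [lra|]. intros u Hu.
    rewrite wt_tube, Hqi, (pc_jacobian (tube_param eps He i)). unfold h.
    replace (a v + - v * circle eps u) with (tube_w eps u v).
    2:{ unfold tube_w, a. rewrite !RtoC_plus, !RtoC_mult, !RtoC_minus. ring. }
    replace (1 - a v + (v - 1) * circle eps u) with (1 - circle eps u - tube_w eps u v).
    2:{ unfold tube_w, a. rewrite !RtoC_plus, !RtoC_mult, !RtoC_minus. ring. }
    ring. }
  rewrite E.
  (* Integrability in v of the contracted integrals is inherited from the tube, where it follows
     from joint continuity. *)
  assert (I : is_cint (fun v => monodromy_minus_1 (p i) * cint (fun r => rpow (p i) r * h v (RtoC r)) 0 eps) 0 1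
     (cint (fun v => monodromy_minus_1 (p i) * cint (fun r => rpow (p i) r * h v (RtoC r)) 0 eps) 0 1)).
  { eapply is_cint_cint.
    eapply is_cint_ext; [lra | |
      exact (ccont2_cint _ 0 1 0 1 ltac:(lra) ltac:(lra) (ccont2_swap _ _ _ _ _
        (pc_cont_integrand (tube_param eps He i) q)))].
    intros v Hv. cbn beta.
    rewrite <- (circle_integral_nice eps (p i) (h v)); [|assumption|lra|apply Nh; lra].
    apply cint_ext; [lra|]. intros u Hu.
    rewrite wt_tube, Hqi, (pc_jacobian (tube_param eps He i)). unfold h.
    replace (a v + - v * circle eps u) with (tube_w eps u v).
    2:{ unfold tube_w, a. rewrite !RtoC_plus, !RtoC_mult, !RtoC_minus. ring. }
    replace (1 - a v + (v - 1) * circle eps u) with (1 - circle eps u - tube_w eps u v).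
    2:{ unfold tube_w, a. rewrite !RtoC_plus, !RtoC_mult, !RtoC_minus. ring. }
    ring. }
  (* After contraction both other forms are real with sum 1 - r and at least eps each, so both are
     at most 1 - eps. *)
  assert (B : forall v r, I01 v -> (0 <= r <= eps)%R ->
     (Cmod (rpow (p i) r * h v (RtoC r)) <= X (p (next i)) * X (p (next (next i))) * (1 - eps) ^ n)%R).
  { intros v r Hv Hr.
    assert (Hr' : (Cmod (RtoC r) <= eps)%R) by (rewrite Cmod_R, Rabs_pos_eq; lra).
    destruct (affine_tube_bounds v (RtoC r) Hv Hr') as [[A1 A2] [A3 A4]]. fold (a v) in A1, A2, A3, A4.
    set (l := (a v - v * r)%R). set (m := (1 - a v - (1 - v) * r)%R).
    assert (El : a v + - v * RtoC r = RtoC l) by (unfold l; rewrite RtoC_minus, RtoC_mult; ring).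
    assert (Em : (1 - a v) + (v - 1) * RtoC r = RtoC m)
      by (unfold m; rewrite !RtoC_minus, RtoC_mult, RtoC_minus; ring).
    rewrite El in A1, A2. rewrite Em in A3, A4.
    change (Re (RtoC l)) with l in A1. change (Re (RtoC m)) with m in A3.
    assert (S : (l + m = 1 - r)%R) by (unfold l, m; ring).
    assert (P : forall j x, (eps <= x <= 1 - eps)%R ->
      (Cmod (Cexp (q j * Clog (RtoC x))) <= X (p j) * (if line_eqb j L3 then (1 - eps) ^ n else 1))%R).
    { intros j x Hx.
      assert (P0 : (Cmod (Cexp (p j * Clog (RtoC x))) <= X (p j))%R).
      { apply Cmod_Cexp_Clog_le; simpl; try lra. rewrite Cmod_R, Rabs_pos_eq; lra. }
      unfold q, shift. destruct (line_eqb j L3).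
      - rewrite Cmult_plus_distr_r, Cexp_plus, Cmod_mult.
        apply Rmult_le_compat; try apply Cmod_ge_0; [exact P0|].
        rewrite Clog_RtoC, <- RtoC_mult, Cexp_RtoC, <- pow_exp_ln, Cmod_R by lra.
        rewrite Rabs_pos_eq by (apply pow_le; lra). apply pow_incr. lra.
      - rewrite Rmult_1_r. exact P0. }
    unfold h. rewrite El, Em, !Cmod_mult.
    pose proof (P (next i) l ltac:(lra)) as P1. pose proof (P (next (next i)) m ltac:(lra)) as P2.
    pose proof (Cmod_rpow_le_1 (p i) r ltac:(lra) ltac:(lra)) as P3.
    assert (P4 : (Cmod ((1 - eps - eps) + - (1) * RtoC r) <= 1)%R).
    { replace ((1 - eps - eps) + - (1) * RtoC r) with (RtoC (1 - eps - eps - r)) by (rewrite !RtoC_minus; ring).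
      rewrite Cmod_R. apply Rabs_le_between. lra. }
    set (Y := ((1 - eps) ^ n)%R) in *.
    (* As i is not [L3], exactly one of the two other lines is [L3], and the factor (1 - eps)^n
       occurs once. *)
    assert (P5 : (X (p (next i)) * (if line_eqb (next i) L3 then Y else 1) *
                  (X (p (next (next i))) * (if line_eqb (next (next i)) L3 then Y else 1))
                  = X (p (next i)) * X (p (next (next i))) * Y)%R).
    { destruct i; simpl; try discriminate Hi; ring. }
    rewrite <- P5.
    assert (0 <= Cmod (Cexp (q (next i) * Clog l)))%R by apply Cmod_ge_0.
    assert (0 <= Cmod (Cexp (q (next (next i)) * Clog m)))%R by apply Cmod_ge_0.
    pose proof (Rmult_le_compat _ _ _ _ H H0 P1 P2) as P6.
    apply Rle_trans with (1 * (Cmod (Cexp (q (next i) * Clog l)) * Cmod (Cexp (q (next (next i)) * Clog m)) * 1))%R;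
      [|lra].
    apply Rmult_le_compat; [apply Cmod_ge_0 | | exact P3 |].
    - repeat apply Rmult_le_pos; try assumption; apply Cmod_ge_0.
    - apply Rmult_le_compat_l; [now apply Rmult_le_pos | exact P4]. }
  replace (Cmod (monodromy_minus_1 (p i)) * (eps * (X (p (next i)) * X (p (next (next i))))) * (1 - eps) ^ n)%R
    with ((1 - 0) * (Cmod (monodromy_minus_1 (p i)) * ((eps - 0) * (X (p (next i)) * X (p (next (next i))) * (1 - eps) ^ n))))%R by ring.
  eapply is_cint_norm_const; [lra | | exact I].
  intros v Hv. cbn beta. rewrite Cmod_mult. apply Rmult_le_compat_l; [apply Cmod_ge_0|].
  eapply is_cint_norm_const; [lra | | apply cint_correct; [lra|]].
  - intros r Hr. exact (B v r Hv Hr).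
  - intros r Hr. destruct (Nh v Hv) as [[h' D] _].
    apply (ccont_rpow_h (p i) (h v) eps); [assumption | intros z0 Hz; apply (D z0 Hz) | assumption].
Qed.

Lemma wt_torus_12 p u v :
  wt p (torus_cell eps L1 u v) = Cexp (p L1 * circle_log eps u)
    * (Cexp (p L2 * circle_log eps v) * Cexp (p L3 * Clog (1 - circle eps u - circle eps v))).
Proof.
  unfold wt. rewrite <- !Cexp_plus. f_equal. simpl. unfold point_at; simpl. ring.
Qed.

Lemma torus_nice (q k zeta : C) : (Cmod zeta <= eps)%R ->
  nice eps (fun z => k * Cexp (q * Clog (1 - zeta - z))).
Proof.
  intro Hz. apply nice_mult; [apply nice_const|].
  apply (nice_ext _ (fun z => Cexp (q * Clog ((1 - zeta) + - (1) * z)))).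
  { intro z. do 3 f_equal. ring. }
  (* The real part is at least 1 - 2 eps > 1/3. *)
  apply (nice_power eps _ _ _ (1 / 3) 2); [lra|]. intros z Hz'.
  pose proof (re_le_Cmod zeta) as A. pose proof (re_le_Cmod z) as B.
  apply Rabs_le_between in A. apply Rabs_le_between in B.
  split.
  - assert (E : Re (1 - zeta + - (1) * z) = (1 - Re zeta - Re z)%R) by (unfold Re; simpl; ring).
    rewrite E. lra.
  - eapply Rle_trans; [apply Cmod_triangle|]. rewrite Cmod_mult, Cmod_opp, Cmod_1.
    eapply Rle_trans; [apply Rplus_le_compat_r; apply Cmod_triangle|]. rewrite Cmod_opp, Cmod_1. lra.
Qed.

(** The circle of l_2 is contracted at fixed u; after an exchange of the integrals the circle of l_1
    is contracted at fixed t. The function [k] is the integrand between the two contractions, and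
    each contraction yields its monodromy factor. *)
Lemma corner_cell p n : (0 < Re (p L1))%R -> (0 < Re (p L2))%R ->
  cell_int (shift p L3 (RtoC (INR n))) (torus_cell eps L1)
  = monodromy_minus_1 (p L1) * monodromy_minus_1 (p L2) * corner (p L1) (p L2) (p L3) eps n.
Proof.
  intros H1 H2. set (q := p L3 + RtoC (INR n)).
  set (c1 := monodromy_minus_1 (p L1)). set (c2 := monodromy_minus_1 (p L2)).
  set (k := fun u t => Cexp (p L1 * circle_log eps u) * (rpow (p L2) t * Cexp (q * Clog (1 - t - circle eps u)))
                       * (2 * PI * Ci * circle eps u)).
  assert (Ck : ccont2 k 0 1 0 eps).
  { intros u t Hu Ht. unfold k.
    assert (CC : ccont (fun x : R * R => circle eps (fst x)) (u, t))
      by (apply (ccont_circle (fun _ => eps) fst); [apply continuous_const | apply continuous_fst]).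
    apply ccont_mult; [apply ccont_mult; [|apply ccont_mult]|].
    - apply ccont_Cexp. apply ccont_mult; [apply ccont_const|].
      apply (ccont_circle_log (fun _ => eps)); [lra | apply continuous_const | apply continuous_fst].
    - apply (ccont_comp (V := R_UniformSpace) snd (rpow (p L2))); [apply continuous_snd | now apply ccont_rpow].
    - apply ccont_Cexp. apply ccont_mult; [apply ccont_const|].
      apply (ccont_Clog (fun x : R * R => 1 - RtoC (snd x) - circle eps (fst x))).
      + apply ccont_minus; [|exact CC]. apply ccont_minus; [apply ccont_const|].
        apply ccont_RtoC, continuous_snd.
      + simpl. pose proof (Re_circle_le eps u ltac:(lra)) as A.
        change (0 < 1 - t - Re (circle eps u))%R. lra.
    - apply ccont_mult; [apply ccont_const | exact CC]. }
  transitivity (cint (fun u => c2 * cint (k u) 0 eps) 0 1).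
  { apply cint_ext; [lra|]. intros u Hu.
    assert (Hcu : (Cmod (circle eps u) <= eps)%R) by (rewrite Cmod_circle; lra).
    rewrite (cint_ext (k u) (fun t => rpow (p L2) t *
      ((Cexp (p L1 * circle_log eps u) * (2 * PI * Ci * circle eps u))
        * Cexp (q * Clog (1 - circle eps u - RtoC t))))).
    - unfold c2. rewrite <- (circle_integral_nice eps (p L2)
        (fun w => (Cexp (p L1 * circle_log eps u) * (2 * PI * Ci * circle eps u))
        * Cexp (q * Clog (1 - circle eps u - w)))); [|assumption|lra|now apply torus_nice].
      apply cint_ext; [lra|]. intros v Hv.
      rewrite wt_torus_12, (pc_jacobian (torus_param eps He L1)).
      unfold shift, q; simpl. ring.
    - lra.
    - intros t Ht. unfold k.
      replace (1 - circle eps u - t) with (1 - t - circle eps u) by ring. ring. }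
  rewrite (is_cint_unique _ _ _ _ (is_cint_scal c2 _ _ _ _ (ccont2_cint k 0 1 0 eps ltac:(lra) ltac:(lra) Ck))).
  rewrite (cint_swap k 0 1 0 eps) by (lra || assumption).
  assert (G : forall t, (0 < t < eps)%R -> cint (fun u => k u t) 0 1
    = c1 * cint (fun s => rpow (p L2) t * (rpow (p L1) s * Cexp (q * RtoC (ln (1 - s - t))))) 0 eps).
  { intros t Ht.
    assert (Hct : (Cmod (RtoC t) <= eps)%R) by (rewrite Cmod_R, Rabs_pos_eq; lra).
    transitivity (circle_integral (p L1) (fun z => rpow (p L2) t * Cexp (q * Clog (1 - t - z))) eps).
    - apply cint_ext; [lra|]. intros u Hu. reflexivity.
    - rewrite (circle_integral_nice eps); [|assumption|lra|now apply torus_nice].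
      unfold c1. f_equal. apply cint_ext; [lra|]. intros s Hs.
      replace (1 - t - s) with (RtoC (1 - s - t)) by (rewrite !RtoC_minus; ring).
      rewrite Clog_RtoC by lra. ring. }
  rewrite (cint_ext _ (fun t => c1 * cint (fun s => rpow (p L2) t *
      (rpow (p L1) s * Cexp (q * RtoC (ln (1 - s - t))))) 0 eps)); [|lra|exact G].
  unfold q.
  rewrite (is_cint_unique _ _ _ _ (is_cint_scal c1 _ _ _ _
     (ccont2_cint _ 0 eps 0 eps ltac:(lra) ltac:(lra) (corner_ccont2 (p L1) (p L2) (p L3) eps H1 H2 He n)))).
  fold (corner (p L1) (p L2) (p L3) eps n). ring.
Qed.

(* Only the torus around the corner l_1 = l_2 = 0 contributes to the leading order. *)
Lemma chain_asymptotic p : (forall i, monodromy_minus_1 (p i) <> 0) ->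
  (0 < Re (p L1))%R -> (0 < Re (p L2))%R ->
  clim (fun n => Cexp ((p L1 + p L2 + 2) * RtoC (ln (INR (S n))))
                 * chain_int eps p (shift p L3 (RtoC (INR (S n)))))
       (Cgamma (p L1 + 1) * Cgamma (p L2 + 1)).
Proof.
  intros Hp H1 H2.
  set (q := fun n => shift p L3 (RtoC (INR n))).
  destruct (far_cell p (1 - eps) (sigma_param eps He) ltac:(lra)) as [K0 B0].
  { intros u v Hu Hv. now apply sigma_L3. }
  destruct (near_tube p L1 H1 eq_refl) as [K1 B1]. destruct (near_tube p L2 H2 eq_refl) as [K2 B2].
  destruct (far_cell p (1 - eps) (tube_param eps He L3) ltac:(lra)) as [K3 B3].
  { intros u v Hu Hv. simpl. unfold point_at; simpl. rewrite Cmod_circle; lra. }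
  destruct (far_cell p (1 - eps) (torus_param eps He L2) ltac:(lra)) as [K4 B4].
  { intros u v Hu Hv. simpl. unfold point_at; simpl. rewrite Cmod_circle; lra. }
  destruct (far_cell p (1 - eps) (torus_param eps He L3) ltac:(lra)) as [K5 B5].
  { intros u v Hu Hv. simpl. unfold point_at; simpl. rewrite Cmod_circle; lra. }
  set (c1 := monodromy_minus_1 (p L1)) in *. set (c2 := monodromy_minus_1 (p L2)) in *.
  set (c3 := monodromy_minus_1 (p L3)) in *.
  set (rest := fun n => cell_int (q n) (sigma_cell eps)
    + (1 / c1 * cell_int (q n) (tube_cell eps L1)
    + (1 / c2 * cell_int (q n) (tube_cell eps L2)
    + (1 / c3 * cell_int (q n) (tube_cell eps L3)
    + (1 / (c2 * c3) * cell_int (q n) (torus_cell eps L2)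
    + 1 / (c3 * c1) * cell_int (q n) (torus_cell eps L3)))))).
  (* The coefficient 1 / (c1 c2) of the corner torus cancels the two monodromy factors of
     [corner_cell], so [corner] enters with coefficient 1. *)
  assert (E : forall n, chain_int eps p (q n) = corner (p L1) (p L2) (p L3) eps n + rest n).
  { intro n. unfold chain_int, rest. simpl. unfold q at 5. rewrite corner_cell by assumption.
    fold c1 c2 c3.
    assert (c1 <> 0) by apply Hp. assert (c2 <> 0) by apply Hp. assert (c3 <> 0) by apply Hp.
    field. repeat split; assumption. }
  set (K := (K0 + (Cmod (1 / c1) * K1 + (Cmod (1 / c2) * K2 + (Cmod (1 / c3) * K3
    + (Cmod (1 / (c2 * c3)) * K4 + Cmod (1 / (c3 * c1)) * K5)))))%R).
  assert (BR : forall n, (Cmod (rest n) <= K * (1 - eps) ^ n)%R).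
  { intro n.
    assert (T : forall a z k, (Cmod z <= k * (1 - eps) ^ n)%R -> (Cmod (a * z) <= Cmod a * k * (1 - eps) ^ n)%R).
    { intros a z k Hz. rewrite Cmod_mult, Rmult_assoc. apply Rmult_le_compat_l; [apply Cmod_ge_0 | exact Hz]. }
    assert (P : forall z w k l, (Cmod z <= k * (1 - eps) ^ n)%R -> (Cmod w <= l * (1 - eps) ^ n)%R ->
      (Cmod (z + w) <= (k + l) * (1 - eps) ^ n)%R).
    { intros z w k l Hz Hw. eapply Rle_trans; [apply Cmod_triangle|]. lra. }
    unfold rest, K. apply P; [exact (B0 n)|]. apply P; [exact (T _ _ _ (B1 n))|].
    apply P; [exact (T _ _ _ (B2 n))|]. apply P; [exact (T _ _ _ (B3 n))|].
    apply P; [exact (T _ _ _ (B4 n)) | exact (T _ _ _ (B5 n))]. }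
  pose proof (corner_asymptotic (p L1) (p L2) (p L3) eps H1 H2 He) as LC.
  replace (Cgamma (p L1 + 1) * Cgamma (p L2 + 1)) with (Cgamma (p L1 + 1) * Cgamma (p L2 + 1) + 0) by ring.
  apply (clim_ext (fun n => Cexp ((p L1 + p L2 + 2) * RtoC (ln (INR (S n)))) * corner (p L1) (p L2) (p L3) eps (S n)
     + Cexp ((p L1 + p L2 + 2) * RtoC (ln (INR (S n)))) * rest (S n))).
  { intro n. fold (q (S n)). rewrite E. ring. }
  apply clim_plus; [exact LC|].
  apply (clim_le _ 0 (fun n => K * (exp (Re (p L1 + p L2 + 2) * ln (INR (S n))) * (1 - eps) ^ S n))%R).
  - intro n. replace (Cexp ((p L1 + p L2 + 2) * RtoC (ln (INR (S n)))) * rest (S n) - 0)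
      with (Cexp ((p L1 + p L2 + 2) * RtoC (ln (INR (S n)))) * rest (S n)) by ring.
    rewrite Cmod_mult, Cmod_Cexp.
    replace (Re ((p L1 + p L2 + 2) * RtoC (ln (INR (S n))))) with (Re (p L1 + p L2 + 2) * ln (INR (S n)))%R
      by (unfold Re; simpl; ring).
    replace (K * (exp (Re (p L1 + p L2 + 2) * ln (INR (S n))) * (1 - eps) ^ S n))%R
      with (exp (Re (p L1 + p L2 + 2) * ln (INR (S n))) * (K * (1 - eps) ^ S n))%R by ring.
    apply Rmult_le_compat_l; [left; apply exp_pos | apply BR].
  - replace (Finite 0) with (Rbar_mult K 0) by (simpl; f_equal; ring).
    apply is_lim_seq_scal_l. apply exp_ln_pow_lim. lra.
Qed.

(** Raising p_3 by N gives J(p) = (s)_N / (t)_N J(p + N e_3). By [euler_ratio] the quotient grows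
    like Gamma(t) / Gamma(s) N^(s-t), and s - t = p_1 + p_2 + 2 is the power that normalises J in
    [chain_asymptotic]. *)
Lemma chain_gamma_large p : (forall i, monodromy_minus_1 (p i) <> 0) ->
  (0 < Re (p L1))%R -> (0 < Re (p L2))%R -> not_nonpos_int (p L3 + 1) ->
  not_nonpos_int (p L1 + p L2 + p L3 + 3) ->
  chain_int eps p p * Cgamma (p L1 + p L2 + p L3 + 3)
  = Cgamma (p L1 + 1) * Cgamma (p L2 + 1) * Cgamma (p L3 + 1).
Proof.
  intros Hp H1 H2 H3 Hs. set (s := p L1 + p L2 + p L3 + 3) in *. set (t := p L3 + 1) in *.
  pose proof (chain_asymptotic p Hp H1 H2) as LA.
  destruct (Cgamma_spec s Hs) as [Ls Ns]. destruct (Cgamma_spec t H3) as [Lt Nt].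
  assert (Z : clim (fun n => RtoC (/ INR (S n))) 0).
  { split; simpl; [apply inv_INR_lim | apply is_lim_seq_const]. }
  assert (L1' : forall z, clim (fun n => 1 + z * RtoC (/ INR (S n))) 1).
  { intro z. pose proof (clim_plus _ _ _ _ (clim_const 1) (clim_mult _ _ _ _ (clim_const z) Z)) as L.
    now rewrite Cmult_0_r, Cplus_0_r in L. }
  assert (L2' : clim (fun n => / (1 + t * RtoC (/ INR (S n)))) 1).
  { assert (E : / RtoC 1 = 1) by (rewrite <- RtoC_inv by lra; now rewrite Rinv_1).
    pose proof (clim_inv _ _ (L1' t) (RtoC_neq_0 1 R1_neq_R0)) as L. now rewrite E in L. }
  (* Euler's quotient has N + 1 factors in its denominator and the contiguity relation only N; the
     last pair of factors of this sequence compensates for the difference. *)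
  assert (LB : clim (fun n => chain_int eps p p * (euler s (S n) * / euler t (S n))
                   * ((1 + s * RtoC (/ INR (S n))) * / (1 + t * RtoC (/ INR (S n)))))
                 (chain_int eps p p * (Cgamma s * / Cgamma t) * (1 * 1))).
  { apply clim_mult; [|apply clim_mult; [apply L1' | exact L2']].
    apply clim_mult; [apply clim_const|]. apply clim_mult; [|apply clim_inv; [|exact Nt]].
    - apply -> clim_incr_1. exact Ls.
    - apply -> clim_incr_1. exact Lt. }
  assert (F : chain_int eps p p * (Cgamma s * / Cgamma t) * (1 * 1) = Cgamma (p L1 + 1) * Cgamma (p L2 + 1)).
  { apply (clim_unique _ _ _ LB). eapply clim_ext; [|exact LA]. intro n. cbn beta.
    set (N := S n).
    assert (HN : RtoC (INR N) <> 0) by apply RtoC_INR_S_neq_0.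
    pose proof (chain_raise_n eps He p Hp p L3 N (fun i => eq_refl)) as R.
    fold s t in R.
    set (JN := chain_int eps p (shift p L3 (RtoC (INR N)))) in *. set (J := chain_int eps p p) in *.
    assert (P1 : poch s N <> 0) by now apply poch_neq_0.
    assert (P2 : poch t N <> 0) by now apply poch_neq_0.
    assert (P3 : s + RtoC (INR N) <> 0) by apply Hs.
    assert (P4 : t + RtoC (INR N) <> 0) by apply H3.
    replace JN with (poch t N * J / poch s N) by (rewrite R; field; assumption).
    pose proof (euler_ratio s t N Hs H3) as ER.
    change (poch s (S N)) with (poch s N * (s + RtoC (INR N))) in ER.
    change (poch t (S N)) with (poch t N * (t + RtoC (INR N))) in ER.
    assert (Et : euler t N <> 0).
    { unfold euler, Cdiv. apply Cmult_neq_0; [apply Cmult_neq_0; [apply RtoC_fact_neq_0 | apply Cexp_neq_0]|].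
      intro E0. assert (P5 : poch t (S N) <> 0) by now apply poch_neq_0.
      pose proof (Cinv_r _ P5) as E1. rewrite E0, Cmult_0_r in E1. injection E1; lra. }
    set (ex := Cexp ((p L1 + p L2 + 2) * RtoC (ln (INR N)))).
    assert (Ex : Cexp ((t - s) * RtoC (ln (INR N))) = / ex).
    { unfold ex. rewrite <- Cexp_opp. f_equal. unfold t, s. ring. }
    assert (Nex : ex <> 0) by apply Cexp_neq_0.
    rewrite Ex in ER.
    rewrite RtoC_inv by (apply not_0_INR; discriminate).
    assert (Q : poch t N / poch s N = euler s N / euler t N * / ex * ((s + RtoC (INR N)) / (t + RtoC (INR N)))).
    { rewrite <- ER. field. repeat split; assumption. }
    transitivity (ex * J * (poch t N / poch s N)); [field; assumption|].
    rewrite Q. field. repeat split; try assumption; rewrite Cplus_comm; assumption. }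
  replace (chain_int eps p p * Cgamma s) with (chain_int eps p p * (Cgamma s * / Cgamma t) * (1 * 1) * Cgamma t)
    by (field; assumption).
  rewrite F. reflexivity.
Qed.

Lemma chain_int_base p0 p1 p : (forall i, monodromy_minus_1 (p0 i) = monodromy_minus_1 (p1 i)) ->
  chain_int eps p0 p = chain_int eps p1 p.
Proof. intro E. unfold chain_int. simpl. now rewrite !E. Qed.

Definition gamma_formula (p0 p : line -> C) : Prop :=
  chain_int eps p0 p * Cgamma (p L1 + p L2 + p L3 + 3)
  = Cgamma (p L1 + 1) * Cgamma (p L2 + 1) * Cgamma (p L3 + 1).

(* The contiguity relations match Gamma (z + 1) = z Gamma z on the right-hand side. *)
Lemma gamma_formula_lower p0 p a : (forall i, monodromy_minus_1 (p0 i) <> 0) ->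
  same_monodromy p0 p ->
  (forall i, not_nonpos_int (p i + 1)) -> not_nonpos_int (p L1 + p L2 + p L3 + 3) ->
  gamma_formula p0 (shift p a 1) -> gamma_formula p0 p.
Proof.
  intros H0 Hm Hp Hs G. unfold gamma_formula in *.
  pose proof (chain_raise eps He p0 H0 p a Hm) as R.
  pose proof (Cgamma_S _ Hs) as GS. pose proof (Cgamma_S _ (Hp a)) as Ga.
  assert (Na : p a + 1 <> 0).
  { pose proof (Hp a O) as N. change (INR 0) with 0%R in N. now rewrite Cplus_0_r in N. }
  set (s := p L1 + p L2 + p L3 + 3) in *.
  assert (Es : shift p a 1 L1 + shift p a 1 L2 + shift p a 1 L3 + 3 = s + 1)
    by (destruct a; unfold shift, s; simpl; ring).
  rewrite Es, GS in G.
  set (J := chain_int eps p0 p) in *. set (J' := chain_int eps p0 (shift p a 1)) in *.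
  assert (X : (p a + 1) * (J * Cgamma s) = (p a + 1) * (Cgamma (p L1 + 1) * Cgamma (p L2 + 1) * Cgamma (p L3 + 1))).
  { transitivity (((p a + 1) * J) * Cgamma s); [ring|]. rewrite R.
    transitivity (J' * (s * Cgamma s)); [ring|]. rewrite G.
    destruct a; unfold shift; simpl; rewrite Ga; ring. }
  assert (Y : forall k x y : C, k <> 0 -> k * x = k * y -> x = y).
  { intros k x y Hk E. replace x with (/ k * (k * x)) by (field; assumption). rewrite E. field. assumption. }
  exact (Y _ _ _ Na X).
Qed.

Lemma gamma_formula_ext p0 p q : (forall j, p j = q j) -> gamma_formula p0 p -> gamma_formula p0 q.
Proof. intros E G. unfold gamma_formula in *. rewrite <- !E, <- (chain_int_ext eps p0 p q E). exact G. Qed.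

Lemma gamma_formula_lower_n p0 p a n : (forall i, monodromy_minus_1 (p0 i) <> 0) ->
  same_monodromy p0 p ->
  (forall i, not_nonpos_int (p i + 1)) -> not_nonpos_int (p L1 + p L2 + p L3 + 3) ->
  gamma_formula p0 (shift p a (RtoC (INR n))) -> gamma_formula p0 p.
Proof.
  intros H0 Hm Hp Hs. induction n as [|n IH]; intro G.
  - eapply gamma_formula_ext; [|exact G]. intro j. unfold shift. change (INR 0) with 0%R.
    destruct (line_eqb j a); ring.
  - assert (SN : forall z, not_nonpos_int z -> not_nonpos_int (z + RtoC (INR n))).
    { intros z Hz k E. apply (Hz (n + k)%nat). rewrite plus_INR, RtoC_plus, <- E. ring. }
    apply IH. apply (gamma_formula_lower p0 _ a H0).
    + now apply same_monodromy_shift.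
    + intro i. unfold shift. destruct (line_eqb i a); [|apply Hp].
      replace (p i + INR n + 1) with (p i + 1 + INR n) by ring. apply SN, Hp.
    + replace (shift p a (INR n) L1 + shift p a (INR n) L2 + shift p a (INR n) L3 + 3)
        with (p L1 + p L2 + p L3 + 3 + INR n) by (destruct a; unfold shift; simpl; ring).
      apply SN, Hs.
    + eapply gamma_formula_ext; [|exact G]. intro j. rewrite S_INR, RtoC_plus. unfold shift.
      destruct (line_eqb j a); ring.
Qed.

(** A common shift of p_1 and p_2 by some n > |Re p_1| + |Re p_2| reaches the range of
    [chain_gamma_large]; [gamma_formula_lower_n] undoes the two shifts, and [chain_int_base]
    identifies the chains before and after. *)
Theorem chain_gamma p : (forall i, monodromy_minus_1 (p i) <> 0) ->
  (forall i, not_nonpos_int (p i + 1)) -> not_nonpos_int (p L1 + p L2 + p L3 + 3) ->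
  chain_int eps p p * Cgamma (p L1 + p L2 + p L3 + 3)
  = Cgamma (p L1 + 1) * Cgamma (p L2 + 1) * Cgamma (p L3 + 1).
Proof.
  intros Hm Hp Hs.
  destruct (nfloor_ex (Rabs (Re (p L1)) + Rabs (Re (p L2)))) as [m Hm'].
  { pose proof (Rabs_pos (Re (p L1))). pose proof (Rabs_pos (Re (p L2))). lra. }
  set (n := S m).
  assert (HR : (0 < Re (p L1) + INR n)%R /\ (0 < Re (p L2) + INR n)%R).
  { unfold n. rewrite S_INR.
    pose proof (Rabs_pos (Re (p L1))). pose proof (Rabs_pos (Re (p L2))).
    pose proof (Rle_abs (- Re (p L1))). pose proof (Rle_abs (- Re (p L2))).
    rewrite Rabs_Ropp in *. lra. }
  assert (SN : forall z, not_nonpos_int z -> not_nonpos_int (z + RtoC (INR n))).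
  { intros z Hz k E. apply (Hz (n + k)%nat). rewrite plus_INR, RtoC_plus, <- E. ring. }
  change (gamma_formula p p).
  assert (Hp' : forall i, not_nonpos_int (shift p L1 (INR n) i + 1)).
  { intro i. unfold shift. destruct (line_eqb i L1); [|apply Hp].
    replace (p i + INR n + 1) with (p i + 1 + INR n) by ring. apply SN, Hp. }
  assert (Hs' : not_nonpos_int (shift p L1 (INR n) L1 + shift p L1 (INR n) L2 + shift p L1 (INR n) L3 + 3)).
  { replace (shift p L1 (INR n) L1 + shift p L1 (INR n) L2 + shift p L1 (INR n) L3 + 3)
      with (p L1 + p L2 + p L3 + 3 + INR n) by (unfold shift; simpl; ring). apply SN, Hs. }
  apply (gamma_formula_lower_n p p L1 n Hm (fun i => eq_refl) Hp Hs).
  apply (gamma_formula_lower_n p _ L2 n Hm); [now apply same_monodromy_shift | exact Hp' | exact Hs' |].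
  set (q := shift (shift p L1 (INR n)) L2 (INR n)).
  assert (Hq : same_monodromy p q) by now apply same_monodromy_shift, same_monodromy_shift.
  unfold gamma_formula. rewrite (chain_int_base p q q) by (intro i; symmetry; apply Hq).
  apply chain_gamma_large.
  - intro i. rewrite Hq. apply Hm.
  - exact (proj1 HR).
  - exact (proj2 HR).
  - apply (Hp L3).
  - replace (q L1 + q L2 + q L3 + 3) with (p L1 + p L2 + p L3 + 3 + INR n + INR n)
      by (unfold q, shift; simpl; ring).
    apply SN, SN, Hs.
Qed.

(** The shift lowers p_1 by n1 and p_2 by n2 and leaves p_3 = b + b' - a - 2 fixed. One step of
    [chain_raise] on [L1] has the factors p_1 + 1 = -(b + i) and p_1 + p_2 + p_3 + 3 = -(a + i + j),
    and the signs cancel; similarly on [L2]. *)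
Lemma exponents_shift (p0 : line -> C) a b b' (n1 n2 : nat) : (forall i, monodromy_minus_1 (p0 i) <> 0) ->
  same_monodromy p0 (exponents a b b') ->
  poch b n1 * poch b' n2
    * chain_int eps p0 (exponents (a + RtoC (INR (n1 + n2))) (b + RtoC (INR n1)) (b' + RtoC (INR n2)))
  = poch a (n1 + n2) * chain_int eps p0 (exponents a b b').
Proof.
  intros H0 Hm.
  assert (MM : forall p n, monodromy_minus_1 (p - RtoC (INR n)) = monodromy_minus_1 p).
  { intros p n. rewrite <- (monodromy_nat (p - RtoC (INR n)) n). f_equal. ring. }
  assert (HM : forall i j, same_monodromy p0 (exponents (a + RtoC (INR (i + j))) (b + RtoC (INR i)) (b' + RtoC (INR j)))).
  { intros i j k. rewrite <- Hm. destruct k; unfold exponents.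
    - rewrite <- (MM (- b) i). f_equal. ring.
    - rewrite <- (MM (- b') j). f_equal. ring.
    - f_equal. rewrite plus_INR, RtoC_plus. ring. }
  assert (S1 : forall i j, (b + RtoC (INR i)) * chain_int eps p0
       (exponents (a + RtoC (INR (S i + j))) (b + RtoC (INR (S i))) (b' + RtoC (INR j)))
     = (a + RtoC (INR (i + j))) * chain_int eps p0
       (exponents (a + RtoC (INR (i + j))) (b + RtoC (INR i)) (b' + RtoC (INR j)))).
  { intros i j. pose proof (chain_raise eps He p0 H0 _ L1 (HM (S i) j)) as R.
    assert (E1 : chain_int eps p0 (shift (exponents (a + RtoC (INR (S i + j))) (b + RtoC (INR (S i))) (b' + RtoC (INR j))) L1 1)
      = chain_int eps p0 (exponents (a + RtoC (INR (i + j))) (b + RtoC (INR i)) (b' + RtoC (INR j)))).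
    { apply chain_int_ext. intro k. rewrite !plus_INR, S_INR, !RtoC_plus.
      destruct k; unfold shift, exponents; simpl; ring. }
    rewrite E1 in R. clear E1.
    set (X := chain_int eps p0 (exponents (a + RtoC (INR (S i + j))) (b + RtoC (INR (S i))) (b' + RtoC (INR j)))) in *.
    set (Y := chain_int eps p0 (exponents (a + RtoC (INR (i + j))) (b + RtoC (INR i)) (b' + RtoC (INR j)))) in *.
    unfold exponents in R. rewrite !plus_INR, S_INR, !RtoC_plus in *.
    transitivity (- ((- (b + (INR i + 1)) + 1) * X)); [ring|]. rewrite R. ring. }
  assert (S2 : forall i j, (b' + RtoC (INR j)) * chain_int eps p0
       (exponents (a + RtoC (INR (i + S j))) (b + RtoC (INR i)) (b' + RtoC (INR (S j))))
     = (a + RtoC (INR (i + j))) * chain_int eps p0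
       (exponents (a + RtoC (INR (i + j))) (b + RtoC (INR i)) (b' + RtoC (INR j)))).
  { intros i j. pose proof (chain_raise eps He p0 H0 _ L2 (HM i (S j))) as R.
    assert (E1 : chain_int eps p0 (shift (exponents (a + RtoC (INR (i + S j))) (b + RtoC (INR i)) (b' + RtoC (INR (S j)))) L2 1)
      = chain_int eps p0 (exponents (a + RtoC (INR (i + j))) (b + RtoC (INR i)) (b' + RtoC (INR j)))).
    { apply chain_int_ext. intro k. rewrite !plus_INR, S_INR, !RtoC_plus.
      destruct k; unfold shift, exponents; simpl; ring. }
    rewrite E1 in R. clear E1.
    set (X := chain_int eps p0 (exponents (a + RtoC (INR (i + S j))) (b + RtoC (INR i)) (b' + RtoC (INR (S j))))) in *.
    set (Y := chain_int eps p0 (exponents (a + RtoC (INR (i + j))) (b + RtoC (INR i)) (b' + RtoC (INR j)))) in *.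
    unfold exponents in R. rewrite !plus_INR, S_INR, !RtoC_plus in *.
    transitivity (- ((- (b' + (INR j + 1)) + 1) * X)); [ring|]. rewrite R. ring. }
  induction n1 as [|n1 IH].
  - induction n2 as [|n2 IH].
    + simpl. change (INR 0) with 0%R. rewrite !Cmult_1_l. apply chain_int_ext.
      intro k; destruct k; unfold exponents; ring.
    + simpl (0 + S n2)%nat. simpl poch. specialize (S2 O n2). simpl (0 + _)%nat in *.
      transitivity (poch b' n2 * ((b' + INR n2) * chain_int eps p0
        (exponents (a + INR (S n2)) (b + INR 0) (b' + INR (S n2))))); [ring|].
      rewrite S2. simpl poch in IH.
      transitivity ((a + INR n2) * (1 * poch b' n2 * chain_int eps p0
        (exponents (a + INR n2) (b + INR 0) (b' + INR n2)))); [ring|]. rewrite IH. ring.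
  - simpl (S n1 + n2)%nat. simpl poch. specialize (S1 n1 n2). simpl (S n1 + n2)%nat in S1.
    transitivity (poch b n1 * poch b' n2 * ((b + INR n1) * chain_int eps p0
        (exponents (a + INR (S (n1 + n2))) (b + INR (S n1)) (b' + INR n2)))); [ring|].
    rewrite S1.
    transitivity ((a + INR (n1 + n2)) * (poch b n1 * poch b' n2 * chain_int eps p0
        (exponents (a + INR (n1 + n2)) (b + INR n1) (b' + INR n2)))); [ring|]. rewrite IH. ring.
Qed.

End Eval.

(** * The binomial series in two variables *)

(** The values of [sum_n], written directly with the addition of [C] so that [ring] applies. *)
Fixpoint csum (f : nat -> C) (N : nat) : C :=
  match N with O => f O | S n => csum f n + f (S n) end.

Lemma sum_n_csum (f : nat -> C) N : sum_n f N = csum f N.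
Proof. induction N; [now rewrite sum_O | rewrite sum_Sn, IHN; reflexivity]. Qed.

Lemma csum_ext (f g : nat -> C) N : (forall n, (n <= N)%nat -> f n = g n) -> csum f N = csum g N.
Proof.
  induction N; intro E; simpl; [apply E; lia|].
  rewrite IHN by (intros; apply E; lia). now rewrite E by lia.
Qed.

Lemma csum_plus f g N : csum (fun n => f n + g n) N = csum f N + csum g N.
Proof. induction N; simpl; [reflexivity | rewrite IHN; ring]. Qed.

Lemma csum_minus f g N : csum (fun n => f n - g n) N = csum f N - csum g N.
Proof. induction N; simpl; [reflexivity | rewrite IHN; ring]. Qed.

Lemma csum_scal k f N : csum (fun n => k * f n) N = k * csum f N.
Proof. induction N; simpl; [reflexivity | rewrite IHN; ring]. Qed.

Lemma csum_switch (f : nat -> nat -> C) N M :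
  csum (fun i => csum (fun j => f i j) M) N = csum (fun j => csum (fun i => f i j) N) M.
Proof.
  induction N; simpl; [reflexivity|]. rewrite IHN, <- csum_plus. reflexivity.
Qed.

(** The subtracted last term is the origin of the outer-side terms collected in [ray_rest]. *)
Lemma csum_shift (h : nat -> C) N : h O = 0 -> csum h N = csum (fun i => h (S i)) N - h (S N).
Proof. intro H0. induction N; simpl; [rewrite H0; ring | rewrite IHN; ring]. Qed.

Lemma csum_head (f : nat -> C) N : (forall n, f (S n) = 0) -> csum f N = f O.
Proof. intro H. induction N; simpl; [reflexivity | rewrite IHN, H; ring]. Qed.

Lemma csum_geom f c s N : (0 <= c)%R -> (0 < s < 1)%R -> (forall n, (Cmod (f n) <= c * s ^ n)%R) ->
  (Cmod (csum f N) <= c / (1 - s))%R.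
Proof.
  intros Hc Hs Hf.
  assert (A : (Cmod (csum f N) <= c * (1 - s ^ S N) / (1 - s))%R).
  { induction N as [|N IH]; simpl csum.
    - eapply Rle_trans; [apply Hf|]. right. simpl. field. lra.
    - eapply Rle_trans; [apply Cmod_triangle|].
      eapply Rle_trans; [apply Rplus_le_compat; [exact IH | apply Hf]|].
      right. simpl. field. lra. }
  eapply Rle_trans; [exact A|]. unfold Rdiv. apply Rmult_le_compat_r.
  - left. apply Rinv_0_lt_compat. lra.
  - pose proof (pow_le s (S N) ltac:(lra)). nra.
Qed.

Lemma cder_csum (f f' : nat -> R -> C) N t : (forall n, cder (f n) t (f' n t)) ->
  cder (fun t => csum (fun n => f n t) N) t (csum (fun n => f' n t) N).
Proof. intro H. induction N; simpl; [apply H | apply cder_plus; [exact IHN | apply H]]. Qed.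

Fixpoint rpoch (A : R) (n : nat) : R :=
  match n with O => 1 | S m => rpoch A m * (A + INR m) end.

Lemma rpoch_pos A n : (0 < A)%R -> (0 < rpoch A n)%R.
Proof.
  intro HA. induction n; simpl; [lra|]. apply Rmult_lt_0_compat; [assumption|].
  pose proof (pos_INR n). lra.
Qed.

Lemma Cmod_poch_le a A n : (Cmod a <= A)%R -> (Cmod (poch a n) <= rpoch A n)%R.
Proof.
  intro H. induction n; simpl; [rewrite Cmod_1; lra|]. rewrite Cmod_mult.
  apply Rmult_le_compat; try apply Cmod_ge_0; [assumption|].
  eapply Rle_trans; [apply Cmod_triangle|]. rewrite Cmod_R, Rabs_pos_eq by apply pos_INR. lra.
Qed.

(** (A)_n / n! grows more slowly than any geometric sequence: with q = rho / sigma < 1 the quotients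
    (1 + (A - 1)/(n + 1)) q tend to q, so d'Alembert's criterion bounds the terms. *)
Lemma rpoch_geom A rho sigma : (0 < A)%R -> (0 < rho)%R -> (rho < sigma)%R ->
  exists K, (0 <= K)%R /\ forall n, (rpoch A n / INR (fact n) * rho ^ n <= K * sigma ^ n)%R.
Proof.
  intros HA Hr Hs. set (q := (rho / sigma)%R).
  assert (Hq : (0 < q < 1)%R).
  { unfold q. split; [apply Rdiv_lt_0_compat; lra|]. apply (Rmult_lt_reg_r sigma); [lra|].
    unfold Rdiv. rewrite Rmult_assoc, Rinv_l by lra. lra. }
  set (d := fun n => (rpoch A n / INR (fact n) * q ^ n)%R).
  assert (Hd : forall n, (0 < d n)%R).
  { intro n. apply Rmult_lt_0_compat; [|apply pow_lt; lra].
    apply Rdiv_lt_0_compat; [now apply rpoch_pos | apply INR_fact_lt_0]. }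
  assert (S : ex_series (fun n => Rabs (d n))).
  { apply (ex_series_DAlembert d q); [lra | intro n; pose proof (Hd n); lra |].
    apply (is_lim_seq_ext (fun n => (1 + (A - 1) * / INR (S n)) * q)%R).
    - intro n. rewrite Rabs_pos_eq by (left; apply Rdiv_lt_0_compat; apply Hd).
      unfold d. change (fact (S n)) with (S n * fact n)%nat. rewrite mult_INR. simpl rpoch. simpl pow.
      rewrite S_INR. pose proof (pos_INR n). pose proof (INR_fact_lt_0 n). pose proof (rpoch_pos A n HA).
      pose proof (pow_lt q n ltac:(lra)). field. repeat split; lra.
    - replace (Finite q) with (Finite ((1 + (A - 1) * 0) * q)) by (f_equal; ring).
      apply is_lim_seq_mult'; [|apply is_lim_seq_const].
      apply is_lim_seq_plus'; [apply is_lim_seq_const|].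
      apply is_lim_seq_mult'; [apply is_lim_seq_const | apply inv_INR_lim]. }
  apply ex_series_lim_0 in S.
  assert (B : exists K, forall n, (d n <= K)%R).
  { apply is_lim_seq_abs_0 in S. destruct (filterlim_bounded d) as [M HM]; [exists 0%R; exact S|].
    exists M. intro n. eapply Rle_trans; [apply Rle_abs | apply HM]. }
  destruct B as [K HK]. exists K. split; [pose proof (Hd O); pose proof (HK O); lra|].
  intro n. replace (rpoch A n / INR (fact n) * rho ^ n)%R with (d n * sigma ^ n)%R.
  - apply Rmult_le_compat_r; [apply pow_le; lra | apply HK].
  - unfold d. rewrite Rmult_assoc, <- Rpow_mult_distr.
    replace (q * sigma)%R with rho by (unfold q; field; lra). reflexivity.
Qed.

(* By induction, using n f(i,j) = r1 f(i-1,j) + r2 f(i,j-1) for f(i,j) = r1^i r2^j / (i! j!), n = i + j. *)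
Lemma multinomial_le r1 r2 n : (0 <= r1)%R -> (0 <= r2)%R -> forall i j, (i + j = n)%nat ->
  (r1 ^ i / INR (fact i) * (r2 ^ j / INR (fact j)) <= (r1 + r2) ^ n / INR (fact n))%R.
Proof.
  intros H1 H2. induction n as [|n IH]; intros i j Hij.
  - replace i with O by lia. replace j with O by lia.
    change (INR (fact 0)) with 1%R. right. simpl. field.
  - assert (FS : forall k, (INR (fact (S k)) = INR (S k) * INR (fact k))%R).
    { intro k. change (fact (S k)) with (S k * fact k)%nat. apply mult_INR. }
    assert (F0 : forall k, (0 < INR (fact k))%R) by apply INR_fact_lt_0.
    assert (S0 : forall k, (0 < INR (S k))%R) by (intro; apply lt_0_INR; lia).
    assert (P : forall k m, (k + S m = S n)%nat -> (k + m = n)%nat) by lia.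
    assert (A : (INR i * (r1 ^ i / INR (fact i) * (r2 ^ j / INR (fact j)))
                 <= r1 * ((r1 + r2) ^ n / INR (fact n)))%R).
    { destruct i as [|i].
      - change (INR 0) with 0%R. rewrite Rmult_0_l. apply Rmult_le_pos; [assumption|].
        apply Rdiv_le_0_compat; [apply pow_le; lra | apply F0].
      - rewrite FS. replace (INR (S i) * (r1 ^ S i / (INR (S i) * INR (fact i)) * (r2 ^ j / INR (fact j))))%R
          with (r1 * (r1 ^ i / INR (fact i) * (r2 ^ j / INR (fact j))))%R.
        + apply Rmult_le_compat_l; [assumption|]. apply IH. lia.
        + simpl pow. pose proof (F0 i). pose proof (F0 j). pose proof (S0 i). field. repeat split; lra. }
    assert (B : (INR j * (r1 ^ i / INR (fact i) * (r2 ^ j / INR (fact j)))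
                 <= r2 * ((r1 + r2) ^ n / INR (fact n)))%R).
    { destruct j as [|j].
      - change (INR 0) with 0%R. rewrite Rmult_0_l. apply Rmult_le_pos; [assumption|].
        apply Rdiv_le_0_compat; [apply pow_le; lra | apply F0].
      - rewrite FS. replace (INR (S j) * (r1 ^ i / INR (fact i) * (r2 ^ S j / (INR (S j) * INR (fact j)))))%R
          with (r2 * (r1 ^ i / INR (fact i) * (r2 ^ j / INR (fact j))))%R.
        + apply Rmult_le_compat_l; [assumption|]. apply IH. lia.
        + simpl pow. pose proof (F0 i). pose proof (F0 j). pose proof (S0 j). field. repeat split; lra. }
    apply (Rmult_le_reg_l (INR (S n))); [apply S0|].
    rewrite <- Hij at 1. rewrite plus_INR, Rmult_plus_distr_r, FS.
    eapply Rle_trans; [apply Rplus_le_compat; [exact A | exact B]|].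
    right. simpl pow. pose proof (F0 n). pose proof (S0 n). field. split; lra.
Qed.

(** The terms of the expansion of (1 - y1 - y2)^(-a) in powers of y1 and y2. *)
Definition binom_term (a y1 y2 : C) (i j : nat) : C :=
  poch a (i + j) / (RtoC (INR (fact i)) * RtoC (INR (fact j))) * y1 ^ i * y2 ^ j.

(** The constant depends on a, rho and sigma only, which is what makes the later convergence uniform
    on the chain. *)
Lemma binom_term_bound a rho sigma : (0 < rho)%R -> (rho < sigma)%R ->
  exists K, (0 <= K)%R /\ forall r1 r2 i j, (0 <= r1)%R -> (0 <= r2)%R -> (r1 + r2 <= rho)%R ->
    (Cmod (poch a (i + j)) / (INR (fact i) * INR (fact j)) * r1 ^ i * r2 ^ j <= K * sigma ^ (i + j))%R.
Proof.
  intros Hr Hs. pose proof (Cmod_ge_0 a).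
  destruct (rpoch_geom (Cmod a + 1) rho sigma ltac:(lra) Hr Hs) as [K [HK0 HK]].
  exists K. split; [assumption|]. intros r1 r2 i j H1 H2 H12.
  eapply Rle_trans; [|apply HK].
  pose proof (multinomial_le r1 r2 (i + j) H1 H2 i j eq_refl) as M.
  pose proof (Cmod_poch_le a (Cmod a + 1) (i + j) ltac:(lra)) as P.
  pose proof (INR_fact_lt_0 i). pose proof (INR_fact_lt_0 j). pose proof (INR_fact_lt_0 (i + j)).
  replace (Cmod (poch a (i + j)) / (INR (fact i) * INR (fact j)) * r1 ^ i * r2 ^ j)%R
    with (Cmod (poch a (i + j)) * (r1 ^ i / INR (fact i) * (r2 ^ j / INR (fact j))))%R by (field; lra).
  replace (rpoch (Cmod a + 1) (i + j) / INR (fact (i + j)) * rho ^ (i + j))%R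
    with (rpoch (Cmod a + 1) (i + j) * (rho ^ (i + j) / INR (fact (i + j))))%R by (field; lra).
  apply Rmult_le_compat; [apply Cmod_ge_0 | | exact P |].
  - apply Rmult_le_pos; (apply Rdiv_le_0_compat; [now apply pow_le | assumption]).
  - eapply Rle_trans; [exact M|]. apply Rmult_le_compat_r; [left; now apply Rinv_0_lt_compat|].
    apply pow_incr. lra.
Qed.

Lemma Cmod_binom_term a y1 y2 i j :
  Cmod (binom_term a y1 y2 i j)
  = (Cmod (poch a (i + j)) / (INR (fact i) * INR (fact j)) * Cmod y1 ^ i * Cmod y2 ^ j)%R.
Proof.
  unfold binom_term.
  pose proof (INR_fact_lt_0 i). pose proof (INR_fact_lt_0 j).
  rewrite !Cmod_mult, !Cmod_pow, Cmod_div, <- RtoC_mult, Cmod_R, Rabs_pos_eq; [reflexivity | |].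
  - apply Rmult_le_pos; lra.
  - apply Cmult_neq_0; apply RtoC_fact_neq_0.
Qed.

Section DoubleBinomial.
Context (a y1 y2 : C) (N : nat).

Let s := binom_term a y1 y2.
Let s' i j := (a + RtoC (INR (i + j))) * s i j.

Lemma binom_step_1 i j : RtoC (INR (S i)) * s (S i) j = y1 * s' i j.
Proof.
  unfold s', s, binom_term. simpl (S i + j)%nat. simpl poch.
  change (fact (S i)) with (S i * fact i)%nat. rewrite mult_INR, RtoC_mult.
  change (y1 ^ S i) with (y1 * y1 ^ i).
  field. repeat split; try apply RtoC_fact_neq_0. apply RtoC_INR_S_neq_0.
Qed.

Lemma binom_step_2 i j : RtoC (INR (S j)) * s i (S j) = y2 * s' i j.
Proof.
  unfold s', s, binom_term. replace (i + S j)%nat with (S (i + j)) by lia. simpl poch.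
  change (fact (S j)) with (S j * fact j)%nat. rewrite mult_INR, RtoC_mult.
  change (y2 ^ S j) with (y2 * y2 ^ j).
  field. repeat split; try apply RtoC_fact_neq_0. apply RtoC_INR_S_neq_0.
Qed.

Definition ray_sum (t : R) : C := csum (fun i => csum (fun j => s i j * RtoC (t ^ (i + j))) N) N.
Definition ray_dsum (t : R) : C :=
  csum (fun i => csum (fun j => s i j * RtoC (INR (i + j) * t ^ pred (i + j))) N) N.
Definition ray_rest (t : R) : C :=
  y1 * csum (fun j => s' N j * RtoC (t ^ (N + j))) N + y2 * csum (fun i => s' i N * RtoC (t ^ (i + N))) N.

Lemma is_derive_pow_nat (n : nat) (t : R) : is_derive (fun t => t ^ n)%R t (INR n * t ^ pred n)%R.
Proof. eapply is_derive_eq; [apply is_derive_pow, (is_derive_id (K := R_AbsRing))|]. cbn. ring. Qed.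

Lemma cder_ray_sum t : cder ray_sum t (ray_dsum t).
Proof.
  unfold ray_sum, ray_dsum.
  apply (cder_csum (fun i t => csum (fun j => s i j * RtoC (t ^ (i + j))) N)
          (fun i t => csum (fun j => s i j * RtoC (INR (i + j) * t ^ pred (i + j))) N)). intro i.
  apply (cder_csum (fun j t => s i j * RtoC (t ^ (i + j)))
          (fun j t => s i j * RtoC (INR (i + j) * t ^ pred (i + j)))). intro j.
  apply cder_scal, cder_RtoC, is_derive_pow_nat.
Qed.

(* The square partial sum of the series along t |-> (t y1, t y2) satisfies the
   differential equation of (1 - t (y1 + y2))^(-a), up to the terms on the outer
   sides of the square. *)
Lemma ray_ode (t : R) : (1 - t * (y1 + y2)) * ray_dsum t = a * (y1 + y2) * ray_sum t - ray_rest t.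
Proof.
  set (T := csum (fun i => csum (fun j => s' i j * RtoC (t ^ (i + j))) N) N).
  assert (E1 : T = a * ray_sum t + t * ray_dsum t).
  { unfold T, ray_sum, ray_dsum. rewrite <- !csum_scal, <- csum_plus. apply csum_ext. intros i _.
    rewrite <- !csum_scal, <- csum_plus. apply csum_ext. intros j _.
    unfold s'. rewrite RtoC_mult.
    transitivity (a * (s i j * RtoC (t ^ (i + j))) + RtoC (INR (i + j)) * s i j * RtoC (t ^ (i + j))); [ring|].
    replace (RtoC (INR (i + j)) * s i j * RtoC (t ^ (i + j)))
      with (RtoC t * (s i j * (RtoC (INR (i + j)) * RtoC (t ^ pred (i + j))))).
    - ring.
    - destruct (i + j)%nat; [change (INR 0) with 0%R; ring|]. simpl pred. rewrite <- tech_pow_Rmult, RtoC_mult. ring. }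
  assert (E2 : ray_dsum t = (y1 + y2) * T - ray_rest t).
  { assert (D : ray_dsum t =
      csum (fun j => csum (fun i => s i j * RtoC (INR i * t ^ pred (i + j))) N) N
      + csum (fun i => csum (fun j => s i j * RtoC (INR j * t ^ pred (i + j))) N) N).
    { rewrite csum_switch, <- csum_plus. apply csum_ext. intros i _. rewrite <- csum_plus.
      apply csum_ext. intros j _. rewrite plus_INR, !RtoC_mult, RtoC_plus. ring. }
    rewrite D.
    rewrite (csum_ext (fun j => csum (fun i => s i j * RtoC (INR i * t ^ pred (i + j))) N)
      (fun j => y1 * csum (fun i => s' i j * RtoC (t ^ (i + j))) N - y1 * (s' N j * RtoC (t ^ (N + j))))).
    2:{ intros j _. cbv beta.
        rewrite (csum_shift (fun i => s i j * RtoC (INR i * t ^ pred (i + j)))) by (change (INR 0) with 0%R; rewrite Rmult_0_l; ring).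
        assert (K : forall i, s (S i) j * RtoC (INR (S i) * t ^ pred (S i + j)) = y1 * (s' i j * RtoC (t ^ (i + j)))).
        { intro i. simpl pred. rewrite RtoC_mult.
          transitivity ((RtoC (INR (S i)) * s (S i) j) * RtoC (t ^ (i + j))); [ring|].
          rewrite binom_step_1. ring. }
        rewrite K, <- csum_scal. f_equal. apply csum_ext. intros i _. apply K. }
    rewrite (csum_ext (fun i => csum (fun j => s i j * RtoC (INR j * t ^ pred (i + j))) N)
      (fun i => y2 * csum (fun j => s' i j * RtoC (t ^ (i + j))) N - y2 * (s' i N * RtoC (t ^ (i + N))))).
    2:{ intros i _. cbv beta.
        rewrite (csum_shift (fun j => s i j * RtoC (INR j * t ^ pred (i + j)))) by (change (INR 0) with 0%R; rewrite Rmult_0_l; ring).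
        assert (K : forall j, s i (S j) * RtoC (INR (S j) * t ^ pred (i + S j)) = y2 * (s' i j * RtoC (t ^ (i + j)))).
        { intro j. replace (i + S j)%nat with (S (i + j)) by lia. simpl pred. rewrite RtoC_mult.
          transitivity ((RtoC (INR (S j)) * s i (S j)) * RtoC (t ^ (i + j))); [ring|].
          rewrite binom_step_2. ring. }
        rewrite K, <- csum_scal. f_equal. apply csum_ext. intros j _. apply K. }
    rewrite !csum_minus, !csum_scal.
    rewrite (csum_switch (fun j i => s' i j * RtoC (t ^ (i + j)))).
    fold T. unfold ray_rest. ring. }
  transitivity (ray_dsum t - t * (y1 + y2) * ray_dsum t); [ring|].
  rewrite E2 at 1. rewrite E1. ring.
Qed.

Lemma ray_sum_0 : ray_sum 0 = 1.
Proof.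
  unfold ray_sum. rewrite csum_head.
  - rewrite csum_head.
    + unfold s, binom_term. simpl. unfold INR. field.
    + intro j. simpl. rewrite Rmult_0_l. ring.
  - intro i. rewrite (csum_ext _ (fun j => 0 * 0)).
    + rewrite csum_scal. ring.
    + intros j _. simpl. rewrite Rmult_0_l. ring.
Qed.

Lemma ray_sum_1 : ray_sum 1 = double_partial_sum s N.
Proof.
  unfold ray_sum, double_partial_sum. rewrite sum_n_csum. apply csum_ext. intros i _.
  rewrite sum_n_csum. apply csum_ext. intros j _. rewrite pow1. ring.
Qed.

End DoubleBinomial.

Lemma ccont_csum {U : UniformSpace} (f : nat -> U -> C) N p : (forall n, ccont (f n) p) ->
  ccont (fun q => csum (fun n => f n q) N) p.
Proof. intro H. induction N; simpl; [apply H | apply ccont_plus; [exact IHN | apply H]]. Qed.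

Lemma INR_pow_lim (q : R) : (0 < q < 1)%R -> is_lim_seq (fun n => INR (S n) * q ^ S n)%R 0.
Proof.
  intro Hq. eapply is_lim_seq_ext; [|apply (exp_ln_pow_lim 1 q Hq)].
  intro n. cbn beta. rewrite Rmult_1_l, exp_ln; [reflexivity | apply lt_0_INR; lia].
Qed.

(** With Y = y1 + y2, the product g(t) of [ray_sum] and (1 - t Y)^a equals 1 at t = 0, and by
    [ray_ode] its derivative is -(1 - t Y)^(a-1) times [ray_rest]. Hence g(1) - 1 is as small as the
    outer terms, and multiplication by (1 - Y)^(-a) gives the error. *)
Theorem double_binomial (a : C) (rho : R) : (0 < rho < 1)%R ->
  exists tau : nat -> R, is_lim_seq tau 0 /\
    forall y1 y2, (Cmod y1 + Cmod y2 <= rho)%R -> forall N,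
      (Cmod (double_partial_sum (binom_term a y1 y2) N - Cexp (- a * Clog (1 - y1 - y2))) <= tau N)%R.
Proof.
  intro Hr. set (sigma := ((1 + rho) / 2)%R).
  assert (Hs : (rho < sigma < 1)%R) by (unfold sigma; lra).
  destruct (binom_term_bound a rho sigma ltac:(lra) ltac:(lra)) as [K [HK0 HK]].
  set (E0 := exp (Cmod a * (Rabs (ln (1 - rho)) + Rabs (ln 2) + PI))).
  assert (HE0 : (0 < E0)%R) by apply exp_pos.
  (* [E0] bounds (1 - t Y)^a and (1 - Y)^(-a), 1/(1 - rho) bounds 1/|1 - t Y|, and the remaining
     factors bound the two geometric sums of [ray_rest]. *)
  exists (fun N => E0 * E0 * / (1 - rho) * (2 * K / (1 - sigma)) * (INR (S N) * sigma ^ S N))%R.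
  split.
  { replace (Finite 0) with (Rbar_mult (E0 * E0 * / (1 - rho) * (2 * K / (1 - sigma)))%R 0)
      by (simpl; f_equal; ring).
    apply is_lim_seq_scal_l, INR_pow_lim. lra. }
  intros y1 y2 Hy N. set (Y := y1 + y2).
  assert (HY : (Cmod Y <= rho)%R) by (eapply Rle_trans; [apply Cmod_triangle | exact Hy]).
  assert (Hl : forall t, I01 t -> (1 - rho <= Re (1 - t * Y))%R /\ (Cmod (1 - t * Y) <= 2)%R).
  { intros t Ht. pose proof (Cmod_scal_le t Y Ht). pose proof (Re_le_Cmod (t * Y)). split.
    - change (1 - rho <= 1 - Re (t * Y))%R. lra.
    - eapply Rle_trans; [apply Cmod_triangle|]. rewrite Cmod_opp, Cmod_1. lra. }
  set (g := fun t : R => ray_sum a y1 y2 N t * Cexp (a * Clog (1 - t * Y))).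
  set (g' := fun t : R => - (ray_rest a y1 y2 N t * (Cexp (a * Clog (1 - t * Y)) * Cexp (- Clog (1 - t * Y))))).
  assert (Dl : forall t, cder (fun t : R => 1 - t * Y) t (- Y)).
  { intro t. eapply cder_eq.
    - apply (cder_minus (fun _ => RtoC 1)); [apply cder_const|].
      apply (cder_mult RtoC (fun _ => Y)); [apply cder_id | apply cder_const].
    - cbn beta. ring. }
  assert (Dg : forall t, I01 t -> cder g t (g' t)).
  { intros t Ht. destruct (Hl t Ht) as [H1 _]. eapply cder_eq.
    - apply cder_mult; [apply cder_ray_sum|].
      apply (cder_Cexp (fun t : R => a * Clog (1 - t * Y))), cder_scal.
      apply (cder_Clog (fun t : R => 1 - t * Y)); [apply Dl | lra].
    - unfold g'. rewrite Cexp_opp, Cexp_Clog by lra.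
      assert (N0 : 1 - t * Y <> 0) by (apply Re_pos_neq_0; lra).
      assert (R : ray_rest a y1 y2 N t = a * Y * ray_sum a y1 y2 N t - (1 - t * Y) * ray_dsum a y1 y2 N t)
        by (unfold Y; rewrite ray_ode; ring).
      rewrite R. field. assumption. }
  assert (Cg : forall t, I01 t -> ccont g' t).
  { intros t Ht. destruct (Hl t Ht) as [H1 _].
    assert (L : ccont (fun t : R => Clog (1 - t * Y)) t).
    { apply (ccont_Clog (fun t : R => 1 - t * Y)); [eapply cder_ccont, Dl | lra]. }
    assert (P : forall n, continuous (fun t => t ^ n)%R t)
      by (intro n; eapply is_derive_cont, is_derive_pow_nat).
    unfold g'. apply ccont_opp, ccont_mult.
    - unfold ray_rest. apply ccont_plus; (apply ccont_mult; [apply ccont_const|]).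
      + apply (ccont_csum (fun j t => (a + RtoC (INR (N + j))) * binom_term a y1 y2 N j * RtoC (t ^ (N + j)))). intro j.
        apply ccont_mult; [apply ccont_const | apply ccont_RtoC, P].
      + apply (ccont_csum (fun i t => (a + RtoC (INR (i + N))) * binom_term a y1 y2 i N * RtoC (t ^ (i + N)))). intro j.
        apply ccont_mult; [apply ccont_const | apply ccont_RtoC, P].
    - apply ccont_mult; apply ccont_Cexp; [apply ccont_mult; [apply ccont_const | exact L] | apply ccont_opp, L]. }
  assert (I : is_cint g' 0 1 (g 1%R - g 0%R)) by (apply is_cint_derive; [lra | exact Dg | exact Cg]).
  assert (g0 : g 0%R = 1).
  { unfold g. rewrite ray_sum_0. replace (1 - 0%R * Y) with (RtoC 1) by ring.
    rewrite Clog_1, Cmult_0_r, Cexp_0. ring. }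
  assert (Yy : 1 - 1%R * Y = 1 - y1 - y2) by (unfold Y; ring).
  assert (BE : forall b t, (Cmod b = Cmod a)%R -> I01 t -> (Cmod (Cexp (b * Clog (1 - t * Y))) <= E0)%R).
  { intros b t Hb Ht. destruct (Hl t Ht) as [H1 H2]. unfold E0. rewrite <- Hb.
    apply Cmod_Cexp_Clog_le; lra. }
  assert (g1 : double_partial_sum (binom_term a y1 y2) N - Cexp (- a * Clog (1 - y1 - y2))
     = (g 1%R - g 0%R) * Cexp (- a * Clog (1 - y1 - y2))).
  { rewrite g0. unfold g. rewrite ray_sum_1, Yy.
    replace (- a * Clog (1 - y1 - y2)) with (- (a * Clog (1 - y1 - y2))) by ring. rewrite Cexp_opp.
    field. apply Cexp_neq_0. }
  set (bN := ((2 * K / (1 - sigma)) * (INR (S N) * sigma ^ S N))%R).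
  assert (HbN : (0 <= bN)%R).
  { unfold bN. pose proof (pos_INR (S N)). pose proof (pow_le sigma (S N) ltac:(lra)).
    apply Rmult_le_pos; [apply Rdiv_le_0_compat; lra | now apply Rmult_le_pos]. }
  assert (BR : forall t, I01 t -> (Cmod (ray_rest a y1 y2 N t) <= bN)%R).
  { intros t Ht.
    assert (HT : forall i j, (Cmod (binom_term a y1 y2 i j) <= K * sigma ^ (i + j))%R).
    { intros i j. rewrite Cmod_binom_term. apply HK; try apply Cmod_ge_0. exact Hy. }
    assert (Ct : forall n, (Cmod (RtoC (t ^ n)) <= 1)%R).
    { intro n. rewrite Cmod_R, Rabs_pos_eq by (apply pow_le; lra).
      apply Rle_trans with (1 ^ n)%R; [apply pow_incr; lra | rewrite pow1; lra]. }
    assert (Q : (bN = INR (S N) * K * sigma ^ S N / (1 - sigma) + INR (S N) * K * sigma ^ S N / (1 - sigma))%R)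
      by (unfold bN; field; lra).
    assert (Hc : (0 <= INR (S N) * K * sigma ^ S N)%R).
    { pose proof (pos_INR (S N)). pose proof (pow_le sigma (S N) ltac:(lra)).
      apply Rmult_le_pos; [now apply Rmult_le_pos | assumption]. }
    rewrite Q. eapply Rle_trans; [apply Cmod_triangle|].
    unfold ray_rest. rewrite <- !csum_scal. apply Rplus_le_compat.
    - apply csum_geom; [exact Hc | lra |]. intro j.
      replace (y1 * ((a + INR (N + j)) * binom_term a y1 y2 N j * (t ^ (N + j))%R))
        with (RtoC (INR (S N)) * binom_term a y1 y2 (S N) j * RtoC (t ^ (N + j))).
      2:{ rewrite binom_step_1. ring. }
      rewrite !Cmod_mult, Cmod_R, Rabs_pos_eq by apply pos_INR.
      replace (INR (S N) * K * sigma ^ S N * sigma ^ j)%R with (INR (S N) * (K * sigma ^ (S N + j)) * 1)%R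
        by (rewrite pow_add; ring).
      apply Rmult_le_compat; [apply Rmult_le_pos; [apply pos_INR | apply Cmod_ge_0] | apply Cmod_ge_0 | | apply Ct].
      apply Rmult_le_compat_l; [apply pos_INR | apply HT].
    - apply csum_geom; [exact Hc | lra |]. intro i.
      replace (y2 * ((a + INR (i + N)) * binom_term a y1 y2 i N * (t ^ (i + N))%R))
        with (RtoC (INR (S N)) * binom_term a y1 y2 i (S N) * RtoC (t ^ (i + N))).
      2:{ rewrite binom_step_2. ring. }
      rewrite !Cmod_mult, Cmod_R, Rabs_pos_eq by apply pos_INR.
      replace (INR (S N) * K * sigma ^ S N * sigma ^ i)%R with (INR (S N) * (K * sigma ^ (i + S N)) * 1)%R
        by (rewrite pow_add; ring).
      apply Rmult_le_compat; [apply Rmult_le_pos; [apply pos_INR | apply Cmod_ge_0] | apply Cmod_ge_0 | | apply Ct].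
      apply Rmult_le_compat_l; [apply pos_INR | apply HT]. }
  rewrite g1, Cmod_mult.
  assert (B1 : (Cmod (g 1%R - g 0%R) <= (1 - 0) * (bN * (E0 * / (1 - rho))))%R).
  { eapply is_cint_norm_const; [lra | | exact I]. intros t Ht. unfold g'.
    rewrite Cmod_opp, !Cmod_mult. destruct (Hl t Ht) as [H1 H2].
    assert (B2 : (Cmod (Cexp (- Clog (1 - t * Y))) <= / (1 - rho))%R).
    { assert (N0 : 1 - t * Y <> 0) by (apply Re_pos_neq_0; lra).
      rewrite Cexp_opp, Cexp_Clog, Cmod_inv by (lra || assumption).
      apply Rinv_le_contravar; [lra|]. pose proof (Re_le_Cmod (1 - t * Y)). lra. }
    apply Rmult_le_compat; [apply Cmod_ge_0 | apply Rmult_le_pos; apply Cmod_ge_0 | now apply BR |].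
    apply Rmult_le_compat; try apply Cmod_ge_0; [now apply BE | exact B2]. }
  assert (B3 : (Cmod (Cexp (- a * Clog (1 - y1 - y2))) <= E0)%R).
  { rewrite <- Yy. apply BE; [apply Cmod_opp | lra]. }
  eapply Rle_trans; [apply Rmult_le_compat; [apply Cmod_ge_0 | apply Cmod_ge_0 | exact B1 | exact B3]|].
  right. unfold bN. ring.
Qed.

(** * Fourfold integrals and uniform limits *)

(** Both integrability of the limit and the rate of convergence are extracted, so that the statement
    can be iterated over nested integrals. *)
Lemma is_cint_unif_limit (g : nat -> R -> C) (I : nat -> C) (h : R -> C) (e : nat -> R) :
  (forall n, is_cint (g n) 0 1 (I n)) -> is_lim_seq e 0 ->
  (forall n x, I01 x -> (Cmod (g n x - h x) <= e n)%R) ->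
  is_cint h 0 1 (cint h 0 1) /\ forall n, (Cmod (I n - cint h 0 1) <= e n)%R.
Proof.
  intros HI He Hgh.
  (* The limit theorem for integrals asks for uniform convergence on the whole line; clamping the
     argument reduces it to [0, 1]. *)
  set (tr := fun (f : R -> C) x => f (clamp 0 1 x)).
  assert (T : forall f l, is_cint f 0 1 l -> is_cint (tr f) 0 1 l).
  { intros f l. apply is_cint_ext; [lra|]. intros x Hx. unfold tr. now rewrite clamp_id by lra. }
  assert (T' : forall f l, is_cint (tr f) 0 1 l -> is_cint f 0 1 l).
  { intros f l. apply is_cint_ext; [lra|]. intros x Hx. unfold tr. now rewrite clamp_id by lra. }
  destruct (filterlim_RInt (V := C_R_CompleteNormedModule) (fun n => tr (g n)) 0 1 eventually _ (tr h) I) as [If [_ HIf]].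
  { intro n. apply T, HI. }
  { apply (filterlim_locally (U := fct_UniformSpace R C_R_CompleteNormedModule)). intros [d Hd].
    apply is_lim_seq_spec in He. destruct (He (mkposreal d Hd)) as [N HN]. exists N. intros n Hn.
    specialize (HN n Hn). simpl in HN. rewrite Rminus_0_r in HN. pose proof (Rle_abs (e n)).
    intro x. pose proof (Hgh n (clamp 0 1 x) (clamp_in 0 1 x ltac:(lra))) as B.
    change (tr h x) with (h (clamp 0 1 x)). change (tr (g n) x) with (g n (clamp 0 1 x)).
    split.
    - change (Rabs (Re (g n (clamp 0 1 x) - h (clamp 0 1 x))) < d)%R.
      eapply Rle_lt_trans; [apply re_le_Cmod|]. lra.
    - change (Rabs (Im (g n (clamp 0 1 x) - h (clamp 0 1 x))) < d)%R.
      eapply Rle_lt_trans; [apply im_le_Cmod|]. lra. }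
  assert (H : is_cint h 0 1 (cint h 0 1)) by (eapply is_cint_cint, T'; exact HIf).
  split; [exact H|]. intro n.
  replace (e n) with ((1 - 0) * e n)%R by ring.
  eapply is_cint_norm_const; [lra | | exact (is_cint_minus _ _ _ _ _ _ (HI n) H)].
  intros x Hx. now apply Hgh.
Qed.

(** The inner integrals are recorded as functions, so that integrability at each of the four levels
    is part of the datum and passes to sums and multiples. *)
Definition nint4 (f : R -> R -> R -> R -> C) (l : C) : Prop :=
  exists f3 f2 f1,
    (forall x y z, I01 x -> I01 y -> I01 z -> is_cint (f x y z) 0 1 (f3 x y z)) /\
    (forall x y, I01 x -> I01 y -> is_cint (f3 x y) 0 1 (f2 x y)) /\
    (forall x, I01 x -> is_cint (f2 x) 0 1 (f1 x)) /\ is_cint f1 0 1 l.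

(** [CInt] is [cint] over [0, 1], so [cell_integral] unfolds to an integral of this shape. *)
Definition cint4 (f : R -> R -> R -> R -> C) : C :=
  cint (fun x => cint (fun y => cint (fun z => cint (f x y z) 0 1) 0 1) 0 1) 0 1.

Lemma nint4_plus f g l m : nint4 f l -> nint4 g m ->
  nint4 (fun x y z t => f x y z t + g x y z t) (l + m).
Proof.
  intros (f3 & f2 & f1 & A & B & D & E) (g3 & g2 & g1 & A' & B' & D' & E').
  exists (fun x y z => f3 x y z + g3 x y z), (fun x y => f2 x y + g2 x y), (fun x => f1 x + g1 x).
  repeat split; intros; apply is_cint_plus; auto.
Qed.

Lemma nint4_scal k f l : nint4 f l -> nint4 (fun x y z t => k * f x y z t) (k * l).
Proof.
  intros (f3 & f2 & f1 & A & B & D & E).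
  exists (fun x y z => k * f3 x y z), (fun x y => k * f2 x y), (fun x => k * f1 x).
  repeat split; intros; apply is_cint_scal; auto.
Qed.

Lemma nint4_csum (f : nat -> R -> R -> R -> R -> C) l N : (forall n, nint4 (f n) (l n)) ->
  nint4 (fun x y z t => csum (fun n => f n x y z t) N) (csum l N).
Proof. intro H. induction N; simpl; [apply H | now apply nint4_plus]. Qed.

Lemma nint4_product g h : ccont2 g 0 1 0 1 -> ccont2 h 0 1 0 1 ->
  nint4 (fun x y z t => g x y * h z t)
    (cint (fun x => cint (g x) 0 1) 0 1 * cint (fun z => cint (h z) 0 1) 0 1).
Proof.
  intros Hg Hh. set (Ih := cint (fun z => cint (h z) 0 1) 0 1).
  exists (fun x y z => g x y * cint (h z) 0 1), (fun x y => g x y * Ih), (fun x => cint (g x) 0 1 * Ih).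
  assert (S : forall f k l a b, is_cint f a b l -> is_cint (fun t => f t * k) a b (l * k)).
  { intros f k l a b Hf. rewrite Cmult_comm.
    pose proof (is_cint_scal k _ _ _ _ Hf) as A. revert A. unfold is_cint.
    apply (is_RInt_ext (V := C_R_NormedModule)). intros t _. apply Cmult_comm. }
  repeat split.
  - intros x y z Hx Hy Hz. apply is_cint_scal, cint_correct; [lra|].
    intros t Ht. now apply (ccont2_slice h 0 1 0 1).
  - intros x y Hx Hy. apply is_cint_scal, ccont2_cint; (lra || assumption).
  - intros x Hx. apply S, cint_correct; [lra|]. intros t Ht. now apply (ccont2_slice g 0 1 0 1).
  - apply S, ccont2_cint; (lra || assumption).
Qed.

(** [is_cint_unif_limit] is applied four times, from the innermost integral outwards. Over intervals
    of length 1 the error bound e n is handed on unchanged. *)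
Lemma nint4_limit (f : nat -> R -> R -> R -> R -> C) (l : nat -> C) h (e : nat -> R) :
  (forall n, nint4 (f n) (l n)) -> is_lim_seq e 0 ->
  (forall n x y z t, I01 x -> I01 y -> I01 z -> I01 t -> (Cmod (f n x y z t - h x y z t) <= e n)%R) ->
  clim l (cint4 h).
Proof.
  intros Hf He Hh.
  assert (L3 : forall x y z, I01 x -> I01 y -> I01 z ->
    forall n, (Cmod (cint (f n x y z) 0 1 - cint (h x y z) 0 1) <= e n)%R).
  { intros x y z Hx Hy Hz.
    apply (is_cint_unif_limit (fun n => f n x y z) (fun n => cint (f n x y z) 0 1) (h x y z) e); [|assumption|].
    - intro n. destruct (Hf n) as (f3 & f2 & f1 & A & _). eapply is_cint_cint. now apply A.
    - intros n t Ht. now apply Hh. }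
  assert (I2 : forall n x y, I01 x -> I01 y ->
     is_cint (fun z => cint (f n x y z) 0 1) 0 1 (cint (fun z => cint (f n x y z) 0 1) 0 1)).
  { intros n x y Hx Hy. destruct (Hf n) as (f3 & f2 & f1 & A & B & _). eapply is_cint_cint.
    eapply is_cint_ext; [lra | | exact (B x y Hx Hy)]. intros z Hz. symmetry. apply is_cint_unique, A; try assumption.
    lra. }
  assert (L2 : forall x y, I01 x -> I01 y ->
    forall n, (Cmod (cint (fun z => cint (f n x y z) 0 1) 0 1 - cint (fun z => cint (h x y z) 0 1) 0 1) <= e n)%R).
  { intros x y Hx Hy.
    apply (is_cint_unif_limit (fun n z => cint (f n x y z) 0 1) _ (fun z => cint (h x y z) 0 1) e); [|assumption|].
    - intro n. now apply I2.
    - intros n z Hz. now apply L3. }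
  assert (I1 : forall n x, I01 x ->
     is_cint (fun y => cint (fun z => cint (f n x y z) 0 1) 0 1) 0 1
       (cint (fun y => cint (fun z => cint (f n x y z) 0 1) 0 1) 0 1)).
  { intros n x Hx. destruct (Hf n) as (f3 & f2 & f1 & A & B & D & _). eapply is_cint_cint.
    eapply is_cint_ext; [lra | | exact (D x Hx)]. intros y Hy. symmetry. apply is_cint_unique.
    assert (Hy' : I01 y) by (lra).
    eapply is_cint_ext; [lra | | exact (B x y Hx Hy')]. intros z Hz. symmetry. apply is_cint_unique, A; try assumption.
    lra. }
  assert (L1' : forall x, I01 x -> forall n,
    (Cmod (cint (fun y => cint (fun z => cint (f n x y z) 0 1) 0 1) 0 1
           - cint (fun y => cint (fun z => cint (h x y z) 0 1) 0 1) 0 1) <= e n)%R).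
  { intros x Hx.
    apply (is_cint_unif_limit (fun n y => cint (fun z => cint (f n x y z) 0 1) 0 1) _
             (fun y => cint (fun z => cint (h x y z) 0 1) 0 1) e); [|assumption|].
    - intro n. now apply I1.
    - intros n y Hy. now apply L2. }
  assert (I0 : forall n, is_cint (fun x => cint (fun y => cint (fun z => cint (f n x y z) 0 1) 0 1) 0 1) 0 1 (l n)).
  { intros n. destruct (Hf n) as (f3 & f2 & f1 & A & B & D & E).
    eapply is_cint_ext; [lra | | exact E]. intros x Hx. symmetry. apply is_cint_unique.
    assert (Hx' : I01 x) by (lra).
    eapply is_cint_ext; [lra | | exact (D x Hx')]. intros y Hy. symmetry. apply is_cint_unique.
    assert (Hy' : I01 y) by (lra).
    eapply is_cint_ext; [lra | | exact (B x y Hx' Hy')]. intros z Hz. symmetry. apply is_cint_unique, A; try assumption.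
    lra. }
  apply (clim_le _ _ e); [|assumption].
  apply (is_cint_unif_limit (fun n x => cint (fun y => cint (fun z => cint (f n x y z) 0 1) 0 1) 0 1) l
             (fun x => cint (fun y => cint (fun z => cint (h x y z) 0 1) 0 1) 0 1) e I0 He).
  intros n x Hx. now apply L1'.
Qed.

Lemma clim_Csum {T} (f : T -> nat -> C) (g : T -> C) l : (forall x, In x l -> clim (f x) (g x)) ->
  clim (fun n => Csum (fun x => f x n) l) (Csum g l).
Proof.
  induction l as [|x l IH]; intro H; simpl; [apply clim_const|].
  apply clim_plus; [apply H; now left | apply IH; intros; apply H; now right].
Qed.

(** * The support of the regularization *)

Section Support.
Context (eps : R).
Hypothesis (He : (0 < eps < 1 / 3)%R).

Lemma reg_form_ge p k c : In (k, c) (regularization p eps) -> forall u v j, I01 u -> I01 v ->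
  (eps <= Cmod (form (c u v) j))%R.
Proof.
  intros Hc u v j Hu Hv.
  destruct (reg_cells eps p k c Hc) as [->|[[i ->]|[i ->]]].
  - eapply Rle_trans; [|apply Re_le_Cmod]. now apply sigma_Re.
  - destruct (line_eqb j i) eqn:E.
    + simpl. unfold point_at. rewrite E. rewrite Cmod_circle; lra.
    + eapply Rle_trans; [|apply Re_le_Cmod]. now apply tube_Re.
  - destruct (line_eqb j i) eqn:E; [|destruct (line_eqb j (next i)) eqn:E'].
    + simpl. unfold point_at. rewrite E. rewrite Cmod_circle; lra.
    + simpl. unfold point_at. rewrite E, E'. rewrite Cmod_circle; lra.
    + eapply Rle_trans; [|apply Re_le_Cmod]. now apply torus_Re.
Qed.

Lemma support_ge p s t : in_support (regularization p eps) s t -> (eps <= Cmod s)%R /\ (eps <= Cmod t)%R.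
Proof.
  intros (k & c & u & v & Hc & Hu & Hv & -> & ->). split; now apply (reg_form_ge p k c).
Qed.

Lemma support_torus p u v : I01 u -> I01 v ->
  in_support (regularization p eps) (circle eps u) (circle eps v).
Proof.
  intros Hu Hv. do 4 eexists. split; [|split; [exact Hu | split; [exact Hv | split]]].
  - unfold regularization. simpl. do 4 right. left. reflexivity.
  - reflexivity.
  - reflexivity.
Qed.

Lemma wt_exponents_shift p k c a b b' i j u v : In (k, c) (regularization p eps) -> I01 u -> I01 v ->
  wt (exponents (a + RtoC (INR (i + j))) (b + RtoC (INR i)) (b' + RtoC (INR j))) (c u v)
  = wt (exponents a b b') (c u v) * (/ form (c u v) L1) ^ i * (/ form (c u v) L2) ^ j.
Proof.
  intros Hc Hu Hv.
  destruct (reg_cell_param eps He p k c Hc) as (l & z & w & zu & wu & wv & wuv & H).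
  assert (P : forall k n, (/ form (c u v) k) ^ n = Cexp (- (RtoC (INR n) * branch (c u v) k))).
  { intros m n. rewrite <- (pc_exp H u v m) by assumption. rewrite <- Cexp_opp.
    induction n as [|n IH].
    - simpl. change (INR 0) with 0%R. rewrite Cmult_0_l. replace (- RtoC 0) with (RtoC 0) by ring. now rewrite Cexp_0.
    - change (Cexp (- branch (c u v) m) ^ S n) with (Cexp (- branch (c u v) m) * Cexp (- branch (c u v) m) ^ n).
      rewrite IH, <- Cexp_plus. f_equal. rewrite S_INR, RtoC_plus. ring. }
  rewrite !P. unfold wt. rewrite <- !Cexp_plus. f_equal. unfold exponents. rewrite plus_INR, RtoC_plus. ring.
Qed.

(** The shifted weight contains l_1^(-i) l_2^(-j), and |l_1|, |l_2| >= eps on the chain. Through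
    [F_term_chain] this bounds the terms of the hypergeometric series. *)
Lemma chain_int_bound p0 a b b' : exists M, (0 <= M)%R /\ forall i j,
  (Cmod (chain_int eps p0 (exponents (a + RtoC (INR (i + j))) (b + RtoC (INR i)) (b' + RtoC (INR j))))
   <= M * (/ eps) ^ (i + j))%R.
Proof.
  unfold chain_int.
  (* Sublists are allowed in order to make induction on the list of cells possible. *)
  assert (G : forall l, incl l (regularization p0 eps) -> exists M, (0 <= M)%R /\ forall i j,
    (Cmod (Csum (fun kc => (fst kc * cell_int (exponents (a + RtoC (INR (i + j))) (b + RtoC (INR i)) (b' + RtoC (INR j))) (snd kc))%C) l)
     <= M * (/ eps) ^ (i + j))%R).
  2:{ apply G. apply incl_refl. }
  assert (He' : (0 < / eps)%R) by (apply Rinv_0_lt_compat; lra).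
  induction l as [|[k c] l IH]; intro Hl.
  - exists 0%R. split; [lra|]. intros i j. simpl. rewrite Cmod_0, Rmult_0_l. lra.
  - destruct IH as [M [HM0 HM]]; [intros x Hx; apply Hl; now right|].
    assert (Hc : In (k, c) (regularization p0 eps)) by (apply Hl; now left).
    destruct (reg_cell_param eps He p0 k c Hc) as (m & z & w & zu & wu & wv & wuv & H).
    destruct (ccont2_bounded _ (pc_cont_integrand H (exponents a b b'))) as [K HK].
    assert (HK0 : (0 <= K)%R) by (eapply Rle_trans; [apply Cmod_ge_0 | apply (HK 0%R 0%R); lra]).
    exists (Cmod k * K + M)%R. split; [pose proof (Cmod_ge_0 k); nra|].
    intros i j. simpl. eapply Rle_trans; [apply Cmod_triangle|].
    rewrite Rmult_plus_distr_r. apply Rplus_le_compat; [|apply HM].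
    rewrite Cmod_mult, Rmult_assoc. apply Rmult_le_compat_l; [apply Cmod_ge_0|].
    set (q := exponents (a + RtoC (INR (i + j))) (b + RtoC (INR i)) (b' + RtoC (INR j))).
    assert (B : forall u v, I01 u -> I01 v ->
      (Cmod (wt q (c u v) * jacobian c u v) <= K * (/ eps) ^ (i + j))%R).
    { intros u v Hu Hv. unfold q. rewrite (wt_exponents_shift p0 k c a b b' i j u v Hc Hu Hv).
      assert (F : forall n m, (Cmod ((/ form (c u v) n) ^ m) <= (/ eps) ^ m)%R).
      { intros n r. pose proof (reg_form_ge p0 k c Hc u v n Hu Hv).
        assert (form (c u v) n <> 0) by (apply Cmod_gt_0; lra).
        rewrite Cmod_pow, Cmod_inv by assumption. apply pow_incr. split.
        - left. apply Rinv_0_lt_compat. lra.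
        - apply Rinv_le_contravar; lra. }
      replace (wt (exponents a b b') (c u v) * (/ form (c u v) L1) ^ i * (/ form (c u v) L2) ^ j * jacobian c u v)
        with (wt (exponents a b b') (c u v) * jacobian c u v * ((/ form (c u v) L1) ^ i * (/ form (c u v) L2) ^ j)) by ring.
      rewrite (Cmod_mult (wt _ _ * _)), (Cmod_mult (_ ^ i)), pow_add.
      apply Rmult_le_compat; [apply Cmod_ge_0 | apply Rmult_le_pos; apply Cmod_ge_0 | now apply HK |].
      apply Rmult_le_compat; try apply Cmod_ge_0; apply F. }
    replace (K * (/ eps) ^ (i + j))%R with ((1 - 0) * (K * (/ eps) ^ (i + j)))%R by ring.
    eapply is_cint_norm_const; [lra | | exact (ccont2_cint _ 0 1 0 1 ltac:(lra) ltac:(lra)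
      (pc_cont_integrand H q))].
    intros u Hu. cbn beta.
    replace (K * (/ eps) ^ (i + j))%R with ((1 - 0) * (K * (/ eps) ^ (i + j)))%R by ring.
    eapply is_cint_norm_const; [lra | | apply cint_correct; [lra|]].
    + intros v Hv. exact (B u v Hu Hv).
    + intros v Hv. exact (ccont2_slice _ 0 1 0 1 _ _ (pc_cont_integrand H q) Hu Hv).
Qed.

End Support.

(** Provides torus points with the phases of x_1 and x_2, at which both quotients x_1/(t_1 t_2) and
    x_2/(t_3 t_4) are nonnegative. *)
Lemma polar (z : C) : exists u, I01 u /\ circle (Cmod z) u = z.
Proof.
  destruct (Ceq_dec z 0) as [->|Hz].
  { exists 0%R. split; [lra|]. unfold circle. rewrite Cmod_0. ring. }
  destruct z as [x y]. apply Cmod_gt_0 in Hz. set (r := Cmod (x, y)) in *.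
  assert (Hr : (r * r = x * x + y * y)%R).
  { pose proof (Cmod2_alt (x, y)) as E. fold r in E. unfold Re, Im in E. simpl in E. lra. }
  assert (Hx : (-1 <= x / r <= 1)%R).
  { assert (- r <= x <= r)%R by (split; nra).
    split; apply (Rmult_le_reg_r r); try assumption; unfold Rdiv; rewrite Rmult_assoc, Rinv_l by lra; lra. }
  assert (Hs : sin (acos (x / r)) = (Rabs y / r)%R).
  { rewrite sin_acos by assumption.
    replace (1 - Rsqr (x / r))%R with (Rsqr (Rabs y / r)).
    - apply sqrt_Rsqr. apply Rdiv_le_0_compat; [apply Rabs_pos | assumption].
    - rewrite !Rsqr_div', <- Rsqr_abs. unfold Rsqr. rewrite Hr. field. nra. }
  pose proof (acos_bound (x / r)) as Hb. pose proof PI_RGT_0 as HPI.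
  assert (C : forall th, (0 <= th <= 2 * PI)%R -> cos th = (x / r)%R -> sin th = (y / r)%R ->
    exists u, I01 u /\ circle r u = (x, y)).
  { intros th Hth Hc Hsn. exists (th / (2 * PI))%R. split.
    - split; [apply Rdiv_le_0_compat; lra|]. apply (Rmult_le_reg_r (2 * PI)); [lra|].
      unfold Rdiv. rewrite Rmult_assoc, Rinv_l by lra. lra.
    - unfold circle. unfold Cexp. rewrite Re_2PIu, Im_2PIu, exp_0.
      replace (2 * PI * (th / (2 * PI)))%R with th by (field; lra). rewrite Hc, Hsn.
      apply C_eq; unfold Re, Im; simpl; field; lra. }
  destruct (Rle_dec 0 y).
  - apply (C (acos (x / r))); [lra | now apply cos_acos | rewrite Hs, Rabs_pos_eq by assumption; reflexivity].
  - apply (C (2 * PI - acos (x / r))%R); [lra | |].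
    + rewrite <- (cos_acos (x / r)) at 2 by assumption.
      rewrite cos_minus, cos_2PI, sin_2PI. ring.
    + rewrite sin_minus, cos_2PI, sin_2PI, Hs, Rabs_left by lra. field. lra.
Qed.

(** * The integral representation *)

(** If exp(2 pi i p) = 1, its modulus forces Im p = 0, and cos(2 pi Re p) = 1 forces sin(pi Re p) =
    0, so that p is an integer. *)
Lemma monodromy_neq_0 (p : C) : ~ is_int p -> monodromy_minus_1 p <> 0.
Proof.
  intros Hp E. apply Hp. unfold monodromy_minus_1 in E.
  assert (E1 : Cexp (2 * PI * Ci * p) = 1).
  { replace (Cexp (2 * PI * Ci * p)) with (Cexp (2 * PI * Ci * p) - 1 + 1) by ring. rewrite E. ring. }
  assert (ER : Re (2 * PI * Ci * p) = (- (2 * PI) * Im p)%R) by (unfold Re, Im; simpl; ring).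
  assert (EI : Im (2 * PI * Ci * p) = (2 * (PI * Re p))%R) by (unfold Re, Im; simpl; ring).
  pose proof PI_RGT_0 as HPI.
  assert (M : exp (Re (2 * PI * Ci * p)) = 1%R) by (rewrite <- Cmod_Cexp, E1; apply Cmod_1).
  assert (I0 : Im p = 0%R).
  { rewrite <- exp_0 in M. apply exp_inv in M. rewrite ER in M. nra. }
  assert (C1 : cos (2 * (PI * Re p)) = 1%R).
  { pose proof (f_equal Re E1) as C. unfold Cexp in C. rewrite M, EI in C. unfold Re in *; simpl in C. lra. }
  rewrite cos_2a_sin in C1.
  destruct (sin_eq_0_0 (PI * Re p)) as [k Hk]; [nra|].
  exists k. apply C_eq; simpl; [|exact I0].
  apply (Rmult_eq_reg_l PI); [rewrite Hk; ring | lra].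
Qed.

Lemma Cpow_div_mult (x y z : C) n : y <> 0 -> z <> 0 -> (x / (y * z)) ^ n = x ^ n * (/ y) ^ n * (/ z) ^ n.
Proof.
  intros Hy Hz. induction n as [|n IH]; [simpl; ring|].
  change ((x / (y * z)) ^ S n) with (x / (y * z) * (x / (y * z)) ^ n). rewrite IH.
  change (x ^ S n) with (x * x ^ n). change ((/ y) ^ S n) with (/ y * (/ y) ^ n).
  change ((/ z) ^ S n) with (/ z * (/ z) ^ n). field. split; assumption.
Qed.

Lemma poch_1 n : poch 1 n = RtoC (INR (fact n)).
Proof.
  induction n as [|n IH]; [reflexivity|]. simpl poch. rewrite IH.
  change (fact (S n)) with (S n * fact n)%nat. rewrite mult_INR, RtoC_mult, S_INR, RtoC_plus. ring.
Qed.

Lemma not_int_not_nonpos (b : C) : ~ is_int b -> not_nonpos_int b.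
Proof.
  intros H n E. apply H. exists (- Z.of_nat n)%Z. rewrite opp_IZR, <- INR_IZR_INZ, RtoC_opp.
  replace b with (b + INR n - INR n) by ring. rewrite E. ring.
Qed.

Lemma not_int_opp_plus (b : C) (k : Z) : ~ is_int b -> ~ is_int (RtoC (IZR k) - b).
Proof.
  intros H [n E]. apply H. exists (k - n)%Z. rewrite minus_IZR, RtoC_minus, <- E. ring.
Qed.

Lemma not_int_plus (b : C) (k : Z) : ~ is_int b -> ~ is_int (b + RtoC (IZR k)).
Proof.
  intros H [n E]. apply H. exists (n - k)%Z. rewrite minus_IZR, RtoC_minus, <- E. ring.
Qed.

Lemma exponents_not_int a b b' : ~ is_int b -> ~ is_int b' -> ~ is_int (b + b' - a) ->
  forall i, ~ is_int (exponents a b b' i).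
Proof.
  intros Hb Hb' Ha i. destruct i; unfold exponents.
  - replace (- b) with (RtoC (IZR 0) - b) by (simpl; ring). now apply not_int_opp_plus.
  - replace (- b') with (RtoC (IZR 0) - b') by (simpl; ring). now apply not_int_opp_plus.
  - replace (b + b' - a - 2) with (b + b' - a + RtoC (IZR (-2)))
      by (replace (RtoC (IZR (-2))) with (- RtoC 2) by (apply C_eq; simpl; lra); ring).
    now apply not_int_plus.
Qed.

(** For these exponents p_1 + p_2 + p_3 + 3 = 1 - a, and the condition on a keeps this point off the
    poles of Gamma. The constant [C00] is assembled from two instances of this formula. *)
Lemma regularized_dirichlet a b b' eps : (0 < eps < 1 / 3)%R ->
  ~ is_int b -> ~ is_int b' -> ~ is_int (b + b' - a) -> (forall n : nat, a <> RtoC (INR (S n))) ->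
  let p := exponents a b b' in
  chain_int eps p p * Cgamma (1 - a) = Cgamma (1 - b) * Cgamma (1 - b') * Cgamma (b + b' - a - 1)
  /\ Cgamma (1 - b) * Cgamma (1 - b') * Cgamma (b + b' - a - 1) <> 0.
Proof.
  intros He Hb Hb' Hab Ha p.
  pose proof (exponents_not_int a b b' Hb Hb' Hab) as Hp. fold p in Hp.
  assert (Hq : forall i, not_nonpos_int (p i + 1)).
  { intro i. apply not_int_not_nonpos. apply (not_int_plus _ 1). apply Hp. }
  assert (E : p L1 + p L2 + p L3 + 3 = 1 - a) by (unfold p, exponents; ring).
  assert (E1 : p L1 + 1 = 1 - b) by (unfold p, exponents; ring).
  assert (E2 : p L2 + 1 = 1 - b') by (unfold p, exponents; ring).
  assert (E3 : p L3 + 1 = b + b' - a - 1) by (unfold p, exponents; ring).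
  assert (Hs : not_nonpos_int (p L1 + p L2 + p L3 + 3)).
  { rewrite E. intros n Hn. apply (Ha n). rewrite S_INR, RtoC_plus.
    replace a with (1 + INR n - (1 - a + INR n)) by ring. rewrite Hn. ring. }
  pose proof (chain_gamma eps He p (fun i => monodromy_neq_0 _ (Hp i)) Hq Hs) as G.
  rewrite E, E1, E2, E3 in G. split; [exact G|].
  rewrite <- E1, <- E2, <- E3.
  repeat apply Cmult_neq_0; apply Cgamma_spec, Hq.
Qed.

Lemma Csum_csum {T} (f : T -> nat -> C) (l : list T) N :
  Csum (fun x => csum (f x) N) l = csum (fun n => Csum (fun x => f x n) l) N.
Proof.
  induction l as [|x l IH]; simpl.
  - induction N as [|N IHN]; simpl; [reflexivity | rewrite <- IHN; ring].
  - rewrite IH, <- csum_plus. reflexivity.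
Qed.

Lemma Csum2_csum2 {T} (g : T -> T -> C) (f : nat -> nat -> T -> T -> C) (l l' : list T) N :
  Csum (fun x => Csum (fun y => g x y * csum (fun i => csum (fun j => f i j x y) N) N) l') l
  = csum (fun i => csum (fun j => Csum (fun x => Csum (fun y => g x y * f i j x y) l') l) N) N.
Proof.
  transitivity (Csum (fun x => csum (fun i => csum (fun j => Csum (fun y => g x y * f i j x y) l') N) N) l).
  - apply Csum_ext. intros x _.
    transitivity (Csum (fun y => csum (fun i => csum (fun j => g x y * f i j x y) N) N) l').
    + apply Csum_ext. intros y _. rewrite <- csum_scal. apply csum_ext. intros i _. now rewrite <- csum_scal.
    + rewrite (Csum_csum (fun y i => csum (fun j => g x y * f i j x y) N)). apply csum_ext. intros i _.
      apply (Csum_csum (fun y j => g x y * f i j x y)).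
  - rewrite (Csum_csum (fun x i => csum (fun j => Csum (fun y => g x y * f i j x y) l') N)).
    apply csum_ext. intros i _. apply (Csum_csum (fun x j => Csum (fun y => g x y * f i j x y) l')).
Qed.

Lemma Csum_product {T} (a A b B : T -> C) (k : C) (l l' : list T) :
  Csum (fun x => Csum (fun y => a x * b y * (k * (A x * B y))) l') l
  = k * (Csum (fun x => a x * A x) l * Csum (fun y => b y * B y) l').
Proof.
  rewrite (Csum_ext _ (fun x => (k * Csum (fun y => b y * B y) l') * (a x * A x))).
  - rewrite Csum_scal. ring.
  - intros x _. rewrite (Csum_ext _ (fun y => (a x * A x * k) * (b y * B y))); [|intros; ring].
    rewrite Csum_scal. ring.
Qed.

(** * From the integrals over the chain to the hypergeometric series *)

Section Representation.
Context (a1 a2 a3 b1 b2 b3 b4 : C) (eps1 eps2 : R).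
Hypothesis (heps1 : (0 < eps1 < 1 / 3)%R) (heps2 : (0 < eps2 < 1 / 3)%R).

Let p := exponents a1 b1 b3.
Let p' := exponents a2 b2 b4.
Let D1 := Delta1 a1 b1 b3 eps1.
Let D2 := Delta2 a2 b2 b4 eps2.

(* On the tori |t_j| = eps the two quotients can be given independent phases. *)
Lemma close_to_0_norm x1 x2 : close_to_0 D1 D2 x1 x2 -> (Cmod x1 + Cmod x2 < eps1 * eps2)%R.
Proof.
  intro H.
  destruct (polar x1) as [u1 [Hu1 E1]]. destruct (polar x2) as [u2 [Hu2 E2]].
  assert (I0 : I01 0) by (lra).
  specialize (H (circle eps1 u1) (circle eps2 0) (circle eps1 u2) (circle eps2 0)
    (support_torus eps1 p u1 u2 Hu1 Hu2) (support_torus eps2 p' 0 0 I0 I0)).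
  assert (D : forall r u, circle r u / (circle eps1 u * circle eps2 0) = RtoC (r / (eps1 * eps2))).
  { intros r u. rewrite circle_0. unfold circle.
    rewrite RtoC_div, RtoC_mult by nra. field. repeat split; [apply RtoC_neq_0; lra | apply RtoC_neq_0; lra | apply Cexp_neq_0]. }
  rewrite <- E1, <- E2, !D, <- RtoC_plus, Cmod_R in H.
  pose proof (Cmod_ge_0 x1). pose proof (Cmod_ge_0 x2).
  assert (P : (0 < eps1 * eps2)%R) by nra.
  rewrite Rabs_pos_eq in H by (rewrite <- Rdiv_plus_distr; apply Rdiv_le_0_compat; lra).
  apply (Rmult_lt_compat_r (eps1 * eps2)) in H; [|assumption].
  rewrite <- Rdiv_plus_distr in H. unfold Rdiv in H. rewrite Rmult_assoc, Rinv_l in H by lra. lra.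
Qed.

Lemma quotient_bound x1 x2 t1 t2 t3 t4 :
  (eps1 <= Cmod t1)%R -> (eps2 <= Cmod t2)%R -> (eps1 <= Cmod t3)%R -> (eps2 <= Cmod t4)%R ->
  (Cmod (x1 / (t1 * t2)) + Cmod (x2 / (t3 * t4)) <= (Cmod x1 + Cmod x2) / (eps1 * eps2))%R.
Proof.
  intros H1 H2 H3 H4.
  assert (P : forall x s t, (eps1 <= Cmod s)%R -> (eps2 <= Cmod t)%R ->
    (Cmod (x / (s * t)) <= Cmod x / (eps1 * eps2))%R).
  { intros x s t Hs Ht.
    assert (s <> 0) by (apply Cmod_gt_0; lra). assert (t <> 0) by (apply Cmod_gt_0; lra).
    rewrite Cmod_div, Cmod_mult by (now apply Cmult_neq_0).
    apply Rmult_le_compat_l; [apply Cmod_ge_0|]. apply Rinv_le_contravar; [nra|].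
    apply Rmult_le_compat; lra. }
  rewrite Rdiv_plus_distr. apply Rplus_le_compat; now apply P.
Qed.

Lemma close_to_0_exists : exists delta, (0 < delta)%R /\
  forall x1 x2 : C, (Cmod x1 < delta)%R -> (Cmod x2 < delta)%R -> close_to_0 D1 D2 x1 x2.
Proof.
  assert (P : (0 < eps1 * eps2)%R) by nra.
  exists (eps1 * eps2 / 2)%R. split; [lra|].
  intros x1 x2 H1 H2 t1 t2 t3 t4 HS HS'.
  destruct (support_ge eps1 heps1 _ _ _ HS) as [A1 A3]. destruct (support_ge eps2 heps2 _ _ _ HS') as [A2 A4].
  eapply Rle_lt_trans; [apply Cmod_triangle|].
  eapply Rle_lt_trans; [now apply quotient_bound|].
  apply (Rmult_lt_reg_r (eps1 * eps2)); [assumption|].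
  unfold Rdiv. rewrite Rmult_assoc, Rinv_l by lra. lra.
Qed.

Lemma close_to_0_not_in_Q x1 x2 t1 t2 t3 t4 : close_to_0 D1 D2 x1 x2 ->
  in_support D1 t1 t3 -> in_support D2 t2 t4 -> ~ in_Q x1 x2 t1 t2 t3 t4.
Proof.
  intros H HS HS' HQ. unfold in_Q in HQ.
  destruct (support_ge eps1 heps1 _ _ _ HS) as [A1 A3]. destruct (support_ge eps2 heps2 _ _ _ HS') as [A2 A4].
  assert (t1 <> 0) by (apply Cmod_gt_0; lra). assert (t2 <> 0) by (apply Cmod_gt_0; lra).
  assert (t3 <> 0) by (apply Cmod_gt_0; lra). assert (t4 <> 0) by (apply Cmod_gt_0; lra).
  specialize (H t1 t2 t3 t4 HS HS').
  assert (E : x1 / (t1 * t2) + x2 / (t3 * t4) = 1).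
  { apply C_sub_eq_0.
    replace (x1 / (t1 * t2) + x2 / (t3 * t4) - 1)
      with (- (t1 * t2 * t3 * t4 - t3 * t4 * x1 - t1 * t2 * x2) / (t1 * t2 * t3 * t4))
      by (field; repeat split; assumption).
    rewrite HQ. field. repeat split; assumption. }
  rewrite E, Cmod_1 in H. lra.
Qed.

Context (x1 x2 : C).

(** In the (i, j) term of the binomial series, [co i j] is the part free of t; the powers (t_1
    t_2)^(-i) (t_3 t_4)^(-j) are absorbed into the exponents [q i j] and [q' i j]. *)
Let co i j := poch a3 (i + j) / (RtoC (INR (fact i)) * RtoC (INR (fact j))) * x1 ^ i * x2 ^ j.
Let q i j := exponents (a1 + RtoC (INR (i + j))) (b1 + RtoC (INR i)) (b3 + RtoC (INR j)).
Let q' i j := exponents (a2 + RtoC (INR (i + j))) (b2 + RtoC (INR i)) (b4 + RtoC (INR j)).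

Lemma u_integrand_wt P P' :
  u_integrand a1 a2 a3 b1 b2 b3 b4 x1 x2 P P' = wt p P * wt p' P' *
    Cexp (- a3 * Clog (1 - x1 / (form P L1 * form P' L1) - x2 / (form P L2 * form P' L2))).
Proof.
  unfold u_integrand, bpow, wt, p, p', exponents. rewrite !Cexp_plus. ring.
Qed.

(** The binomial series converges uniformly on the pair of cells and may be integrated termwise;
    every term separates into a function on [c] times a function on [c']. *)
Lemma cell_integral_limit k c k' c' : (Cmod x1 + Cmod x2 < eps1 * eps2)%R ->
  In (k, c) D1 -> In (k', c') D2 ->
  clim (fun N => csum (fun i => csum (fun j => co i j * (cell_int (q i j) c * cell_int (q' i j) c')) N) N)
       (cell_integral (u_integrand a1 a2 a3 b1 b2 b3 b4 x1 x2) c c').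
Proof.
  intros Hx Hc Hc'.
  destruct (reg_cell_param eps1 heps1 p k c Hc) as (m & z & w & zu & wu & wv & wuv & H).
  destruct (reg_cell_param eps2 heps2 p' k' c' Hc') as (m' & z' & w' & zu' & wu' & wv' & wuv' & H').
  destruct (ccont2_bounded _ (pc_cont_integrand H p)) as [M HM].
  destruct (ccont2_bounded _ (pc_cont_integrand H' p')) as [M' HM'].
  assert (Pe : (0 < eps1 * eps2)%R) by nra.
  set (rho0 := ((Cmod x1 + Cmod x2) / (eps1 * eps2))%R).
  assert (Hrho0 : (rho0 < 1)%R).
  { unfold rho0. apply (Rmult_lt_reg_r (eps1 * eps2)); [assumption|].
    unfold Rdiv. rewrite Rmult_assoc, Rinv_l by lra. lra. }
  (* [double_binomial] asks for a positive radius, whereas [rho0] is 0 when x_1 = x_2 = 0. *)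
  set (rho := Rmax rho0 (1 / 2)).
  assert (Hrho : (0 < rho < 1)%R).
  { unfold rho. split; [eapply Rlt_le_trans; [|apply Rmax_r]; lra | apply Rmax_lub_lt; lra]. }
  destruct (double_binomial a3 rho Hrho) as [tau [Ht0 Ht]].
  apply (nint4_limit (fun N u v u' v' => csum (fun i => csum (fun j =>
     co i j * ((wt (q i j) (c u v) * jacobian c u v) * (wt (q' i j) (c' u' v') * jacobian c' u' v'))) N) N)
     _ (fun u v u' v' => u_integrand a1 a2 a3 b1 b2 b3 b4 x1 x2 (c u v) (c' u' v') * jacobian c u v * jacobian c' u' v')
     (fun N => M * M' * tau N)%R).
  - intro N.
    apply (nint4_csum (fun i u v u' v' => csum (fun j =>
     co i j * ((wt (q i j) (c u v) * jacobian c u v) * (wt (q' i j) (c' u' v') * jacobian c' u' v'))) N)). intro i.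
    apply (nint4_csum (fun j u v u' v' =>
     co i j * ((wt (q i j) (c u v) * jacobian c u v) * (wt (q' i j) (c' u' v') * jacobian c' u' v')))). intro j.
    apply nint4_scal.
    apply (nint4_product (fun u v => wt (q i j) (c u v) * jacobian c u v)
            (fun u' v' => wt (q' i j) (c' u' v') * jacobian c' u' v'));
      [eapply pc_cont_integrand, H | eapply pc_cont_integrand, H'].
  - replace (Finite 0) with (Rbar_mult (M * M')%R 0) by (simpl; f_equal; ring).
    now apply is_lim_seq_scal_l.
  - intros N u v u' v' Hu Hv Hu' Hv'.
    set (t1 := form (c u v) L1). set (t3 := form (c u v) L2).
    set (t2 := form (c' u' v') L1). set (t4 := form (c' u' v') L2).
    assert (A1 := reg_form_ge eps1 heps1 p k c Hc u v L1 Hu Hv). assert (A3 := reg_form_ge eps1 heps1 p k c Hc u v L2 Hu Hv).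
    assert (A2 := reg_form_ge eps2 heps2 p' k' c' Hc' u' v' L1 Hu' Hv'). assert (A4 := reg_form_ge eps2 heps2 p' k' c' Hc' u' v' L2 Hu' Hv').
    fold t1 in A1. fold t2 in A2. fold t3 in A3. fold t4 in A4.
    assert (t1 <> 0) by (apply Cmod_gt_0; lra). assert (t2 <> 0) by (apply Cmod_gt_0; lra).
    assert (t3 <> 0) by (apply Cmod_gt_0; lra). assert (t4 <> 0) by (apply Cmod_gt_0; lra).
    set (y1 := x1 / (t1 * t2)). set (y2 := x2 / (t3 * t4)).
    assert (Hy : (Cmod y1 + Cmod y2 <= rho)%R).
    { eapply Rle_trans; [now apply quotient_bound | apply Rmax_l]. }
    set (W := wt p (c u v) * jacobian c u v). set (W' := wt p' (c' u' v') * jacobian c' u' v').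
    assert (E : csum (fun i => csum (fun j =>
        co i j * ((wt (q i j) (c u v) * jacobian c u v) * (wt (q' i j) (c' u' v') * jacobian c' u' v'))) N) N
      = W * W' * double_partial_sum (binom_term a3 y1 y2) N).
    { unfold double_partial_sum. rewrite sum_n_csum, <- csum_scal. apply csum_ext. intros i _.
      rewrite sum_n_csum, <- csum_scal. apply csum_ext. intros j _.
      unfold q, q'. rewrite (wt_exponents_shift eps1 heps1 p k c a1 b1 b3 i j u v Hc Hu Hv).
      rewrite (wt_exponents_shift eps2 heps2 p' k' c' a2 b2 b4 i j u' v' Hc' Hu' Hv').
      unfold binom_term, y1, y2, co. rewrite !Cpow_div_mult by assumption.
      unfold W, W', p, p'. fold t1 t2 t3 t4. ring. }
    rewrite E, u_integrand_wt. fold t1 t2 t3 t4 y1 y2.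
    replace (W * W' * double_partial_sum (binom_term a3 y1 y2) N -
       wt p (c u v) * wt p' (c' u' v') * Cexp (- a3 * Clog (1 - y1 - y2)) * jacobian c u v * jacobian c' u' v')
      with (W * W' * (double_partial_sum (binom_term a3 y1 y2) N - Cexp (- a3 * Clog (1 - y1 - y2))))
      by (unfold W, W'; ring).
    rewrite !Cmod_mult.
    apply Rmult_le_compat; [apply Rmult_le_pos; apply Cmod_ge_0 | apply Cmod_ge_0 | | now apply Ht].
    apply Rmult_le_compat; try apply Cmod_ge_0; [now apply HM | now apply HM'].
Qed.

Hypothesis (hb1 : ~ is_int b1) (hb2 : ~ is_int b2) (hb3 : ~ is_int b3) (hb4 : ~ is_int b4).
Hypothesis (hb13 : ~ is_int (b1 + b3 - a1)) (hb24 : ~ is_int (b2 + b4 - a2)).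
Hypothesis (ha1 : forall n : nat, a1 <> RtoC (INR (S n))).
Hypothesis (ha2 : forall n : nat, a2 <> RtoC (INR (S n))).

(** The shifted integral is (a)_(i+j) / ((b)_i (b')_j) times the unshifted one, on each of the two
    factors, and [C00] is the inverse of the product of the unshifted integrals. *)
Lemma F_term_chain i j :
  F_term a1 a2 a3 b1 b2 b3 b4 x1 x2 i j
  = C00 a1 a2 b1 b2 b3 b4 * (co i j * (chain_int eps1 p (q i j) * chain_int eps2 p' (q' i j))).
Proof.
  destruct (regularized_dirichlet a1 b1 b3 eps1 heps1 hb1 hb3 hb13 ha1) as [G1 N1]. fold p in G1.
  destruct (regularized_dirichlet a2 b2 b4 eps2 heps2 hb2 hb4 hb24 ha2) as [G2 N2]. fold p' in G2.
  pose proof (exponents_shift eps1 heps1 p a1 b1 b3 i j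
    (fun l => monodromy_neq_0 _ (exponents_not_int a1 b1 b3 hb1 hb3 hb13 l)) (fun l => eq_refl)) as S1.
  pose proof (exponents_shift eps2 heps2 p' a2 b2 b4 i j
    (fun l => monodromy_neq_0 _ (exponents_not_int a2 b2 b4 hb2 hb4 hb24 l)) (fun l => eq_refl)) as S2.
  fold (q i j) p in S1. fold (q' i j) p' in S2.
  assert (P1 : poch b1 i <> 0) by now apply poch_neq_0, not_int_not_nonpos.
  assert (P2 : poch b2 i <> 0) by now apply poch_neq_0, not_int_not_nonpos.
  assert (P3 : poch b3 j <> 0) by now apply poch_neq_0, not_int_not_nonpos.
  assert (P4 : poch b4 j <> 0) by now apply poch_neq_0, not_int_not_nonpos.
  (* The nonvanishing of the Gamma products, included in [regularized_dirichlet], permits the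
     cancellation. *)
  assert (C0 : C00 a1 a2 b1 b2 b3 b4 * (chain_int eps1 p p * chain_int eps2 p' p') = 1).
  { unfold C00.
    set (g1 := Cgamma (1 - b1)) in *. set (g2 := Cgamma (1 - b2)) in *. set (g3 := Cgamma (1 - b3)) in *.
    set (g4 := Cgamma (1 - b4)) in *. set (h1 := Cgamma (b1 + b3 - a1 - 1)) in *.
    set (h2 := Cgamma (b2 + b4 - a2 - 1)) in *.
    replace (g1 * g3 * h1 * g2 * g4 * h2) with ((g1 * g3 * h1) * (g2 * g4 * h2)) by ring.
    transitivity ((chain_int eps1 p p * Cgamma (1 - a1)) * (chain_int eps2 p' p' * Cgamma (1 - a2))
       / ((g1 * g3 * h1) * (g2 * g4 * h2))).
    - unfold Cdiv. ring.
    - rewrite G1, G2. unfold Cdiv. apply Cinv_r. now apply Cmult_neq_0. }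
  set (J1 := chain_int eps1 p p) in *. set (J2 := chain_int eps2 p' p') in *.
  set (X1 := chain_int eps1 p (q i j)) in *. set (X2 := chain_int eps2 p' (q' i j)) in *.
  assert (Q1 : X1 = poch a1 (i + j) * J1 / (poch b1 i * poch b3 j)) by (rewrite <- S1; field; split; assumption).
  assert (Q2 : X2 = poch a2 (i + j) * J2 / (poch b2 i * poch b4 j)) by (rewrite <- S2; field; split; assumption).
  rewrite Q1, Q2. unfold F_term, co. rewrite !poch_1.
  transitivity ((C00 a1 a2 b1 b2 b3 b4 * (J1 * J2)) * (poch a1 (i + j) * poch a2 (i + j) * poch a3 (i + j)
    / (poch b1 i * poch b2 i * INR (fact i) * poch b3 j * poch b4 j * INR (fact j)) * x1 ^ i * x2 ^ j)).
  - rewrite C0. ring.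
  - field. repeat split; try assumption; apply RtoC_fact_neq_0.
Qed.

(** By [F_term_chain] a term is at most a constant times |[co i j]| (eps1 eps2)^(-(i+j)). This is a
    binomial term at a point with r1 + r2 < 1, hence dominated by a double geometric series. *)
Lemma F_term_summable : (Cmod x1 + Cmod x2 < eps1 * eps2)%R ->
  abs_summable (F_term a1 a2 a3 b1 b2 b3 b4 x1 x2).
Proof.
  intro Hx.
  assert (Pe : (0 < eps1 * eps2)%R) by nra.
  destruct (chain_int_bound eps1 heps1 p a1 b1 b3) as [M1 [HM10 HM1]].
  destruct (chain_int_bound eps2 heps2 p' a2 b2 b4) as [M2 [HM20 HM2]].
  set (r1 := (Cmod x1 / (eps1 * eps2))%R). set (r2 := (Cmod x2 / (eps1 * eps2))%R).
  assert (Hr1 : (0 <= r1)%R) by (apply Rdiv_le_0_compat; [apply Cmod_ge_0 | assumption]).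
  assert (Hr2 : (0 <= r2)%R) by (apply Rdiv_le_0_compat; [apply Cmod_ge_0 | assumption]).
  assert (Hr : (r1 + r2 < 1)%R).
  { unfold r1, r2. rewrite <- Rdiv_plus_distr. apply (Rmult_lt_reg_r (eps1 * eps2)); [assumption|].
    unfold Rdiv. rewrite Rmult_assoc, Rinv_l by lra. lra. }
  set (rho := Rmax (r1 + r2) (1 / 2)).
  assert (Hrho : (0 < rho < 1)%R).
  { unfold rho. split; [eapply Rlt_le_trans; [|apply Rmax_r]; lra | apply Rmax_lub_lt; lra]. }
  set (sg := ((1 + rho) / 2)%R). assert (Hsg : (rho < sg < 1)%R) by (unfold sg; lra).
  destruct (binom_term_bound a3 rho sg ltac:(lra) ltac:(lra)) as [K [HK0 HK]].
  set (L := (Cmod (C00 a1 a2 b1 b2 b3 b4) * (M1 * M2) * K)%R).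
  assert (HL : (0 <= L)%R).
  { unfold L. repeat apply Rmult_le_pos; try assumption. apply Cmod_ge_0. }
  assert (B : forall i j, (Cmod (F_term a1 a2 a3 b1 b2 b3 b4 x1 x2 i j) <= L * sg ^ i * sg ^ j)%R).
  { intros i j. rewrite F_term_chain, !Cmod_mult.
    pose proof (HM1 i j) as B1. pose proof (HM2 i j) as B2. fold (q i j) in B1. fold (q' i j) in B2.
    pose proof (HK r1 r2 i j Hr1 Hr2 (Rmax_l _ _)) as B3.
    set (X1 := Cmod (chain_int eps1 p (q i j))) in *. set (X2 := Cmod (chain_int eps2 p' (q' i j))) in *.
    pose proof (Cmod_binom_term a3 x1 x2 i j) as B4. change (binom_term a3 x1 x2 i j) with (co i j) in B4.
    assert (B5 : (X1 * X2 <= M1 * M2 * ((/ eps1) ^ (i + j) * (/ eps2) ^ (i + j)))%R).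
    { replace (M1 * M2 * ((/ eps1) ^ (i + j) * (/ eps2) ^ (i + j)))%R
        with ((M1 * (/ eps1) ^ (i + j)) * (M2 * (/ eps2) ^ (i + j)))%R by ring.
      apply Rmult_le_compat; try assumption; apply Cmod_ge_0. }
    assert (B6 : (Cmod (co i j) * ((/ eps1) ^ (i + j) * (/ eps2) ^ (i + j)) <= K * sg ^ (i + j))%R).
    { rewrite B4. eapply Rle_trans; [|exact B3]. right.
      assert (Ep : forall n x, ((x / (eps1 * eps2)) ^ n = x ^ n * ((/ eps1) ^ n * (/ eps2) ^ n))%R).
      { intros n x. rewrite <- !Rpow_mult_distr. f_equal. field. lra. }
      unfold r1, r2. rewrite !Ep, !pow_add. ring. }
    replace (L * sg ^ i * sg ^ j)%R with (Cmod (C00 a1 a2 b1 b2 b3 b4) * ((M1 * M2) * (K * sg ^ (i + j))))%R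
      by (unfold L; rewrite pow_add; ring).
    apply Rmult_le_compat_l; [apply Cmod_ge_0|].
    eapply Rle_trans; [apply Rmult_le_compat_l; [apply Cmod_ge_0 | exact B5]|].
    replace (Cmod (co i j) * (M1 * M2 * ((/ eps1) ^ (i + j) * (/ eps2) ^ (i + j))))%R
      with (M1 * M2 * (Cmod (co i j) * ((/ eps1) ^ (i + j) * (/ eps2) ^ (i + j))))%R by ring.
    apply Rmult_le_compat_l; [now apply Rmult_le_pos | exact B6]. }
  assert (G : forall (f : nat -> R) c N, (0 <= c)%R -> (forall n, f n <= c * sg ^ n)%R ->
            (sum_n f N <= c / (1 - sg))%R).
  { intros f c N Hc Hf.
    assert (A : (sum_n f N <= c * (1 - sg ^ S N) / (1 - sg))%R).
    { induction N as [|N IH].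
      - rewrite sum_O. eapply Rle_trans; [apply Hf|]. right. simpl. field. lra.
      - rewrite sum_Sn. unfold plus; simpl.
        eapply Rle_trans; [apply Rplus_le_compat; [exact IH | apply Hf]|]. right. simpl. field. lra. }
    eapply Rle_trans; [exact A|]. unfold Rdiv. apply Rmult_le_compat_r.
    - left. apply Rinv_0_lt_compat. lra.
    - pose proof (pow_le sg (S N) ltac:(lra)). nra. }
  exists (L / (1 - sg) / (1 - sg))%R. intro N.
  apply G; [apply Rdiv_le_0_compat; lra|]. intro i.
  eapply Rle_trans; [apply (G _ (L * sg ^ i)%R); [|intro j; apply B]|].
  - apply Rmult_le_pos; [assumption | apply pow_le; lra].
  - right. field. lra.
Qed.

Lemma F_eq_integral : (Cmod x1 + Cmod x2 < eps1 * eps2)%R ->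
  F a1 a2 a3 b1 b2 b3 b4 x1 x2
  = C00 a1 a2 b1 b2 b3 b4 * product_integral D1 D2 (u_integrand a1 a2 a3 b1 b2 b3 b4 x1 x2).
Proof.
  intro Hx. unfold F. apply Clim_seq_clim.
  set (cc := C00 a1 a2 b1 b2 b3 b4).
  apply (clim_ext (fun N => cc * Csum (fun kc => Csum (fun kc' => fst kc * fst kc' *
    csum (fun i => csum (fun j => co i j * (cell_int (q i j) (snd kc) * cell_int (q' i j) (snd kc'))) N) N) D2) D1)).
  - intro N. unfold double_partial_sum. rewrite sum_n_csum.
    rewrite (csum_ext _ (fun i => cc * csum (fun j => co i j * (chain_int eps1 p (q i j) * chain_int eps2 p' (q' i j))) N)).
    2:{ intros i _. rewrite sum_n_csum, <- csum_scal. apply csum_ext. intros j _. apply F_term_chain. }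
    rewrite csum_scal. apply (f_equal (Cmult cc)).
    rewrite (Csum2_csum2 (fun kc kc' => fst kc * fst kc')
      (fun i j kc kc' => co i j * (cell_int (q i j) (snd kc) * cell_int (q' i j) (snd kc')))).
    apply csum_ext. intros i _. apply csum_ext. intros j _.
    apply (Csum_product (fun kc => fst kc) (fun kc => cell_int (q i j) (snd kc))
             (fun kc => fst kc) (fun kc => cell_int (q' i j) (snd kc))).
  - apply clim_mult; [apply clim_const|]. unfold product_integral.
    apply (clim_Csum (fun kc N => Csum (fun kc' => fst kc * fst kc' *
      csum (fun i => csum (fun j => co i j * (cell_int (q i j) (snd kc) * cell_int (q' i j) (snd kc'))) N) N) D2)).
    intros [k c] Hc.
    apply (clim_Csum (fun kc' N => fst (k, c) * fst kc' *
      csum (fun i => csum (fun j => co i j * (cell_int (q i j) (snd (k, c)) * cell_int (q' i j) (snd kc'))) N) N)).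
    intros [k' c'] Hc'. apply clim_mult; [apply clim_const|].
    exact (cell_integral_limit k c k' c' Hx Hc Hc').
Qed.

End Representation.

Theorem theorem3p1
  (a1 a2 a3 b1 b2 b3 b4 : C)
  (hb1 : ~ is_int b1) (hb2 : ~ is_int b2)
  (hb3 : ~ is_int b3) (hb4 : ~ is_int b4)
  (hb13 : ~ is_int (b1 + b3 - a1)) (hb24 : ~ is_int (b2 + b4 - a2))
  (ha1 : forall n : nat, a1 <> RtoC (INR (S n)))
  (ha2 : forall n : nat, a2 <> RtoC (INR (S n)))
  (eps1 eps2 : R)
  (heps1 : (0 < eps1 < 1 / 3)%R) (heps2 : (0 < eps2 < 1 / 3)%R) :
  let D1 := Delta1 a1 b1 b3 eps1 in
  let D2 := Delta2 a2 b2 b4 eps2 in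
  (exists delta : R, (0 < delta)%R /\
     forall x1 x2 : C, (Cmod x1 < delta)%R -> (Cmod x2 < delta)%R ->
       close_to_0 D1 D2 x1 x2)
  /\
  (forall x1 x2 : C, close_to_0 D1 D2 x1 x2 ->
     (forall t1 t2 t3 t4 : C,
        in_support D1 t1 t3 -> in_support D2 t2 t4 ->
        ~ in_Q x1 x2 t1 t2 t3 t4)
     /\ abs_summable (F_term a1 a2 a3 b1 b2 b3 b4 x1 x2)
     /\ F a1 a2 a3 b1 b2 b3 b4 x1 x2 =
        C00 a1 a2 b1 b2 b3 b4 *
        product_integral D1 D2 (u_integrand a1 a2 a3 b1 b2 b3 b4 x1 x2)).
Proof.
  intros D1 D2. split; [now apply close_to_0_exists|].
  intros x1 x2 H.
  pose proof (close_to_0_norm _ _ _ _ _ _ eps1 eps2 heps1 heps2 x1 x2 H) as Hx.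
  split; [|split].
  - intros t1 t2 t3 t4. now apply (close_to_0_not_in_Q a1 a2 b1 b2 b3 b4 eps1 eps2).
  - now apply (F_term_summable a1 a2 a3 b1 b2 b3 b4 eps1 eps2).
  - now apply F_eq_integral.
Qed.
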